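(* Let $\Omega\subset\mathbb{R}^n$ be an open set such that either $\Omega$ is bounded with Lipschitz boundary or $\Omega=\mathbb{R}^n$. For every $f\in BV(\mathbb{R}^n)$, $$\Gamma(L^1)\text{-}\lim_{\alpha\to1^-}|D^\alpha f|(\Omega)=|Df|(\Omega).$$
   Context: Here $n\in\mathbb{N}$, $n\ge1$, and $|Df|$ is the total variation of the distributional gradient of $f$. For $\alpha\in(0,1)$ let $\mu_{n,\alpha}:=2^\alpha\pi^{-n/2}\,\Gamma\big(\tfrac{n+\alpha+1}{2}\big)/\Gamma\big(\tfrac{1-\alpha}{2}\big)$, and for $\varphi\in C^\infty_c(\mathbb{R}^n;\mathbb{R}^n)$ let $$\mathrm{div}^\alpha\varphi(x):=\mu_{n,\alpha}\int_{\mathbb{R}^n}\frac{(y-x)\cdot(\varphi(y)-\varphi(x))}{|y-x|^{n+\alpha+1}}\,dy,\qquad x\in\mathbb{R}^n,$$ which belongs to $L^1(\mathbb{R}^n)\cap L^\infty(\mathbb{R}^n)$. For $g\in L^1(\mathbb{R}^n)$ and $\Omega$ open, $$|D^\alpha g|(\Omega):=\sup\Big\{\int_{\mathbb{R}^n} g\,\mathrm{div}^\alpha\varphi\,dx:\ \varphi\in C^\infty_c(\Omega;\mathbb{R}^n),\ \|\varphi\|_{L^\infty(\Omega;\mathbb{R}^n)}\le1\Big\}\in[0,+\infty].$$ The $\Gamma$-limit is taken for the functionals $g\mapsto|D^\alpha g|(\Omega)$ on the metric space $L^1(\mathbb{R}^n)$. Explicitly, the claim means: for every family $(f_\alpha)_{\alpha\in(0,1)}\subset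 L^1(\mathbb{R}^n)$ with $f_\alpha\to f$ in $L^1(\mathbb{R}^n)$ as $\alpha\to1^-$ one has $|Df|(\Omega)\le\liminf_{\alpha\to1^-}|D^\alpha f_\alpha|(\Omega)$, and there exists such a family with $\limsup_{\alpha\to1^-}|D^\alpha f_\alpha|(\Omega)\le|Df|(\Omega)$. *)

(* Defs.v *)
From HB Require Import structures.
From mathcomp Require Import all_boot all_order all_algebra.
From mathcomp Require Import all_classical all_reals all_analysis.
From mathcomp Require Import measurable_realfun.

Set Implicit Arguments.
Unset Strict Implicit.
Unset Printing Implicit Defensive.

Import Order.TTheory GRing.Theory Num.Theory.
Import numFieldNormedType.Exports.

Local Open Scope classical_set_scope.
Local Open Scope ring_scope.

Section borel_rV.
Context {R : realType} (n : nat).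

Definition borel_rV : set (set 'rV[R]_n) := <<s @open 'rV[R]_n >>.

Let borel_rV0 : borel_rV set0.
Proof. exact: sigma_algebra0. Qed.

Let borel_rVC A : borel_rV A -> borel_rV (~` A).
Proof. exact: sigma_algebraC. Qed.

Let borel_rV_bigcup (F : (set 'rV[R]_n)^nat) :
  (forall i, borel_rV (F i)) -> borel_rV (\bigcup_i F i).
Proof. exact: sigma_algebra_bigcup. Qed.

HB.instance Definition _ := @isMeasurable.Build default_measure_display
  'rV[R]_n borel_rV borel_rV0 borel_rVC borel_rV_bigcup.

End borel_rV.

Section measurability.
Context {R : realType}.

Lemma open_measurable_rV n (U : set 'rV[R]_n) : open U -> measurable U.
Proof. exact: sub_sigma_algebra. Qed.

(* Every open set is a countable union of boxes with rational centre, so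
   measurability into the Borel space 'rV_n can be checked coordinatewise. *)
Lemma measurable_fun_rV d (T : measurableType d) n (f : T -> 'rV[R]_n) :
  (forall i, measurable_fun setT (fun t => f t ord0 i : R)) ->
  measurable_fun setT f.
Proof.
move=> mf; apply: measurability => [|_ [U oU <-]]; first by [].
rewrite setTI.
pose q (c : {ffun 'I_n -> rat}) : 'rV[R]_n := \row_i ratr (c i).
pose B (p : {ffun 'I_n -> rat} * nat) : set 'rV[R]_n :=
  if pselect (ball (q p.1) p.2.+1%:R^-1 `<=` U)
  then ball (q p.1) p.2.+1%:R^-1 else set0.
have -> : U = \bigcup_p B p.
  rewrite eqEsubset; split=> [x Ux|x [p _]]; last first.
    by rewrite /B; case: pselect => // H; exact: H.
  have /nbhs_ballP[e /= e0 xeU] : nbhs x U by move: oU; rewrite openE; exact.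
  have [k ke] : exists k : nat, k.+1%:R^-1 < e / 2 :> R.
    have e20 : 0 < e / 2 by rewrite divr_gt0.
    exists (Num.truncn (e / 2)^-1).
    by rewrite invf_plt ?posrE// truncnS_gt.
  have k0 : 0 < k.+1%:R^-1 :> R by rewrite invr_gt0.
  have /= Q i : {r : rat | `|x ord0 i - ratr r| < k.+1%:R^-1}.
    apply: cid.
    have [r] := @rat_in_itvoo R (x ord0 i - k.+1%:R^-1) (x ord0 i + k.+1%:R^-1)
      ltac:(by rewrite ltrD2l gtrN).
    rewrite in_itv/= => rx; exists r.
    by rewrite distrC ltr_distl.
  pose c : {ffun 'I_n -> rat} := [ffun i => projT1 (Q i)].
  have xc : ball (q c) k.+1%:R^-1 x.
    split=> // i j; rewrite ord1 mxE ffunE /ball/= distrC.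
    exact: (projT2 (Q j)).
  exists (c, k) => //=; rewrite /B/=; case: pselect => // -[].
  move=> y qy; apply: xeU.
  have := ball_triangle (ball_sym xc) qy.
  by apply: le_ball; rewrite (splitr e) lerD// ltW.
rewrite preimage_bigcup; apply: countable_bigcupT_measurable => [|p].
  exact: countableP.
rewrite /B; case: pselect => pU; last by rewrite preimage_set0.
rewrite (_ : _ @^-1` _ =
  \bigcap_(i in [set: 'I_n])
    ((fun t => f t ord0 i) @^-1` ball (q p.1 ord0 i) p.2.+1%:R^-1)).
  apply: fin_bigcap_measurable => // i _; rewrite -[X in measurable X]setTI.
  by apply: mf => //; exact: measurable_ball.
rewrite eqEsubset; split=> t /=.
  by move=> [_ H] i _; exact: H.
move=> H; split=> [|i j]; first by rewrite invr_gt0.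
by rewrite ord1; exact: H.
Qed.


Definition cons_rV n (p : 'rV[R]_n * R) : 'rV[R]_n.+1 :=
  \row_i (if unlift ord0 i is Some j then p.1 ord0 j else p.2).

Lemma measurable_coord n (i : 'I_n) :
  measurable_fun setT (fun x : 'rV[R]_n => x ord0 i : R).
Proof.
apply: measurability; first exact: RGenOpens.measurableE.
move=> _ [_ [a [b ->]] <-]; rewrite setTI; apply: open_measurable_rV.
apply: open_comp; last exact: interval_open.
by move=> x _; exact: coord_continuous.
Qed.

Lemma measurable_cons_rV n : measurable_fun setT (@cons_rV n).
Proof.
apply: measurable_fun_rV => i.
rewrite /cons_rV; under eq_fun do rewrite mxE.
case: unliftP => [j _|_]; last exact: measurable_snd.
apply: (@measurableT_comp _ _ _ _ _ _ (fun x : 'rV[R]_n => x ord0 j)).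
  exact: measurable_coord.
exact: measurable_fst.
Qed.

Definition lebesgue_rV_succ n (mu : {measure set 'rV[R]_n -> \bar R}) :=
  pushforward (mu \x lebesgue_measure)%E (@cons_rV n).

HB.instance Definition _ n (mu : {measure set 'rV[R]_n -> \bar R}) :=
  Measure.copy (lebesgue_rV_succ mu)
    (measure_function_pushforward__canonical__measure_function_Measure
      (mu \x lebesgue_measure)%E (@measurable_cons_rV n)).

(* n-dimensional Lebesgue measure on the Borel sets of R^n, as the n-fold
   product of the one-dimensional Lebesgue measure. *)
Fixpoint lebesgue_rV (n : nat) : {measure set 'rV[R]_n -> \bar R} :=
  match n with
  | 0%N => dirac (0 : 'rV[R]_0)
  | m.+1 => lebesgue_rV_succ (lebesgue_rV m)
  end.

Lemma lebesgue_rV_box n (a b : 'rV[R]_n) : (forall i, a ord0 i <= b ord0 i) ->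
  lebesgue_rV n [set x | forall i, x ord0 i \in `[a ord0 i, b ord0 i]] =
  (\prod_(i < n) (b ord0 i - a ord0 i))%:E.
Proof.
elim: n => [|n IH] in a b *; move=> ab.
  by rewrite big_ord0 /= diracE mem_set// => -[].
rewrite big_ord_recl /= /lebesgue_rV_succ /pushforward.
set C := (X in (_ \x _)%E X).
pose a' : 'rV[R]_n := \row_j a ord0 (lift ord0 j).
pose b' : 'rV[R]_n := \row_j b ord0 (lift ord0 j).
pose D : set 'rV[R]_n :=
  [set x | forall i, x ord0 i \in `[a' ord0 i, b' ord0 i]].
have -> : C = D `*` `[a ord0 ord0, b ord0 ord0]%classic.
  rewrite eqEsubset; split=> -[x y] /= => [H|[H1 H2] i].
    split=> [i|].
      by have := H (lift ord0 i); rewrite !mxE liftK.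
    by have := H ord0; rewrite !mxE unlift_none.
  by rewrite mxE; case: unliftP => [j ->|->//]; have := H1 j; rewrite !mxE.
rewrite product_measure1E//; last first.
  rewrite (_ : D = \bigcap_(i in [set: 'I_n])
      ((fun x : 'rV[R]_n => x ord0 i) @^-1` `[a' ord0 i, b' ord0 i]%classic)).
    apply: fin_bigcap_measurable => // i _; rewrite -[X in measurable X]setTI.
    exact: measurable_coord.
  by rewrite eqEsubset; split=> x /= H i; [move=> _|]; exact: H.
transitivity ((\prod_(i < n) (b' ord0 i - a' ord0 i))%:E *
    (b ord0 ord0 - a ord0 ord0)%:E)%E.
  congr (_ * _)%E; first by apply: IH => i; rewrite !mxE.
  apply: (etrans (lebesgue_measure_itv `[a ord0 ord0, b ord0 ord0])) => /=.
  have := ab ord0; rewrite lte_fin le_eqVlt => /predU1P[->|->].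
    by rewrite ltxx subrr.
  by rewrite EFinB.
rewrite -EFinM mulrC; congr (_ * _)%:E.
by apply: eq_bigr => i _; rewrite !mxE.
Qed.

End measurability.

Section euclidean.
Context {R : realType} {n : nat}.
Implicit Types x y : 'rV[R]_n.

Definition dot x y : R := \sum_i x ord0 i * y ord0 i.

(* The library norm `|x| on 'rV_n is the sup norm. *)
Definition enorm x : R := Num.sqrt (dot x x).

End euclidean.

Definition Gamma {R : realType} (z : R) : R :=
  \int[lebesgue_measure]_(t in `]0, +oo[) (t `^ (z - 1) * expR (- t)).

Section test_fields.
Context {R : realType} {n : nat}.
Implicit Types (phi : 'rV[R]_n -> 'rV[R]_n) (Omega : set 'rV[R]_n).

Definition partial (i : 'I_n) phi : 'rV[R]_n -> 'rV[R]_n :=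
  'D_(delta_mx ord0 i) phi.

Definition partials (s : seq 'I_n) phi := foldr partial phi s.

Definition smooth phi := forall s : seq 'I_n, continuous (partials s phi) /\
  forall i x, derivable (partials s phi) x (delta_mx ord0 i).

Definition support_of phi := closure [set x | phi x != 0].

Definition Cc_infty Omega phi :=
  [/\ smooth phi, compact (support_of phi) & support_of phi `<=` Omega].

Definition Linfty_norm Omega phi : \bar R :=
  Lnorm (lebesgue_rV n) +oo (fun x => (\1_Omega x * enorm (phi x))%:E).

Definition test_field Omega phi :=
  Cc_infty Omega phi /\ (Linfty_norm Omega phi <= 1)%E.

Definition divergence phi (x : 'rV[R]_n) : R := \sum_i partial i phi x ord0 i.

End test_fields.

Section variations.
Context {R : realType} {n : nat}.
Implicit Types (f g : 'rV[R]_n -> R) (phi : 'rV[R]_n -> 'rV[R]_n).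
Implicit Types Omega : set 'rV[R]_n.

(* Members of L^1 are represented by Borel functions; everything below only
   depends on their almost everywhere class. *)
Definition L1 f := f \in Lfun (lebesgue_rV n) 1.

(* Total variation on Omega of a distribution, here a functional T on
   C_c^oo(R^n; R^n). *)
Definition dist_total_variation (T : ('rV[R]_n -> 'rV[R]_n) -> \bar R) Omega :=
  ereal_sup [set T phi | phi in test_field Omega].

Definition distr_grad f phi : \bar R :=
  (- \int[lebesgue_rV n]_x (f x * divergence phi x)%:E)%E.

Definition total_var f Omega : \bar R :=
  dist_total_variation (distr_grad f) Omega.

Definition BV_Rn f := L1 f /\ (total_var f setT < +oo)%E.

Definition mu_frac (alpha : R) : R :=
  2 `^ alpha * pi `^ (- (n%:R / 2)) *
  Gamma ((n%:R + alpha + 1) / 2) / Gamma ((1 - alpha) / 2).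

Definition frac_div (alpha : R) phi (x : 'rV[R]_n) : R :=
  mu_frac alpha *
  \int[lebesgue_rV n]_y (dot (y - x) (phi y - phi x) /
                 enorm (y - x) `^ (n%:R + alpha + 1)).

Definition frac_variation (alpha : R) g Omega : \bar R :=
  ereal_sup [set (\int[lebesgue_rV n]_x (g x * frac_div alpha phi x)%:E)%E
            | phi in test_field Omega].

End variations.

(* Around every boundary point, after an orthogonal change of coordinates
   y |-> y *m Q, Omega is in a small cube the strict epigraph, in the direction
   of the k-th axis, of a Lipschitz function of the n - 1 other coordinates. *)
Definition lipschitz_boundary {R : realType} {n : nat}
    (Omega : set 'rV[R]_n) :=
  forall x, (closure Omega `\` interior Omega) x ->
  exists (r : R) (Q : 'M[R]_n) (k : 'I_n) (gamma : 'rV[R]_n.-1 -> R),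
    [/\ 0 < r,
        Q *m Q^T = 1%:M,
        exists L : R, forall u v, `|gamma u - gamma v| <= L * enorm (u - v) &
        forall y, (forall i, `|((y - x) *m Q) ord0 i| < r) ->
          (Omega y <-> gamma (col' k (y *m Q)) < (y *m Q) ord0 k)].

Section gamma_limit.
Context {R : realType} {n : nat}.

Definition cvg_L1 (fam : R -> 'rV[R]_n -> R) (f : 'rV[R]_n -> R) :=
  (forall alpha, 0 < alpha < 1 -> L1 (fam alpha)) /\
  Lnorm (lebesgue_rV n) 1 (fun x => (fam alpha x - f x)%:E)
    @[alpha --> 1^'-] --> 0%E.

Definition Gamma_L1_lim (F : R -> ('rV[R]_n -> R) -> \bar R)
    (f : 'rV[R]_n -> R) (l : \bar R) :=
  (forall fam, cvg_L1 fam f ->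
    (l <= limf_einf (fun alpha => F alpha (fam alpha)) (1^'-))%E) /\
  (exists2 fam, cvg_L1 fam f &
    (limf_esup (fun alpha => F alpha (fam alpha)) (1^'-) <= l)%E).

End gamma_limit.

(* Main.v *)
Require Import Defs.
From HB Require Import structures.
From mathcomp Require Import all_boot all_order all_algebra.
From mathcomp Require Import all_classical all_reals all_analysis.
From mathcomp Require Import measurable_realfun ess_sup_inf lra ring.

(* The kernel of div^alpha is cut at the distance sqrt b.  The part beyond sqrt b
   contributes O(mu_{n,alpha}) and mu_{n,alpha} -> 0.  Inside, after subtracting
   its value on the sphere, the kernel is minus the gradient of a nonnegative
   radial function [kern] supported in that ball, so that an integration by
   parts turns the near part into [kern * div phi].  The mass of [kern] tends to
   1, because the volume omega_n of the unit ball satisfies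
   mu_{n,alpha} omega_n / (1 - alpha) -> 1.

   Hence div^alpha phi -> div phi uniformly, which gives the liminf inequality,
   and |D^alpha g|(Omega) <= (1 + o(1)) |Dg|(U) + o(1) ||g||_1 as soon as U
   contains a neighbourhood of Omega.

   It remains to find g close to f in L^1 with |Dg|(U) <= |Df|(Omega) + eps.  When
   Omega is a bounded Lipschitz set, f is pulled out of Omega:
   g = f + sum_i zeta_i (f(. + t e_i) - f), where the translation by t e_i maps
   the part of the closure of Omega in the support of zeta_i into Omega, and
   sum_i zeta_i = 1 near the closure of Omega.  A diagonal choice of such g
   is the recovery family. *)

Set Implicit Arguments.
Unset Strict Implicit.
Unset Printing Implicit Defensive.

Import Order.TTheory GRing.Theory Num.Theory.
Import numFieldNormedType.Exports.

Local Open Scope classical_set_scope.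
Local Open Scope ring_scope.

(** * Lebesgue measure on R^n *)

Section lebesgue_rV_theory.
Context {R : realType}.

(** The kernel must vanish on the cutting sphere so that the integration by parts leaves no boundary
    term; subtracting its value there only adds a bounded kernel with the factor mu, which joins the
    far part. Nonnegativity of [kern] permits the comparison with |Dg|: the near part averages
    pairings with translates of one field, with positive weights. The pole of Gamma at 0 makes mu
    vanish like (1 - alpha) / omega_n, while the singularity integrated against 1 grows like 1 / (1
    - alpha).

    The obstacle to the limsup inequality is the boundary. Translates of a field of Omega leave
    Omega, so the constant family is only controlled by |Df| on neighbourhoods of Omega, and |Df|
    may charge the boundary of Omega. A test field for the pulled-out g, cut by zeta_i and
    translated back, becomes a field of Omega, hence only |Df|(Omega) enters. The price is grad
    zeta_i paired with f(. + t e_i) - f, small because translations are continuous in L^1. For Omega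
    = R^n no translate escapes and f is its own recovery family. *)

Lemma measurable_rV_box n (a b : 'rV[R]_n) :
  measurable [set x : 'rV[R]_n | forall i, x ord0 i \in `[a ord0 i, b ord0 i]].
Proof.
rewrite (_ : mkset _ = \bigcap_(i in [set: 'I_n])
    ((fun x : 'rV[R]_n => x ord0 i) @^-1` `[a ord0 i, b ord0 i]%classic)).
  apply: fin_bigcap_measurable => // i _; rewrite -[X in measurable X]setTI.
  exact: measurable_coord.
by rewrite eqEsubset; split=> x /= H i; [move=> _|]; exact: H.
Qed.

Lemma sigma_finite_rV n : sigma_finite setT (@lebesgue_rV R n).
Proof.
exists (fun k => [set x : 'rV[R]_n | forall i, x ord0 i \in `[- k%:R, k%:R]]).
  rewrite eqEsubset; split => // x _.
  exists (Num.truncn `|x|).+1 => //= i.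
  rewrite in_itv/= -ler_norml ltW// (le_lt_trans _ (truncnS_gt _))//.
  rewrite [leRHS]/Num.Def.normr/= mx_normrE.
  by apply: (le_trans _ (@le_bigmax _ _ _ _ _ (ord0, i))).
move=> k; split.
  have := measurable_rV_box (const_mx (- k%:R)) (const_mx k%:R : 'rV[R]_n).
  by under eq_set do under eq_forall do rewrite !mxE.
have /(_ n) := @lebesgue_rV_box R _ (const_mx (- k%:R)) (const_mx k%:R).
under eq_set do under eq_forall do rewrite !mxE.
move=> ->; first by rewrite ltry.
by move=> i; rewrite !mxE -subr_ge0 opprK addr_ge0.
Qed.

(* A copy of [lebesgue_rV n] registered as a sigma-finite measure, as Fubini's
   theorem requires. *)
Definition leb (n : nat) : set 'rV[R]_n -> \bar R := lebesgue_rV n.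
Arguments leb n : clear implicits.
HB.instance Definition _ n := Measure.copy (leb n) (lebesgue_rV n).
HB.instance Definition _ n :=
  @Measure_isSigmaFinite.Build _ _ _ (leb n) (sigma_finite_rV n).

Lemma continuous_measurable_rV n m (f : 'rV[R]_n -> 'rV[R]_m) :
  continuous f -> measurable_fun setT f.
Proof.
move=> cf; apply: measurability => [|_ [U oU <-]]; first by [].
rewrite setTI; apply: open_measurable_rV.
by apply: open_comp => // x _; exact: cf.
Qed.

Lemma continuous_measurable_rVR n (f : 'rV[R]_n -> R) :
  continuous f -> measurable_fun setT f.
Proof.
move=> cf; apply: measurability; first exact: RGenOpens.measurableE.
move=> _ [_ [a [b ->]] <-]; rewrite setTI; apply: open_measurable_rV.
apply: open_comp; last exact: interval_open.
by move=> x _; exact: cf.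
Qed.

Lemma measurable_add_rV n d (T : measurableType d) (f g : T -> 'rV[R]_n) :
  measurable_fun setT f -> measurable_fun setT g ->
  measurable_fun setT (fun t => f t + g t).
Proof.
move=> mf mg; apply: measurable_fun_rV => i.
under eq_fun do rewrite mxE.
apply: measurable_funD.
  exact: (measurableT_comp (measurable_coord i) mf).
exact: (measurableT_comp (measurable_coord i) mg).
Qed.

Lemma measurable_scale_rV n d (T : measurableType d) (r : T -> R) (g : T -> 'rV[R]_n) :
  measurable_fun setT r -> measurable_fun setT g ->
  measurable_fun setT (fun t => r t *: g t).
Proof.
move=> mf mg; apply: measurable_fun_rV => i.
under eq_fun do rewrite mxE.
apply: measurable_funM; first exact: mf.
exact: (measurableT_comp (measurable_coord i) mg).
Qed.

Lemma measurable_dot n d (T : measurableType d) (f g : T -> 'rV[R]_n) :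
  measurable_fun setT f -> measurable_fun setT g ->
  measurable_fun setT (fun t => dot (f t) (g t)).
Proof.
move=> mf mg; apply: measurable_sum => i; apply: measurable_funM.
  exact: (measurableT_comp (measurable_coord i) mf).
exact: (measurableT_comp (measurable_coord i) mg).
Qed.

(* Same carrier, but with the display carried by [lebesgue_measure]. *)
Lemma mcons_rV n :
  @measurable_fun _ _ ('rV[R]_n * measurableTypeR R)%type 'rV[R]_n.+1 setT
    (@cons_rV R n).
Proof. exact: measurable_cons_rV. Qed.

Lemma measurable_pair_cons n (y : 'rV[R]_n) :
  measurable_fun setT (fun t : measurableTypeR R => cons_rV (y, t)).
Proof. exact: (measurableT_comp (@measurable_cons_rV R n) (measurable_pair1 y)). Qed.

Lemma ge0_integral_leb_succ n (f : 'rV[R]_n.+1 -> \bar R) :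
  measurable_fun setT f -> (forall x, 0 <= f x)%E ->
  (\int[leb n.+1]_x f x =
   \int[leb n]_y \int[lebesgue_measure]_t f (cons_rV (y, t)))%E.
Proof.
move=> mf f0.
transitivity (\int[pushforward (leb n \x lebesgue_measure)
  (@cons_rV R n)]_x f x)%E; first by [].
rewrite (@ge0_integral_pushforward _ _ ('rV[R]_n * measurableTypeR R)%type _ R _
  (@mcons_rV n) (leb n \x lebesgue_measure)%E)//.
rewrite preimage_setT fubini_tonelli1// => [|x /=]; last exact: f0.
by apply: measurableT_comp => //; exact: mcons_rV.
Qed.

Lemma integrable_leb_succ n (f : 'rV[R]_n.+1 -> \bar R) :
  (leb n.+1).-integrable setT f ->
  (leb n \x lebesgue_measure)%E.-integrable setT (f \o @cons_rV R n).
Proof.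
move=> /integrableP[mf fi].
have mc := measurableT_comp mf (@mcons_rV n).
apply/(@integrable12ltyP _ _ 'rV[R]_n (measurableTypeR R) R (leb n)
  lebesgue_measure _ mc).
rewrite -(@ge0_integral_leb_succ _ (fun x => `|f x|%E))//.
exact: measurableT_comp.
Qed.

Lemma integral_leb_succ n (f : 'rV[R]_n.+1 -> \bar R) :
  (leb n.+1).-integrable setT f ->
  (\int[leb n.+1]_x f x =
   \int[leb n]_y \int[lebesgue_measure]_t f (cons_rV (y, t)))%E.
Proof.
move=> fi; have := integrable_leb_succ fi; move: (measurable_int _ fi) => mf fi'.
transitivity (\int[pushforward (leb n \x lebesgue_measure)
  (@cons_rV R n)]_x f x)%E; first by [].
rewrite (@integral_pushforward _ _ ('rV[R]_n * measurableTypeR R)%type _ R _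
  (@mcons_rV n) (leb n \x lebesgue_measure)%E)//.
by rewrite preimage_setT -integral12_prod_meas1.
Qed.

Lemma integral_leb_succC n (f : 'rV[R]_n.+1 -> \bar R) :
  (leb n.+1).-integrable setT f ->
  (\int[leb n.+1]_x f x =
   \int[lebesgue_measure]_t \int[leb n]_y f (cons_rV (y, t)))%E.
Proof.
move=> fi; rewrite integral_leb_succ//.
exact: (@Fubini _ _ 'rV[R]_n (measurableTypeR R) R (leb n)
  lebesgue_measure _ (integrable_leb_succ fi)).
Qed.

(** Uniqueness of Lebesgue measure: [r] times the pushforward by the affine map agrees with it on
    half-open intervals. *)
Lemma ge0_integral_lebesgue_affine (r b : R) (f : R -> \bar R) : 0 < r ->
  measurable_fun setT f -> (forall x, 0 <= f x)%E ->
  (\int[lebesgue_measure]_t f (r * t + b)%R =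
   (r^-1)%:E * \int[lebesgue_measure]_t f t)%E.
Proof.
move=> r0 mf f0.
pose phi : measurableTypeR R -> measurableTypeR R := fun t => r * t + b.
have mphi : measurable_fun setT phi.
  by apply: measurable_funD => //; exact: measurable_funM.
pose nu : {measure set (measurableTypeR R) -> \bar R} :=
  mscale (NngNum (ltW r0))
    (measure_function_pushforward__canonical__measure_function_Measure
      lebesgue_measure mphi).
have E A : measurable A -> lebesgue_measure A = nu A.
  apply: lebesgue_measure_unique => _ [[c d]] /= _ <-.
  rewrite /nu /mscale/= /pushforward.
  have -> : phi @^-1` `]c, d] = `](c - b) / r, (d - b) / r]%classic.
    apply/seteqP; split => t; rewrite /phi /= !in_itv /= ltr_pdivrMr// ler_pdivlMr//;
    by rewrite ltrBlDr lerBrDr mulrC.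
  have [cd|dc] := ltP c d; last first.
    rewrite !set_itv_ge ?measure0 ?mule0// bnd_simp -leNgt//.
    by rewrite ler_pM2r ?invr_gt0// lerD2r.
  rewrite [X in X = _]lebesgue_measure_itv/= lte_fin cd.
  rewrite [X in (_ * X)%E]lebesgue_measure_itv/= lte_fin ltr_pM2r ?invr_gt0// ltrD2r cd.
  rewrite -!EFinB -EFinM; congr EFin; field.
  by rewrite gt_eqF.
rewrite -(@ge0_integral_pushforward _ _ _ _ _ phi mphi lebesgue_measure setT f)//.
rewrite [in RHS](eq_measure_integral nu) => [|A mA _]; last exact: E.
rewrite ge0_integral_mscale//= muleA -EFinM mulVf ?mul1e//.
by rewrite gt_eqF.
Qed.

Lemma cons_rV_surj n (x : 'rV[R]_n.+1) :
  x = cons_rV (\row_j x ord0 (lift ord0 j), x ord0 ord0).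
Proof.
apply/rowP => i; rewrite mxE; case: unliftP => [j ->|->]//.
by rewrite mxE.
Qed.

Lemma cons_rV_affine n (r : R) (y x : 'rV[R]_n) t b :
  r *: cons_rV (y, t) + cons_rV (x, b) = cons_rV (r *: y + x, r * t + b).
Proof.
apply/rowP => i; rewrite !mxE; case: (unlift ord0 i) => [j|] //=.
by rewrite !mxE.
Qed.

(** Coordinate by coordinate. Scaling is for the volume of balls and for rescaled weights; [r = 1]
    gives translation invariance. *)
Lemma ge0_integral_leb_affine n (r : R) (x : 'rV[R]_n) (f : 'rV[R]_n -> \bar R) :
  0 < r -> measurable_fun setT f -> (forall x, 0 <= f x)%E ->
  (\int[leb n]_z f (r *: z + x)%R = (r ^- n)%:E * \int[leb n]_z f z)%E.
Proof.
move=> r0; elim: n => [|n IH] in x f * => mf f0.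
  rewrite expr0 invr1 mul1e; apply: eq_integral => z _; congr f.
  by apply/rowP => -[].
have maff m (v : 'rV[R]_m) : measurable_fun setT (fun z : 'rV[R]_m => r *: z + v).
  by apply: measurable_add_rV => //; exact: measurable_scale_rV.
rewrite [in LHS]ge0_integral_leb_succ//; last first.
  by apply: measurableT_comp => //; exact: maff.
rewrite (cons_rV_surj x); set x' := \row_j _; set b := x ord0 ord0.
under eq_integral => y _.
  under eq_integral do rewrite cons_rV_affine.
  rewrite (@ge0_integral_lebesgue_affine r b (fun t => f (cons_rV (r *: y + x', t))))//; last first.
    exact: measurableT_comp mf (@measurable_pair_cons _ _).
  over.
have mF : measurable_fun setT (fun y => \int[lebesgue_measure]_t f (cons_rV (y, t)))%E.
  apply: (@measurable_fun_fubini_tonelli_F _ _ 'rV[R]_n (measurableTypeR R) R lebesgue_measure (f \o @cons_rV R n)).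
    by apply: measurableT_comp => //; exact: mcons_rV.
  by move=> z /=.
rewrite ge0_integralZl//; last 3 first.
- exact: measurableT_comp mF (@maff _ _).
- by move=> y _; exact: integral_ge0.
- by rewrite lee_fin invr_ge0 ltW.
rewrite (IH x' (fun y => \int[lebesgue_measure]_t f (cons_rV (y, t)))%E)//; last first.
  by move=> y; exact: integral_ge0.
by rewrite -ge0_integral_leb_succ// muleA -EFinM -invfM exprS.
Qed.

Lemma integral_leb_shift n (x : 'rV[R]_n) (f : 'rV[R]_n -> \bar R) :
  measurable_fun setT f ->
  (\int[leb n]_z f (z + x)%R = \int[leb n]_z f z)%E.
Proof.
move=> mf; have S (g : 'rV[R]_n -> \bar R) : measurable_fun setT g ->
    (forall x, 0 <= g x)%E -> (\int[leb n]_z g (z + x)%R = \int[leb n]_z g z)%E.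
  move=> mg g0; have := ge0_integral_leb_affine x ltr01 mg g0.
  rewrite expr1n invr1 mul1e => <-.
  by apply: eq_integral => z _; rewrite scale1r.
rewrite [LHS]integralE [RHS]integralE; congr (_ - _)%E.
  rewrite -(S _ (measurable_funepos mf))//.
  by apply: eq_integral => z _; rewrite !unlock.
rewrite -(S _ (measurable_funeneg mf))//.
by apply: eq_integral => z _; rewrite !unlock.
Qed.

Lemma integrable_leb_shift n (x : 'rV[R]_n) (f : 'rV[R]_n -> \bar R) :
  (leb n).-integrable setT f -> (leb n).-integrable setT (fun z => f (z + x)).
Proof.
move=> /integrableP[mf fi]; apply/integrableP; split.
  by apply: measurableT_comp => //; exact: measurable_add_rV.
by rewrite (@integral_leb_shift _ x (fun z => `|f z|%E))//; exact: measurableT_comp.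
Qed.

End lebesgue_rV_theory.
Arguments leb {R} n.

(** * The Gamma function and the volume of the ball *)

Section gamma_function.
Context {R : realType}.
Notation lam := (@lebesgue_measure R).

(** Tonelli on the region [F x <= s]. It is the common source of the functional equation of Gamma,
    of the volume of the ball and of the mass of every radial function below. *)
Lemma layer_cake d (T : measurableType d)
    (m : {sigma_finite_measure set T -> \bar R}) (w F : T -> R) (psi : R -> R) :
  measurable_fun setT w -> measurable_fun setT F -> measurable_fun setT psi ->
  (forall x, 0 <= w x) -> (forall s, 0 <= psi s) ->
  (\int[m]_x ((w x)%:E * \int[lam]_s (psi s * (F x <= s)%R%:R)%:E) =
   \int[lam]_s ((psi s)%:E * \int[m]_x (w x * (F x <= s)%R%:R)%:E))%E.
Proof.
move=> mw mF mpsi w0 psi0.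
have mle : measurable_fun [set: T * measurableTypeR R]
    (fun p => (F p.1 <= p.2)%R%:R : R).
  rewrite (_ : (fun _ => _) = \1_[set p | F p.1 <= p.2]); last first.
    apply/funext => p; rewrite indicE; congr (nat_of_bool _)%:R.
    by apply/idP/idP => [/mem_set//|]; rewrite inE.
  apply: measurable_indic; rewrite -[X in measurable X]setTI.
  apply: measurable_fun_le => //.
  exact: measurableT_comp mF measurable_fst.
have mle2 s : measurable_fun setT (fun x => (F x <= s)%R%:R : R).
  exact: (measurableT_comp mle (measurable_pair2 s)).
have mle1 x : measurable_fun setT (fun s : measurableTypeR R => (F x <= s)%R%:R : R).
  exact: (measurableT_comp mle (measurable_pair1 x)).
under eq_integral => x _.
  rewrite -ge0_integralZl//; last 3 first.
  - by apply/measurable_EFinP; exact: measurable_funM.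
  - by move=> s _; rewrite lee_fin mulr_ge0.
  - by rewrite lee_fin.
  over.
under [RHS]eq_integral => s _.
  rewrite -ge0_integralZl//; last 3 first.
  - by apply/measurable_EFinP; exact: measurable_funM.
  - by move=> x _; rewrite lee_fin mulr_ge0.
  - by rewrite lee_fin.
  over.
transitivity (\int[m]_x \int[lam]_s (w x * (psi s * (F x <= s)%R%:R))%:E)%E.
  by [].
transitivity (\int[lam]_s \int[m]_x (w x * (psi s * (F x <= s)%R%:R))%:E)%E.
  apply: (@fubini_tonelli _ _ T (measurableTypeR R) R m lam
    (fun p => (w p.1 * (psi p.2 * (F p.1 <= p.2)%R%:R))%:E)) => [|p].
    apply/measurable_EFinP; apply: measurable_funM.
      exact: measurableT_comp mw measurable_fst.
    apply: measurable_funM => //.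
    exact: measurableT_comp mpsi measurable_snd.
  by rewrite lee_fin !mulr_ge0.
by apply: eq_integral => s _; apply: eq_integral => x _ /=; rewrite mulrCA.
Qed.

Lemma integral_patchR (D : set R) (f g : R -> R) : measurable D ->
  (forall x, f x = if x \in D then g x else 0) ->
  (\int[lam]_x (f x)%:E = \int[lam]_(x in D) (g x)%:E)%E.
Proof.
move=> mD fg; rewrite [RHS]integral_mkcond; apply: eq_integral => x _.
by rewrite patchE fg; case: ifP.
Qed.

Lemma integral_expRN (a : R) :
  (\int[lam]_(s in `[a, +oo[) (expR (- s))%:E = (expR (- a))%:E)%E.
Proof.
rewrite (@ge0_continuous_FTC2y _ (fun s => expR (- s)) (fun s => - expR (- s)) a 0).
- by rewrite EFinN oppeK add0e.
- by move=> x _; exact: expR_ge0.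
- apply: continuous_subspaceT => x.
  by apply: continuous_comp; [exact: continuousN|exact: continuous_expR].
- rewrite -oppr0; apply: cvgN; exact: cvgr_expR.
- move=> x _; apply: derivableN.
  by apply: ex_derive.
- apply: cvgN; apply: cvg_at_right_filter.
  by apply: continuous_comp; [exact: continuousN|exact: continuous_expR].
- move=> x _; rewrite derive1E derive_val.
  by rewrite mulrN1 opprK.
Qed.

Lemma measurable_powRl (p : R) D : measurable_fun D (fun t : R => t `^ p).
Proof. by apply: measurable_funTS; exact: measurable_powR. Qed.

(** For [z < 1] the integrand blows up at 0, so the fundamental theorem is applied on
    [[a / (k + 2), a]], never degenerate thanks to the [+ 2], and monotone convergence concludes. *)
Lemma integral_powR (z a : R) : 0 < z -> 0 < a ->
  (\int[lam]_(t in `]0%R, a]) (z * t `^ (z - 1))%:E = (a `^ z)%:E)%E.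
Proof.
move=> z0 a0.
pose e k : R := a / k.+2%:R.
have e0 k : 0 < e k by rewrite divr_gt0.
have ea k : e k < a by rewrite ltr_pdivrMr// ltr_pMr// ltr1n.
pose F k : set R := `[e k, a]%classic.
have UF : \bigcup_k F k = `]0, a]%classic.
  apply/seteqP; split => [t [k _]|t].
    rewrite /F /= !in_itv/= => /andP[et ta].
    by rewrite (lt_le_trans (e0 k) et).
  rewrite /= in_itv/= => /andP[t0 ta].
  exists (Num.truncn (a / t)) => //=; rewrite /F /= in_itv/= ta andbT.
  rewrite /e ler_pdivrMr// mulrC -ler_pdivrMr// ltW//.
  apply: (lt_trans (truncnS_gt _)).
  by rewrite ltr_nat.
have H k : (\int[lam]_(t in F k) (z * t `^ (z - 1))%:E = (a `^ z - e k `^ z)%:E)%E.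
  rewrite EFinB.
  apply: (@continuous_FTC2 _ _ (fun t => t `^ z)) => //.
  - apply: derivable_within_continuous => x /=.
    rewrite in_itv/= => /andP[ex _].
    apply: derivableM => //; apply: derivable_powR.
    by rewrite in_itv/= andbT (lt_le_trans (e0 k) ex).
  - have D x : 0 < x -> derivable (fun t => t `^ z) x 1.
      by move=> x0; apply: derivable_powR; rewrite in_itv/= andbT.
    have C x : 0 < x -> {for x, continuous (fun t => t `^ z)}.
      by move=> x0; exact/differentiable_continuous/derivable1_diffP/D.
    split.
    + by move=> x; rewrite in_itv/= => /andP[ex _]; apply: D; exact: lt_trans ex.
    + apply: cvg_at_right_filter.
      exact: C.
    + apply: cvg_at_left_filter.
      exact: C.
  - move=> x; rewrite in_itv/= => /andP[ex _].
    by rewrite powR_derive1// in_itv/= andbT (lt_trans _ ex).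
rewrite -UF.
have C1 := @ge0_nondecreasing_set_cvg_integral _ (measurableTypeR R) R F
  (fun t => (z * t `^ (z - 1))%:E) lam.
apply: (@cvg_unique _ _ _ _ _ _ (C1 _ _ _ _)) => //.
- move=> i j ij; apply/subsetPset => t; rewrite /F /= !in_itv/= => /andP[et ->].
  rewrite andbT (le_trans _ et)// /e ler_pM2l// lef_pV2 ?posrE//.
  by rewrite ler_nat.
- by move=> i; exact: measurable_itv.
- move=> i; apply/measurable_EFinP; apply: measurable_funM => //.
  exact: measurable_powRl.
- by move=> i x _; rewrite lee_fin mulr_ge0 ?powR_ge0// ltW.
rewrite /=.
under eq_cvg do rewrite H.
apply: cvg_EFin; first by near=> k.
rewrite -[X in _ --> X]subr0.
apply: (@cvgB _ _ _ _ _ (fun=> a `^ z)); first exact: cvg_cst.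
have e_cvg0 : e @ \oo --> (0 : R).
  rewrite -[X in _ --> X](mulr0 a); apply: cvgMr.
  by have := @cvg_harmonic R; rewrite -(cvg_shiftS _).
have e_cvg : e @ \oo --> 0^'+.
  move=> P [d /= d0 dP]; move/cvgrPdist_lt : e_cvg0 => /(_ d d0) [N _ HN].
  by exists N => // k Nk; apply: dP => //; exact: HN.
exact: cvg_comp e_cvg (powR_cvg0 z0).
Unshelve. all: by end_near. Qed.

(** The value before [fine]: a divergent integral would silently become 0 in [Gamma], so identities
    are proved here and finiteness separately. *)
Definition eGamma (z : R) : \bar R :=
  (\int[lam]_(t in `]0%R, +oo[) (t `^ (z - 1) * expR (- t))%:E)%E.

Lemma GammaE (z : R) : Gamma z = fine (eGamma z).
Proof. by []. Qed.

Lemma eGamma_ge0 (z : R) : (0 <= eGamma z)%E.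
Proof.
by apply: integral_ge0 => t _; rewrite lee_fin mulr_ge0 ?powR_ge0 ?expR_ge0.
Qed.

Lemma measurable_expRN D : measurable_fun D (fun t : R => expR (- t)).
Proof.
apply: measurable_funTS; apply: continuous_measurable_fun => t.
by apply: continuous_comp; [exact: continuousN|exact: continuous_expR].
Qed.

(** Profile whose integral over [[u, +oo[] is [expR (- u)] for [u >= 0]; this puts the exponential
    in the form [layer_cake] expects. *)
Definition expN0 (s : R) : R := if 0 <= s then expR (- s) else 0.

Lemma expN0_ge0 s : 0 <= expN0 s.
Proof. by rewrite /expN0; case: ifP => // _; exact: expR_ge0. Qed.

Lemma measurable_expN0 : measurable_fun setT expN0.
Proof.
apply: measurable_fun_ifT => //; last exact: measurable_expRN.
exact: measurable_fun_ler.
Qed.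

Lemma integral_expN0 (u : R) : 0 <= u ->
  (\int[lam]_s (expN0 s * (u <= s)%R%:R)%:E = (expR (- u))%:E)%E.
Proof.
move=> u0; rewrite -integral_expRN.
apply: integral_patchR => // s; rewrite mem_setE in_itv/= andbT /expN0.
case: ifPn => [s0|]; first by case: ifP; rewrite ?mulr1 ?mulr0.
rewrite mul0r -ltNge => s0; case: ifP => // us.
by have := lt_le_trans s0 (le_trans u0 us); rewrite ltxx.
Qed.

Lemma integral_expN0_powR (z : R) : 0 < z ->
  (\int[lam]_s (expN0 s * s `^ z)%:E = eGamma (z + 1))%E.
Proof.
move=> z0; rewrite /eGamma; apply: integral_patchR => // s.
rewrite mem_setE in_itv/= andbT /expN0 addrK.
have [s0|s0|<-] := ltgtP 0 s; rewrite ?mul0r//; first by rewrite mulrC.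
by rewrite powR0 ?mulr0// gt_eqF.
Qed.

(** Tonelli replaces the integration by parts: write [expR (- t)] as the integral of [expR (- s)]
    over [s >= t], then integrate [z * t ^ (z - 1)] over [t <= s], which gives [s ^ z]. *)
Lemma eGammaS (z : R) : 0 < z -> (z%:E * eGamma z = eGamma (z + 1))%E.
Proof.
move=> z0; rewrite -integral_expN0_powR//.
pose w (t : R) : R := if 0 < t then z * t `^ (z - 1) else 0.
have w0 t : 0 <= w t.
  by rewrite /w; case: ifP => // t0; rewrite mulr_ge0 ?powR_ge0// ltW.
have mw : measurable_fun setT w.
  apply: measurable_fun_ifT => //; first exact: measurable_fun_ltr.
  by apply: measurable_funM => //; exact: measurable_powRl.
have := @layer_cake _ (measurableTypeR R) lam w id expN0 mw (@measurable_id _ _ _)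
  measurable_expN0 w0 expN0_ge0.
transitivity (\int[lam]_x ((w x)%:E * \int[lam]_s (expN0 s * (x <= s)%R%:R)%:E))%E.
  transitivity (\int[lam]_(t in `]0%R, +oo[)
      (z%:E * (t `^ (z - 1) * expR (- t))%:E))%E.
    apply/esym/ge0_integralZl; first exact: measurable_itv.
  - apply/measurable_EFinP; apply: measurable_funM; last exact: measurable_expRN.
    exact: measurable_powRl.
  - by move=> t _; rewrite lee_fin mulr_ge0 ?powR_ge0 ?expR_ge0.
  - by rewrite lee_fin ltW.
  rewrite [LHS]integral_mkcond; apply: eq_integral => t _.
  rewrite patchE mem_setE in_itv/= andbT /w; case: ifP => [t0|_]; last by rewrite mul0e.
  by rewrite integral_expN0 ?(ltW t0)// -!EFinM mulrA.
rewrite /= H.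
apply: eq_integral => s _.
have [s0|s0] := ltP 0 s; last first.
  have [->|s0'] := eqVneq s 0.
    have E0 : (\int[lam]_x (w x * (x <= 0)%R%:R)%:E = 0)%E.
      apply: integral0_eq => x _; rewrite /w; case: ifPn; rewrite ?mul0r//.
      by rewrite ltNge => /negbTE ->; rewrite mulr0.
    by rewrite E0 powR0 ?gt_eqF// mulr0 mule0.
  by rewrite /expN0 leNgt lt_neqAle s0' s0 /= mul0e mul0r.
rewrite EFinM -(integral_powR z0 s0); congr (_ * _)%E.
apply: integral_patchR => // x; rewrite mem_setE in_itv/= /w.
by case: ltP => _; rewrite ?mul0r//=; case: leP; rewrite ?mulr1 ?mulr0.
Qed.

Lemma eGamma1 : eGamma 1 = 1%E.
Proof.
rewrite /eGamma; under eq_integral do rewrite subrr powRr0 mul1r.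
rewrite integral_itv_obnd_cbnd ?integral_expRN ?oppr0 ?expR0//.
by apply/measurable_EFinP; exact: measurable_expRN.
Qed.

Lemma eGamma_nat n : (eGamma n.+1%:R < +oo)%E.
Proof.
elim: n => [|n IH]; first by rewrite eGamma1 ltry.
by rewrite -natr1 -eGammaS// lte_mul_pinfty.
Qed.

(** For [z >= 1] the power [t ^ (z - 1)] lies below [1 + t ^ m] with [m] the integer part of [z],
    and integer arguments are finite by the functional equation. For [0 < z < 1] the same equation
    brings finiteness back from [z + 1]. *)
Lemma eGamma_fin (z : R) : 0 < z -> (eGamma z < +oo)%E.
Proof.
have P z1 : 1 <= z1 -> (eGamma z1 < +oo)%E.
  move=> z1_ge; set m := Num.truncn z1.
  have H : (eGamma z1 <= eGamma 1 + eGamma m.+1%:R)%E.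
    rewrite -ge0_integralD//; last 4 first.
    - by move=> t _; rewrite lee_fin mulr_ge0 ?powR_ge0 ?expR_ge0.
    - apply/measurable_EFinP; apply: measurable_funM; last exact: measurable_expRN.
      exact: measurable_powRl.
    - by move=> t _; rewrite lee_fin mulr_ge0 ?powR_ge0 ?expR_ge0.
    - apply/measurable_EFinP; apply: measurable_funM; last exact: measurable_expRN.
      exact: measurable_powRl.
    apply: ge0_le_integral => //.
    - by move=> t _; rewrite lee_fin mulr_ge0 ?powR_ge0 ?expR_ge0.
    - apply/measurable_EFinP; apply: measurable_funM; last exact: measurable_expRN.
      exact: measurable_powRl.
    - apply/measurable_EFinP; apply: measurable_funD; apply: measurable_funM;
        (exact: measurable_expRN || exact: measurable_powRl).
    move=> t /=; rewrite in_itv/= andbT => t0.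
    rewrite -EFinD lee_fin -mulrDl ler_wpM2r ?expR_ge0//.
    have [t1|t1] := leP t 1.
      by rewrite ler_wpDr ?powR_ge0// ger_powR ?t0 ?lerD2r.
    rewrite ler_wpDl ?powR_ge0// ler_powR ?(ltW t1)//.
    by rewrite lerD2r ltW// truncnS_gt.
  by rewrite (le_lt_trans H)// eGamma1 lte_add_pinfty ?ltry ?eGamma_nat.
move=> z0; have := P (z + 1); rewrite lerDr (ltW z0) => /(_ isT).
rewrite -eGammaS//; case: (eGamma z) (eGamma_ge0 z) => [r _ _|_|//].
  by rewrite ltry.
by rewrite gt0_muley ?lte_fin.
Qed.

Lemma Gamma_ge0 (z : R) : 0 <= Gamma z.
Proof. by rewrite GammaE fine_ge0// eGamma_ge0. Qed.

Lemma eGammaR (z : R) : 0 < z -> eGamma z = (Gamma z)%:E.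
Proof.
by move=> z0; rewrite GammaE fineK// ge0_fin_numE ?eGamma_ge0// eGamma_fin.
Qed.

Lemma GammaS (z : R) : 0 < z -> z * Gamma z = Gamma (z + 1).
Proof.
move=> z0; apply: EFin_inj; rewrite EFinM -!eGammaR ?eGammaS//.
by rewrite addr_gt0.
Qed.

Lemma Gamma1 : Gamma 1 = 1 :> R.
Proof. by apply: EFin_inj; rewrite -eGammaR ?eGamma1. Qed.

Lemma integrable_Gamma (z : R) : 0 < z ->
  lam.-integrable `]0, +oo[ (fun t => (t `^ (z - 1) * expR (- t))%:E).
Proof.
move=> z0; apply/integrableP; split.
  apply/measurable_EFinP; apply: measurable_funM; last exact: measurable_expRN.
  exact: measurable_powRl.
apply: le_lt_trans (eGamma_fin z0).
rewrite le_eqVlt; apply/orP; left; apply/eqP; apply: eq_integral => t _.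
by rewrite gee0_abs// lee_fin mulr_ge0 ?powR_ge0 ?expR_ge0.
Qed.

Lemma continuous_Gamma (c : R) : 0 < c -> {for c, continuous (@Gamma R)}.
Proof.
move=> c0.
(* Majorant for all exponents between [c / 2] and [c + 1]: the smaller exponent dominates for
   [t <= 1], the larger one for [t > 1]. *)
pose g (t : R) := (t `^ (c / 2 - 1) + t `^ (c + 1 - 1)) * expR (- t).
apply: (@continuity_under_integral R _ (measurableTypeR R) lam
  (fun z t => t `^ (z - 1) * expR (- t)) `]0, +oo[ _ (c / 2) (c + 1) _ _ g).
- exact: measurable_itv.
- move=> x /=; rewrite in_itv/= => /andP[cx _].
  by apply: integrable_Gamma; apply: lt_trans cx; rewrite divr_gt0.
- apply: aeW => t /=; rewrite in_itv/= andbT => t0 x _.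
  apply: cvgM; last exact: cvg_cst.
  rewrite (_ : (fun _ => _) = (fun x => expR ((x - 1) * ln t))).
    rewrite /powR gt_eqF//.
    apply: (@cvg_comp _ _ _ (fun y => (y - 1) * ln t) expR); last exact: continuous_expR.
    by apply: cvgM; [apply: cvgB => //; exact: cvg_cst|exact: cvg_cst].
  by apply/funext => y; rewrite /powR gt_eqF.
- rewrite (_ : EFin \o g = (fun t => (t `^ (c / 2 - 1) * expR (- t))%:E +
      (t `^ (c + 1 - 1) * expR (- t))%:E)%E); last first.
    by apply/funext => t; rewrite /= -EFinD -mulrDl.
  by apply: integrableD => //; apply: integrable_Gamma; rewrite ?divr_gt0 ?addr_gt0.
- move=> x /=; rewrite in_itv/= => /andP[cx xc].
  apply: aeW => t /=; rewrite in_itv/= andbT => t0.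
  rewrite ger0_norm; last by rewrite mulr_ge0 ?powR_ge0 ?expR_ge0.
  rewrite /g ler_wpM2r ?expR_ge0//.
  have [t1|t1] := leP t 1.
    by rewrite ler_wpDr ?powR_ge0// ger_powR ?t0// lerD2r ltW.
  by rewrite ler_wpDl ?powR_ge0// ler_powR ?(ltW t1)// lerD2r ltW.
- by rewrite inE /= in_itv/= ltrDl ltr01 ltr_pdivrMr// ltr_pMr// ltr1n.
Qed.

End gamma_function.

(** * Volume of the Euclidean ball and asymptotics of mu *)

Section ball_volume.
Context {R : realType}.
Notation lam := (@lebesgue_measure R).

Lemma dot_ge0 n (z : 'rV[R]_n) : 0 <= dot z z.
Proof. by apply: sumr_ge0 => i _; rewrite -expr2 sqr_ge0. Qed.

Lemma dot_coord n (z : 'rV[R]_n) i : z ord0 i ^+ 2 <= dot z z.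
Proof.
rewrite /dot (bigD1 i)//= -expr2 lerDl; apply: sumr_ge0 => j _.
by rewrite -expr2 sqr_ge0.
Qed.

Lemma dotZZ n r (z : 'rV[R]_n) : dot (r *: z) (r *: z) = r ^+ 2 * dot z z.
Proof.
rewrite /dot mulr_sumr; apply: eq_bigr => i _; rewrite !mxE; ring.
Qed.

Lemma measurable_dotzz n : measurable_fun setT (fun z : 'rV[R]_n => dot z z).
Proof. exact: measurable_dot. Qed.

(** The parameter is the squared radius: all radial functions are written in [dot z z], which stays
    smooth at the origin. *)
Definition cball n (s : R) : set 'rV[R]_n := [set z | dot z z <= s].
Arguments cball n s : clear implicits.

Lemma measurable_cball n s : measurable (cball n s).
Proof.
rewrite -[X in measurable X]setTI; apply: measurable_fun_le => //.
exact: measurable_dotzz.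
Qed.

Definition ballvol n : R := fine (leb n (cball n 1)).
Arguments ballvol n : clear implicits.

Lemma leb_cball_fin n s : (leb n (cball n s) < +oo)%E.
Proof.
(* With [a >= 1] one has [s <= a <= a ^+ 2], so the ball lies in the box of half-side [a]. *)
pose a := Num.max s 1.
have /(_ n) := @lebesgue_rV_box R _ (const_mx (- a)) (const_mx a).
have a1 : 1 <= a by rewrite le_max lexx orbT.
have a0 : 0 <= a by rewrite (le_trans _ a1).
have D i : (const_mx (- a) : 'rV[R]_n) ord0 i <= (const_mx a : 'rV[R]_n) ord0 i.
  by rewrite !mxE -subr_ge0 opprK addr_ge0.
move=> /(_ D) E.
apply: (@le_lt_trans _ _ (leb n [set x | forall i, x ord0 i \in
   `[(const_mx (- a) : 'rV[R]_n) ord0 i, (const_mx a : 'rV[R]_n) ord0 i]])); last first.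
  by rewrite /leb E ltry.
apply: le_measure; rewrite ?inE.
- exact: measurable_cball.
- exact: measurable_rV_box.
- move=> z zs i; rewrite !mxE in_itv/= -ler_norml.
  have H : `|z ord0 i| ^+ 2 <= a ^+ 2.
    rewrite real_normK ?num_real// (le_trans (dot_coord z i))// (le_trans zs)//.
    rewrite (@le_trans _ _ a)// ?le_max ?lexx//.
    by rewrite expr2 ler_peMr.
  by rewrite -(@ler_pXn2r _ 2) ?nnegrE.
Qed.

Lemma leb_cball1 n : leb n (cball n 1) = (ballvol n)%:E.
Proof. by rewrite /ballvol fineK// ge0_fin_numE ?measure_ge0// leb_cball_fin. Qed.

Lemma ballvol_ge0 n : 0 <= ballvol n.
Proof. by rewrite fine_ge0// measure_ge0. Qed.

Lemma leb_cball n s : (0 < n)%N -> 0 <= s ->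
  leb n (cball n s) = (ballvol n * s `^ (n%:R / 2))%:E.
Proof.
move=> n0; rewrite le_eqVlt => /predU1P[<-|s0].
  rewrite powR0 ?mulr0; last by rewrite gt_eqF// divr_gt0// ltr0n.
  have := @lebesgue_rV_box R n 0 0 (fun i => lexx _).
  under eq_bigr do rewrite subrr.
  rewrite prodr_const card_ord expr0n gtn_eqF//= => <-.
  rewrite /leb; congr (lebesgue_rV n _); apply/seteqP; split => z /= zs.
    move=> i; rewrite mxE in_itv/= -eq_le eq_sym -sqrf_eq0 eq_le sqr_ge0 andbT.
    exact: le_trans (dot_coord z i) zs.
  rewrite /cball/= /dot big1// => i _.
  have := zs i; rewrite mxE in_itv/= -eq_le => /eqP <-; by rewrite mulr0.
have r0 : 0 < Num.sqrt s by rewrite sqrtr_gt0.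
have := @ge0_integral_leb_affine R n (Num.sqrt s) 0
  (fun z => (\1_(cball n s) z)%:E) r0.
have m1 : measurable_fun setT (fun z => (\1_(cball n s) z)%:E : \bar R).
  by apply/measurable_EFinP; apply: measurable_indic; exact: measurable_cball.
move=> /(_ m1 (fun _ => _)) H.
have {H} := H (fun x => ltac:(by rewrite lee_fin)).
have E1 : (\int[leb n]_z (\1_(cball n s) z)%:E = leb n (cball n s))%E.
  by rewrite integral_indic ?setIT//; exact: measurable_cball.
have -> : (\int[leb n]_z (\1_(cball n s) (Num.sqrt s *: z + 0)%R)%:E =
    (ballvol n)%:E)%E.
  rewrite -leb_cball1 -[in RHS](setIT (cball n 1)).
  rewrite -(@integral_indic _ _ _ (leb n))//; last exact: measurable_cball.
  apply: eq_integral => z _; rewrite !indicE addr0; congr (nat_of_bool _)%:R%:E.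
  have E : (dot (Num.sqrt s *: z) (Num.sqrt s *: z) <= s) = (dot z z <= 1).
    by rewrite dotZZ sqr_sqrtr ?(ltW s0)// ger_pMr.
  by apply/idP/idP; rewrite !inE /cball/= E.
rewrite E1.
have -> : Num.sqrt s ^- n = (s `^ (n%:R / 2))^-1.
  congr _^-1; rewrite -powR12_sqrt ?(ltW s0)// -powR_mulrn ?powR_ge0//.
  by rewrite -powRrM mulrC.
have p0 : 0 < s `^ (n%:R / 2) by exact: powR_gt0.
move=> /(congr1 (fun x => (s `^ (n%:R / 2))%:E * x)%E).
by rewrite muleA -!EFinM mulfV ?gt_eqF// mul1e mulrC.
Qed.

Lemma integral_gauss_rV n :
  (\int[leb n]_z (expR (- dot z z) : R)%:E = (Num.sqrt pi ^+ n)%:E)%E.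
Proof.
elim: n => [|n IH].
  under eq_integral do rewrite /dot big_ord0 oppr0 expR0.
  rewrite integral_cst// mul1e expr0.
  change (dirac (0 : 'rV[R]_0) setT = 1%E :> \bar R).
  by rewrite diracE mem_set.
have m1 m : measurable_fun setT (fun z : 'rV[R]_m => (expR (- dot z z))%:E).
  apply/measurable_EFinP; apply: (measurableT_comp (@measurable_expRN R setT)).
  exact: measurable_dotzz.
rewrite ge0_integral_leb_succ//.
have D (y : 'rV[R]_n) t : dot (cons_rV (y, t)) (cons_rV (y, t)) = t ^+ 2 + dot y y.
  rewrite /dot big_ord_recl !mxE unlift_none -expr2; congr (_ + _).
  by apply: eq_bigr => i _; rewrite !mxE liftK.
under eq_integral => y _.
  under eq_integral do rewrite D opprD expRD mulrC EFinM.
  rewrite ge0_integralZl//; last first.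
    by apply/measurable_EFinP; exact: measurable_gauss_fun.
  rewrite (_ : (\int[_]_t _ = (Num.sqrt pi)%:E)%E); last exact: integralT_gauss.
  rewrite muleC.
  over.
rewrite ge0_integralZl//; last exact: m1.
by rewrite IH -EFinM exprS.
Qed.

Lemma integral_layer n (psi : R -> R) : (0 < n)%N ->
  measurable_fun setT psi -> (forall s, 0 <= psi s) ->
  (forall s, s < 0 -> psi s = 0) ->
  (\int[leb n]_z \int[lam]_s (psi s * (dot z z <= s)%R%:R)%:E =
   (ballvol n)%:E * \int[lam]_s (psi s * s `^ (n%:R / 2))%:E)%E.
Proof.
move=> n0 mpsi psi0 psiN.
have := @layer_cake R _ _ (leb n) (fun=> 1) (fun z => dot z z) psi
  (measurable_cst _) (@measurable_dotzz n) mpsi (fun=> ler01) psi0.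
under eq_integral do rewrite mul1e; move=> ->.
rewrite -ge0_integralZl//; last 3 first.
- by apply/measurable_EFinP; apply: measurable_funM.
- by move=> s _; rewrite lee_fin mulr_ge0// powR_ge0.
- by rewrite lee_fin ballvol_ge0.
apply: eq_integral => s _.
have [s0|s0] := ltP s 0; first by rewrite psiN// mul0e mul0r mule0.
rewrite (_ : (\int[_]_x _)%E = leb n (cball n s)); last first.
  rewrite -[cball n s]setIT -(@integral_indic _ _ _ (leb n))//; last exact: measurable_cball.
  apply: eq_integral => z _; rewrite mul1r indicE; congr (nat_of_bool _)%:R%:E.
  by apply/idP/idP; rewrite inE.
by rewrite leb_cball// -!EFinM mulrCA.
Qed.

(** The Gaussian integral computed twice: as a product over coordinates, and by layers, where balls
    of squared radius [s] contribute [s ^ (n / 2)] against [expR (- s)]. *)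
Lemma ballvol_Gamma n : (0 < n)%N ->
  ballvol n * Gamma (n%:R / 2 + 1) = Num.sqrt pi ^+ n.
Proof.
move=> n0; apply: EFin_inj; rewrite -integral_gauss_rV.
have n20 : (0 : R) < n%:R / 2 by rewrite divr_gt0// ltr0n.
have := @integral_layer n expN0 n0 measurable_expN0 expN0_ge0.
rewrite integral_expN0_powR// eGammaR ?addr_gt0// EFinM => <-.
  by apply: eq_integral => z _; rewrite integral_expN0// dot_ge0.
by move=> s s0; rewrite /expN0 leNgt s0.
Qed.

Lemma ballvol_gt0 n : (0 < n)%N -> 0 < ballvol n.
Proof.
move=> n0; rewrite lt_neqAle ballvol_ge0 andbT eq_sym; apply/eqP => E.
have /eqP := ballvol_Gamma n0; rewrite E mul0r eq_sym expf_eq0 n0 /=.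
by rewrite gt_eqF// sqrtr_gt0 pi_gt0.
Qed.

Lemma mu_frac_ge0 n (a : R) : 0 < a < 1 -> 0 <= mu_frac (R := R) (n := n) a.
Proof.
move=> _; rewrite /mu_frac; apply: divr_ge0; rewrite ?mulr_ge0// ?powR_ge0//;
exact: Gamma_ge0.
Qed.

(** The factor [1 - a] is absorbed by the pole: [(1 - a) / 2 * Gamma ((1 - a) / 2) = Gamma ((3 - a)
    / 2)]. What remains is continuous at [a = 1], with value [pi ^ (- n / 2) * ballvol n * Gamma (n
    / 2 + 1) = 1]. *)
Lemma mu_frac_lim n : (0 < n)%N ->
  mu_frac (n := n) a * ballvol n / (1 - a) @[a --> (1 : R)^'-] --> (1 : R).
Proof.
move=> n0.
have G1 : {for 1, continuous (@Gamma R)} by exact: continuous_Gamma.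
have Gn : {for n%:R / 2 + 1, continuous (@Gamma R)}.
  by apply: continuous_Gamma; rewrite addr_gt0// divr_gt0// ltr0n.
have E : \forall a \near (1 : R)^'-, 2 `^ (a - 1) *
    (pi `^ (- (n%:R / 2)) * ballvol n) *
    Gamma ((n%:R + a + 1) / 2) / Gamma ((3 - a) / 2) =
    mu_frac (n := n) a * ballvol n / (1 - a).
  near=> a.
  have a1 : a < 1 by near: a; exact: nbhs_left_lt.
  have b0 : 0 < (1 - a) / 2 by rewrite divr_gt0// subr_gt0.
  have -> : (3 - a) / 2 = (1 - a) / 2 + 1 by field.
  rewrite -GammaS// /mu_frac powRB; last by rewrite pnatr_eq0 implybT.
  rewrite powRr1//.
  (* Were this value 0, both sides would be 0 because [0^-1 = 0]; this spares a proof that Gamma is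
     positive. *)
  have [->|G0] := eqVneq (Gamma ((1 - a) / 2)) 0.
    by rewrite mulr0 invr0 !(mulr0,mul0r).
  field.
  by rewrite G0 /= gt_eqF// subr_gt0.
apply: cvg_trans; first exact: (near_eq_cvg E).
have V : 2 `^ (1 - 1) * (pi `^ (- (n%:R / 2)) * ballvol n) *
    Gamma ((n%:R + 1 + 1) / 2) / Gamma ((3 - 1) / 2) = 1 :> R.
  have -> : (n%:R + 1 + 1) / 2 = n%:R / 2 + 1 :> R by field.
  have -> : (3 - 1) / 2 = 1 :> R by field.
  rewrite Gamma1 invr1 mulr1 subrr powRr0 mul1r -mulrA ballvol_Gamma//.
  rewrite -powR12_sqrt ?pi_ge0// -powR_mulrn ?powR_ge0// -powRrM.
  rewrite -powRD; last by rewrite (gt_eqF (pi_gt0 _)) implybT.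
  by rewrite [2^-1 * _]mulrC addNr powRr0.
suff W : 2 `^ (a - 1) * (pi `^ (- (n%:R / 2)) * ballvol n) *
    Gamma ((n%:R + a + 1) / 2) / Gamma ((3 - a) / 2) @[a --> (1 : R)^'-] -->
    2 `^ (1 - 1) * (pi `^ (- (n%:R / 2)) * ballvol n) *
    Gamma ((n%:R + 1 + 1) / 2) / Gamma ((3 - 1) / 2) by rewrite V in W.
have idc : (a : R) @[a --> (1:R)^'-] --> (1 : R).
  by apply: cvg_at_left_filter.
apply: cvgM.
  apply: cvgM; first apply: cvgM; last 2 first.
  - exact: cvg_cst.
  - apply: continuous_cvg.
      by have -> : (n%:R + 1 + 1) / 2 = n%:R / 2 + 1 :> R by field.
    apply: cvgM; last exact: cvg_cst.
    apply: cvgD; last exact: cvg_cst.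
    by apply: cvgD => //; exact: cvg_cst.
  rewrite /powR pnatr_eq0 /=.
  apply: continuous_cvg; first exact: continuous_expR.
  by apply: cvgM; [apply: cvgB => //; exact: cvg_cst|exact: cvg_cst].
have e1 : (3 - 1) / 2 = 1 :> R by field.
apply: cvgV; first by rewrite e1 Gamma1 oner_eq0.
apply: continuous_cvg; first (rewrite e1; exact: G1).
apply: cvgM; last exact: cvg_cst.
by apply: cvgB => //; exact: cvg_cst.
Unshelve. all: by end_near. Qed.

End ball_volume.
Arguments cball {R} n s.
Arguments ballvol {R} n.

(** * Norms and partial derivatives *)

Section continuity.
Context {R : realType} {T : topologicalType}.
Implicit Types f g : T -> R.

Lemma contcst (c : R) : continuous (fun _ : T => c).
Proof. by move=> t; exact: cst_continuous. Qed.

Lemma contD f g : continuous f -> continuous g -> continuous (fun t => f t + g t).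
Proof. by move=> cf cg t; apply: cvgD; [exact: cf|exact: cg]. Qed.

Lemma contB f g : continuous f -> continuous g -> continuous (fun t => f t - g t).
Proof. by move=> cf cg t; apply: cvgB; [exact: cf|exact: cg]. Qed.

Lemma contM f g : continuous f -> continuous g -> continuous (fun t => f t * g t).
Proof. by move=> cf cg t; apply: cvgM; [exact: cf|exact: cg]. Qed.

Lemma contsum (I : Type) (r : seq I) (F : I -> T -> R) :
  (forall i, continuous (F i)) -> continuous (fun t => \sum_(i <- r) F i t).
Proof.
move=> cF; elim: r => [|i r IH].
  under eq_fun do rewrite big_nil; exact: contcst.
under eq_fun do rewrite big_cons.
exact: contD.
Qed.

Lemma contcomp (k : R -> R) f : continuous k -> continuous f ->
  continuous (fun t => k (f t)).
Proof. by move=> ck cf t; apply: continuous_comp; [exact: cf|exact: ck]. Qed.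

Lemma contcoord n (f : T -> 'rV[R]_n) i :
  continuous f -> continuous (fun t => f t ord0 i : R).
Proof.
move=> cf t; apply: (@continuous_comp _ _ _ f (fun v : 'rV[R]_n => v ord0 i : R)).
  exact: cf.
exact: coord_continuous.
Qed.

Lemma contrV n (f : T -> 'rV[R]_n) :
  (forall i, continuous (fun t => f t ord0 i : R)) -> continuous f.
Proof.
move=> cf t; apply/cvgrPdist_le => e e0; near=> s.
rewrite [leLHS]/Num.Def.normr/= mx_normrE; apply: bigmax_le; first exact: ltW.
move=> [i j] _ /=; rewrite ord1 !mxE.
move: j; near: s; apply: filter_forall => j.
by move/cvgrPdist_le : (cf j t); apply.
Unshelve. all: by end_near. Qed.

Lemma contaddrV n (f g : T -> 'rV[R]_n) : continuous f -> continuous g ->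
  continuous (fun t => f t + g t).
Proof.
move=> cf cg; apply: contrV => i; under eq_fun do rewrite mxE.
by apply: contD; exact: contcoord.
Qed.

Lemma contdot n (f g : T -> 'rV[R]_n) : continuous f -> continuous g ->
  continuous (fun t => dot (f t) (g t)).
Proof. by move=> cf cg; apply: contsum => i; apply: contM; exact: contcoord. Qed.

Lemma contconst_rV n (v : 'rV[R]_n) : continuous (fun _ : T => v).
Proof. by move=> t; exact: cst_continuous. Qed.

Lemma contcons_rV n (f : T -> 'rV[R]_n) (g : T -> R) : continuous f ->
  continuous g -> continuous (fun t => cons_rV (f t, g t)).
Proof.
move=> cf cg; apply: contrV => i; under eq_fun do rewrite mxE.
by case: (unlift ord0 i) => [j|] //=; exact: contcoord.
Qed.

End continuity.

Lemma contid {T : topologicalType} : continuous (fun t : T => t).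
Proof. by move=> t; exact: cvg_id. Qed.

Section norms.
Context {R : realType} {n : nat}.
Implicit Types x y z : 'rV[R]_n.

Lemma ler_coord_norm z i : `|z ord0 i| <= `|z|.
Proof.
rewrite [leRHS]/Num.Def.normr/= mx_normrE.
exact: (@le_bigmax _ _ _ 0 (fun ij : 'I_1 * 'I_n => `|z ij.1 ij.2|) (ord0, i)).
Qed.

Lemma norm_rV_le z (M : R) : 0 <= M -> (forall i, `|z ord0 i| <= M) -> `|z| <= M.
Proof.
move=> M0 H; rewrite [leLHS]/Num.Def.normr/= mx_normrE.
by apply: bigmax_le => // -[i j] _ /=; rewrite ord1.
Qed.

Lemma enorm_ge0 z : 0 <= enorm z. Proof. exact: sqrtr_ge0. Qed.

Lemma enorm_sqr z : enorm z ^+ 2 = dot z z.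
Proof. by rewrite sqr_sqrtr// dot_ge0. Qed.

Lemma ler_coord_enorm z i : `|z ord0 i| <= enorm z.
Proof.
rewrite -(@ler_pXn2r _ 2) ?nnegrE ?enorm_ge0// enorm_sqr.
by rewrite real_normK ?num_real// dot_coord.
Qed.

Lemma norm_le_enorm z : `|z| <= enorm z.
Proof. by apply: norm_rV_le; [exact: enorm_ge0|exact: ler_coord_enorm]. Qed.

Lemma dot_le_norm z : dot z z <= n%:R * `|z| ^+ 2.
Proof.
rewrite /dot (@le_trans _ _ (\sum_(i < n) `|z| ^+ 2))//.
  apply: ler_sum => i _; rewrite -expr2 -real_normK ?num_real//.
  by rewrite ler_pXn2r ?nnegrE// ler_coord_norm.
by rewrite sumr_const card_ord mulr_natl.
Qed.

Lemma dotDl x y z : dot (x + y) z = dot x z + dot y z.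
Proof.
by rewrite /dot -big_split; apply: eq_bigr => i _; rewrite mxE mulrDl.
Qed.

Lemma dotC x y : dot x y = dot y x.
Proof. by rewrite /dot; apply: eq_bigr => i _; rewrite mulrC. Qed.

Lemma dotZl a x y : dot (a *: x) y = a * dot x y.
Proof. by rewrite /dot mulr_sumr; apply: eq_bigr => i _; rewrite mxE mulrA. Qed.

Lemma dot_eq0 x : dot x x = 0 -> x = 0.
Proof.
move=> x0; apply/rowP => i; rewrite mxE; apply/eqP; rewrite -sqrf_eq0.
by rewrite eq_le sqr_ge0 andbT -x0 dot_coord.
Qed.

Lemma cauchy_schwarz x y : dot x y <= enorm x * enorm y.
Proof.
have [y0|y0] := eqVneq (dot y y) 0.
  rewrite (dot_eq0 y0) dotC /dot big1 ?mulr_ge0 ?enorm_ge0//.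
  by move=> i _; rewrite mxE mul0r.
have yp : 0 < dot y y by rewrite lt_neqAle eq_sym y0 dot_ge0.
rewrite (le_trans (ler_norm _))// -(@ler_pXn2r _ 2) ?nnegrE ?mulr_ge0 ?enorm_ge0//.
rewrite exprMn !enorm_sqr real_normK ?num_real//.
have := dot_ge0 (dot y y *: x + (- dot x y) *: y).
rewrite !dotDl !dotZl ![dot _ (_ + _)]dotC !dotDl !dotZl (dotC y x).
set a := dot x x; set b := dot x y; set c := dot y y.
have -> : c * (c * a + - b * b) + - b * (c * b + - b * c) = c * (a * c - b ^+ 2).
  ring.
by rewrite pmulr_rge0// subr_ge0.
Qed.

Lemma enormD x y : enorm (x + y) <= enorm x + enorm y.
Proof.
rewrite -(@ler_pXn2r _ 2) ?nnegrE ?addr_ge0 ?enorm_ge0//.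
rewrite enorm_sqr sqrrD !enorm_sqr !dotDl ![dot _ (_ + _)]dotC !dotDl (dotC y x).
have := cauchy_schwarz x y; lra.
Qed.

Lemma enormZ a x : enorm (a *: x) = `|a| * enorm x.
Proof. by rewrite /enorm dotZZ sqrtrM ?sqr_ge0// sqrtr_sqr. Qed.

Lemma enorm0 : enorm (0 : 'rV[R]_n) = 0.
Proof. by rewrite /enorm /dot big1 ?sqrtr0// => i _; rewrite mxE mul0r. Qed.

Lemma enorm_sum (I : Type) (r : seq I) (F : I -> 'rV[R]_n) :
  enorm (\sum_(i <- r) F i) <= \sum_(i <- r) enorm (F i).
Proof.
elim: r => [|i r IH]; first by rewrite !big_nil enorm0.
by rewrite !big_cons (le_trans (enormD _ _))// lerD2l.
Qed.

Lemma dot_abs_le z (v : 'rV[R]_n) (S : R) : (forall i, `|v ord0 i| <= S) ->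
  `|dot z v| <= n%:R * S * enorm z.
Proof.
move=> vS; rewrite (le_trans (ler_norm_sum _ _ _))//.
rewrite (@le_trans _ _ (\sum_(i < n) S * enorm z))//.
  apply: ler_sum => i _; rewrite normrM mulrC.
  by rewrite ler_pM// ler_coord_enorm.
by rewrite sumr_const card_ord -[in leRHS]mulrA mulr_natl.
Qed.

Lemma continuous_dotzz : continuous (fun z : 'rV[R]_n => dot z z : R).
Proof. by apply: contdot; exact: contid. Qed.

Lemma continuous_enorm : continuous (fun z : 'rV[R]_n => enorm z : R).
Proof. by apply: contcomp; [exact: sqrt_continuous|exact: continuous_dotzz]. Qed.

Lemma closed_norm_le (M : R) : closed [set z : 'rV[R]_n | `|z| <= M].
Proof.
rewrite (_ : mkset _ = (fun z : 'rV[R]_n => `|z|) @^-1` [set x | x <= M])//.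
apply: closed_comp; last exact: closed_le.
by move=> x _; exact: norm_continuous.
Qed.

Lemma continuous_add_rV (a : 'rV[R]_n) : continuous (fun z : 'rV[R]_n => z + a).
Proof. by apply: contaddrV; [exact: contid|exact: contconst_rV]. Qed.

Lemma continuous_dot_sub (a : 'rV[R]_n) :
  continuous (fun z : 'rV[R]_n => dot (z - a) (z - a) : R).
Proof. by apply: contdot; exact: continuous_add_rV. Qed.

Lemma open_dot_lt (a : 'rV[R]_n) (r : R) : open [set z | dot (z - a) (z - a) < r].
Proof.
apply: (@open_comp _ _ (fun z : 'rV[R]_n => dot (z - a) (z - a)) [set t | t < r]).
  by move=> z _; exact: continuous_dot_sub.
exact: open_lt.
Qed.

Lemma closed_dot_le (a : 'rV[R]_n) (r : R) : closed [set z | dot (z - a) (z - a) <= r].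
Proof.
apply: (@closed_comp _ _ (fun z : 'rV[R]_n => dot (z - a) (z - a)) [set t | t <= r]).
  by move=> z _; exact: continuous_dot_sub.
exact: closed_le.
Qed.

Lemma closed_box_compact (M : R) : compact [set z : 'rV[R]_n | `|z| <= M].
Proof.
apply: bounded_closed_compact.
  exists M; split; first exact: num_real.
  by move=> x Mx z /= zM; rewrite (le_trans zM)// ltW.
exact: closed_norm_le.
Qed.

Lemma measurable_box (M : R) : measurable [set z : 'rV[R]_n | `|z| <= M].
Proof.
rewrite -[X in measurable X]setTI; apply: measurable_fun_le => //.
by apply: continuous_measurable_rVR; exact: norm_continuous.
Qed.

Lemma leb_box_fin (M : R) : (leb n [set z : 'rV[R]_n | (`|z| <= M)%R] < +oo)%E.
Proof.
apply: le_lt_trans (leb_cball_fin n (n%:R * M ^+ 2)).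
apply: le_measure; rewrite ?inE; [exact: measurable_box|exact: measurable_cball|].
move=> z /= zM; apply: (le_trans (dot_le_norm z)).
by rewrite ler_wpM2l// ler_pXn2r ?nnegrE// (le_trans _ zM).
Qed.

Lemma integrable_bounded_box (g : 'rV[R]_n -> R) (C M : R) :
  measurable_fun setT g -> (forall z, `|g z| <= C) ->
  (forall z, M <= `|z| -> g z = 0) -> (leb n).-integrable setT (EFin \o g).
Proof.
move=> mg gC g0.
have C0 : 0 <= C by apply: le_trans (gC 0).
apply: (@le_integrable _ _ _ _ _ _ _
  (EFin \o (fun z => C * \1_[set z : 'rV[R]_n | `|z| <= M] z))) => //.
- exact/measurable_EFinP.
- move=> z _ /=; rewrite lee_fin indicE.
  have [zM|zM] := leP `|z| M.
    by rewrite mem_set//= mulr1 (ger0_norm C0).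
  by rewrite g0 ?normr0// ltW.
- rewrite (_ : EFin \o _ =
    (fun z => C%:E * (\1_[set z : 'rV[R]_n | (`|z| <= M)%R] z)%:E)%E)//.
  apply: integrableZl => //.
  apply/integrableP; split.
    by apply/measurable_EFinP; apply: measurable_indic; exact: measurable_box.
  under eq_integral do rewrite gee0_abs ?lee_fin//.
  rewrite integral_indic//; last exact: measurable_box.
  by rewrite setIT; exact: leb_box_fin.
Qed.

Lemma bounded_support (g : 'rV[R]_n -> R) (M : R) :
  continuous g -> (forall z, M <= `|z| -> g z = 0) ->
  exists C, forall z, `|g z| <= C.
Proof.
move=> cg g0.
have [C [_ HC]] := compact_bounded (continuous_compact
  (continuous_subspaceT cg) (@closed_box_compact M)).
exists (`|C| + 1) => z.
have [zM|zM] := leP `|z| M; last by rewrite g0 ?normr0 ?addr_ge0// ltW.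
apply: (HC (`|C| + 1)); last by exists z.
by rewrite (le_lt_trans (ler_norm _))// ltrDl.
Qed.

Lemma integrable_support (g : 'rV[R]_n -> R) (M : R) :
  continuous g -> (forall z, M <= `|z| -> g z = 0) ->
  (leb n).-integrable setT (EFin \o g).
Proof.
move=> cg g0; have [C HC] := bounded_support cg g0.
apply: integrable_bounded_box HC g0.
exact: continuous_measurable_rVR.
Qed.

End norms.

(** * Calculus along coordinate lines *)

Section lines.
Context {R : realType}.

Lemma is_derive_line (V : normedModType R) (u : V -> R) (z v : V) (t : R) d :
  is_derive (z + t *: v) v u d -> is_derive t 1 (fun s : R => u (z + s *: v)) d.
Proof.
have E : (fun h : R => h^-1 *: (((fun s => u (z + s *: v)) \o shift t) (h *: (1 : R)) -
    u (z + t *: v))) =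
  (fun h : R => h^-1 *: ((u \o shift (z + t *: v)) (h *: v) - u (z + t *: v))).
  apply/funext => h /=; congr (_ *: (u _ - _)).
  by rewrite [h *: (1 : R)]mulr1 scalerDl addrCA.
move=> [du <-]; split; first by rewrite /derivable E.
by rewrite /derive E.
Qed.

(** Restriction to a line: the chain rule for partial derivatives is then inherited from functions
    of one variable. *)
Lemma is_derive_line0 (V : normedModType R) (u : V -> R) (z v : V) d :
  is_derive z v u d <-> is_derive (0 : R) 1 (fun s : R => u (z + s *: v)) d.
Proof.
have E : (fun h : R => h^-1 *: (((fun s => u (z + s *: v)) \o shift 0) (h *: (1 : R)) -
    u (z + 0 *: v))) =
  (fun h : R => h^-1 *: ((u \o shift z) (h *: v) - u z)).
  apply/funext => h /=; rewrite scale0r !addr0; congr (_ *: (u _ - _)).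
  by rewrite [h *: (1 : R)]mulr1 addrC.
split => -[du <-]; split.
- by rewrite /derivable E.
- by rewrite /derive E.
- by move: du; rewrite /derivable E.
- by rewrite /derive E.
Qed.

Lemma is_derive_shift_rV (V : normedModType R) (u : V -> R) (x z v : V) d :
  is_derive (x + z) v u d -> is_derive z v (fun y => u (x + y)) d.
Proof.
move=> /is_derive_line0 H; apply/is_derive_line0.
by under eq_fun do rewrite addrA.
Qed.

Lemma is_derive_comp1 (V : normedModType R) (k : R -> R) (u : V -> R) z v a b :
  is_derive (u z) 1 k a -> is_derive z v u b ->
  is_derive z v (fun y => k (u y)) (a * b).
Proof.
move=> ka /is_derive_line0 ub; apply/is_derive_line0.
apply: (@is_derive1_comp _ k (fun s : R => u (z + s *: v))) => //.
by rewrite scale0r addr0.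
Qed.

Lemma is_derive_coord n (z : 'rV[R]_n) i j :
  is_derive z (delta_mx ord0 i) (fun y : 'rV[R]_n => y ord0 j : R) (i == j)%:R.
Proof.
apply/is_derive_line0.
rewrite (_ : (fun _ => _) = cst (z ord0 j) + (i == j)%:R \*: id).
  by apply: is_derive_eq; rewrite add0r [_ *: _]mulr1.
apply/funext => s; rewrite !mxE eqxx /= eq_sym.
by rewrite /GRing.add /= /GRing.scale /= mulrC.
Qed.

Lemma is_derive_dotzz n (z : 'rV[R]_n) i :
  is_derive z (delta_mx ord0 i) (fun y : 'rV[R]_n => dot y y) (2 * z ord0 i).
Proof.
have -> : (fun y : 'rV[R]_n => dot y y) =
    \sum_(j < n) ((fun y : 'rV[R]_n => y ord0 j : R) * (fun y => y ord0 j)).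
  by apply/funext => y; rewrite /dot fct_sumE.
have H := fun j => is_derive_coord z i j.
have HM j : is_derive z (delta_mx ord0 i)
    ((fun y : 'rV[R]_n => y ord0 j : R) * (fun y => y ord0 j))
    (z ord0 j *: (i == j)%:R + z ord0 j *: (i == j)%:R : R).
  by apply: is_deriveM.
apply: (is_derive_eq (is_derive_sum HM)).
rewrite (bigD1 i)//= eqxx big1 => [|j ji]; last first.
  by rewrite eq_sym (negbTE ji) !scaler0 addr0.
by rewrite addr0 -mulr2n [_ *: _]mulr1 mulr_natl.
Qed.

Lemma integral_derive0 (u du : R -> R) (M : R) :
  (forall t, is_derive (t : R) 1 u (du t)) -> continuous du ->
  (forall t, M <= `|t| -> u t = 0 /\ du t = 0) ->
  (\int[lebesgue_measure]_t (du t)%:E = 0)%E.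
Proof.
move=> dudt cdu u0; pose N := `|M| + 1.
have N0 : 0 < N by rewrite ltr_wpDl.
have MN : M <= N by rewrite (le_trans (ler_norm _))// lerDl.
have NN : - N < N by rewrite gtrN.
transitivity (\int[lebesgue_measure]_(t in `[(- N)%R, N]) (du t)%:E)%E.
  rewrite [RHS]integral_mkcond; apply: eq_integral => t _.
  rewrite patchE; case: ifPn => //; rewrite mem_setE in_itv/= -ler_norml -ltNge.
  by move=> /ltW Nt; rewrite (u0 t _).2// (le_trans MN).
have cu t : {for t, continuous u}.
  by apply/differentiable_continuous/derivable1_diffP; exact: ex_derive.
rewrite (@continuous_FTC2 _ du u)//.
- by rewrite (u0 N _).1 ?(u0 (- N) _).1 ?normrN ?gtr0_norm// subee.
- exact: continuous_subspaceT.
- split; first by move=> t _; exact: ex_derive.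
    by apply: cvg_at_right_filter; exact: cu.
  by apply: cvg_at_left_filter; exact: cu.
- by move=> t _; rewrite derive1E derive_val.
Qed.

Lemma cons_rV_line0 n (y : 'rV[R]_n) (t : R) :
  cons_rV (y, t) = cons_rV (y, 0) + t *: delta_mx ord0 ord0.
Proof.
apply/rowP => i; rewrite !mxE /=.
case: (unliftP ord0 i) => [j ->|->] /=; first by rewrite mulr0 addr0.
by rewrite mulr1 add0r.
Qed.

Lemma cons_rV_line n (y : 'rV[R]_n) (t s : R) j :
  cons_rV (y + s *: delta_mx ord0 j, t) =
  cons_rV (y, t) + s *: delta_mx ord0 (lift ord0 j).
Proof.
apply/rowP => i; rewrite !mxE /=.
case: (unliftP ord0 i) => [k ->|->] /=; last by rewrite mulr0 addr0.
by rewrite !mxE /= (inj_eq (@lift_inj _ _)).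
Qed.

Lemma norm_cons_rV n (y : 'rV[R]_n) (t : R) :
  `|y| <= `|cons_rV (y, t)| /\ `|t| <= `|cons_rV (y, t)|.
Proof.
split.
  apply: norm_rV_le => // i.
  by have := ler_coord_norm (cons_rV (y, t)) (lift ord0 i); rewrite mxE liftK.
by have := ler_coord_norm (cons_rV (y, t)) ord0; rewrite mxE unlift_none.
Qed.

(** Fubini in the order that suits [i]: if [i] is the coordinate split off, the inner integral is
    that of the derivative of a function vanishing far out; otherwise the induction hypothesis kills
    every slice. *)
Lemma integral_partial0 n (i : 'I_n) (u du : 'rV[R]_n -> R) (M : R) :
  (forall z, is_derive z (delta_mx ord0 i) u (du z)) -> continuous du ->
  (forall z, M <= `|z| -> u z = 0 /\ du z = 0) ->
  (\int[leb n]_z (du z)%:E = 0)%E.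
Proof.
elim: n => [|n IH] in i u du M *; first by case: i.
move=> dudi cdu u0.
have idu : (leb n.+1).-integrable setT (EFin \o du).
  by apply: (@integrable_support _ _ _ M) => // z Mz; exact: (u0 z Mz).2.
have [j ij|ij] := unliftP ord0 i.
- rewrite integral_leb_succC//; apply: integral0_eq => t _.
  apply: (IH j (fun y => u (cons_rV (y, t))) _ M).
  + move=> y; apply/is_derive_line0.
    under eq_fun do rewrite cons_rV_line.
    by apply: (iffLR (@is_derive_line0 _ u _ _ _)); rewrite -ij; exact: dudi.
  + move=> y; apply: continuous_comp; last exact: cdu.
    by apply: contcons_rV; [exact: contid|exact: contcst].
  + by move=> y My; apply: u0; rewrite (le_trans My)//; case: (norm_cons_rV y t).
- rewrite integral_leb_succ//; apply: integral0_eq => y _.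
  apply: (@integral_derive0 (fun t => u (cons_rV (y, t))) _ M).
  + move=> t; under eq_fun do rewrite cons_rV_line0.
    apply: is_derive_line; rewrite -cons_rV_line0 -ij; exact: dudi.
  + move=> t; apply: continuous_comp; last exact: cdu.
    by apply: contcons_rV; [exact: contconst_rV|exact: contid].
  + by move=> t Mt; apply: u0; rewrite (le_trans Mt)//; case: (norm_cons_rV y t).
Qed.

(** The increment is performed one coordinate at a time, each by the mean value theorem; hence the
    sum of the [|z_i|] on the right, and partial derivatives are all that is used. *)
Lemma ler_lipschitz_partial n (u : 'rV[R]_n -> R) (du : 'I_n -> 'rV[R]_n -> R) (C : R) :
  (forall i z, is_derive z (delta_mx ord0 i) u (du i z)) ->
  (forall i z, `|du i z| <= C) ->
  forall x z, `|u (x + z) - u x| <= C * \sum_i `|z ord0 i|.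
Proof.
move=> dudi duC x z.
have L1 i y (t : R) : `|u (y + t *: delta_mx ord0 i) - u y| <= C * `|t|.
  have D (s : R) : is_derive s 1 (fun s : R => u (y + s *: delta_mx ord0 i))
      (du i (y + s *: delta_mx ord0 i)).
    exact: is_derive_line.
  have cont a b : {within `[a, b], continuous (fun s : R => u (y + s *: delta_mx ord0 i))}.
    by apply: derivable_within_continuous => s _; exact: ex_derive.
  have E0 : u y = u (y + 0 *: delta_mx ord0 i) by rewrite scale0r addr0.
  have [t0|t0] := leP 0 t.
    have [c _ H] := MVT_segment t0 (fun s _ => D s) (@cont 0 t).
    by rewrite E0 H subr0 normrM ler_wpM2r.
  have [c _ H] := MVT_segment (ltW t0) (fun s _ => D s) (@cont t 0).
  by rewrite distrC E0 H sub0r normrM normrN ler_wpM2r.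
rewrite [in leLHS](row_sum_delta z).
have -> : \sum_(i < n) z ord0 i *: delta_mx 0 i = \sum_(i <- index_enum 'I_n) z ord0 i *: delta_mx ord0 i :> 'rV[R]_n by [].
elim: (index_enum 'I_n) x => [|i r IH] x.
  by rewrite !big_nil addr0 subrr normr0 mulr0.
rewrite !big_cons mulrDr addrA.
rewrite (le_trans (ler_distD (u (x + z ord0 i *: delta_mx ord0 i)) _ _))//.
by rewrite [leRHS]addrC lerD.
Qed.

End lines.

Lemma near_norm_gt (R : realType) (V : normedModType R) (z : V) (M : R) :
  M < `|z| -> \forall y \near z, M < `|y|.
Proof. by move=> Mz; apply: (cvgr_gt `|z|) => //; exact: norm_continuous. Qed.

Section test_fields.
Context {R : realType} {n : nat}.
Variable phi : 'rV[R]_n -> 'rV[R]_n.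
Hypotheses (sphi : smooth phi) (cphi : compact (support_of phi)).

Lemma smooth_continuous : continuous phi.
Proof. by have [] := sphi [::]. Qed.

Lemma smooth_continuous_partial i : continuous (partial i phi).
Proof. by have [] := sphi [:: i]. Qed.

Lemma smooth_is_derive i j x : is_derive x (delta_mx ord0 i)
  (fun y => phi y ord0 j : R) (partial i phi x ord0 j).
Proof.
have [_ /(_ i x) d] := sphi [::].
split; first exact: (derivable_mxP _ _ _).1.
by rewrite /partial derive_mx// mxE.
Qed.

Lemma support_bound : exists M : R, forall z, M <= `|z| ->
  phi z = 0 /\ forall i, partial i phi z = 0.
Proof.
have [M [_ HM]] := compact_bounded cphi.
pose M1 := `|M| + 1.
have M1M : M < M1 by rewrite (le_lt_trans (ler_norm _))// ltrDl.
have phi0 z : M1 < `|z| -> phi z = 0.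
  move=> zM; apply: contrapT => /eqP pz.
  have /(HM M1 M1M) : support_of phi z by apply: subset_closure.
  by rewrite /= leNgt zM.
(* The extra 1 makes [phi] vanish on a neighbourhood of [z], so that its partial derivatives vanish
   at [z] as well. *)
exists (M1 + 1) => z Mz.
have zM : M1 < `|z| by rewrite (lt_le_trans _ Mz)// ltrDl.
split; first exact: phi0.
move=> i.
have H : is_derive z (delta_mx ord0 i) phi 0.
  apply: (near_eq_is_derive (f := cst 0)).
  by apply: filterS (near_norm_gt zM) => y /phi0 ->.
by rewrite /partial derive_val.
Qed.

Lemma continuous_divergence : continuous (divergence phi : 'rV[R]_n -> R).
Proof.
by apply: contsum => i; apply: contcoord; exact: smooth_continuous_partial.
Qed.

Lemma test_bounds : exists M C : R, [/\ 0 <= C,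
  forall z, M <= `|z| -> phi z = 0 /\ forall i, partial i phi z = 0,
  forall z i j, `|partial i phi z ord0 j| <= C,
  forall z j, `|phi z ord0 j| <= C & forall z, `|divergence phi z| <= C].
Proof.
have [M HM] := support_bound.
have B1 : forall ij : 'I_n * 'I_n, exists C, forall z, `|partial ij.1 phi z ord0 ij.2| <= C.
  move=> [i j]; apply: (@bounded_support _ _ _ M).
    by apply: contcoord; exact: smooth_continuous_partial.
  by move=> z /HM[_ ->]; rewrite mxE.
have B2 : forall j : 'I_n, exists C, forall z, `|phi z ord0 j| <= C.
  move=> j; apply: (@bounded_support _ _ _ M).
    by apply: contcoord; exact: smooth_continuous.
  by move=> z /HM[-> _]; rewrite mxE.
have [C3 H3] : exists C, forall z, `|divergence phi z| <= C.
  apply: (@bounded_support _ _ _ M); first exact: continuous_divergence.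
  by move=> z /HM[_ H]; rewrite /divergence big1// => i _; rewrite H mxE.
move: B1 => /choice[C1 H1]; move: B2 => /choice[C2 H2].
have P1 k : 0 <= C1 k by apply: le_trans (H1 k 0).
have P2 k : 0 <= C2 k by apply: le_trans (H2 k 0).
have P3 : 0 <= C3 by apply: le_trans (H3 0).
have S1 : 0 <= \sum_k C1 k by apply: sumr_ge0.
have S2 : 0 <= \sum_k C2 k by apply: sumr_ge0.
exists M, (\sum_k C1 k + \sum_k C2 k + C3); split => //.
- by rewrite !addr_ge0.
- move=> z i j; rewrite (le_trans (H1 (i, j) z))// (bigD1 (i, j))//= -!addrA lerDl.
  by rewrite !addr_ge0//; apply: sumr_ge0.
- move=> z j; rewrite (le_trans (H2 j z))// [X in _ + X + _](bigD1 j)//=.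
  rewrite [X in _ <= X + _]addrCA -addrA lerDl !addr_ge0//.
  by apply: sumr_ge0.
- by move=> z; rewrite (le_trans (H3 z))// lerDr addr_ge0.
Qed.

End test_fields.

(** * Integration by parts against a radial kernel *)

Section ibp.
Context {R : realType} {n : nat}.
Variables (k psi : R -> R) (b : R).
Hypothesis kpsi : forall u : R, 0 < u -> is_derive u 1 k (- psi u).
Hypothesis cpsi : forall u, 0 < u -> {for u, continuous psi}.
Hypothesis kpsi0 : forall u, b <= u -> k u = 0 /\ psi u = 0.

Lemma contcomp_pos (T : topologicalType) (h : R -> R) (f : T -> R) :
  (forall u, 0 < u -> {for u, continuous h}) -> continuous f ->
  (forall t, 0 < f t) -> continuous (fun t => h (f t)).
Proof.
move=> ch cf f0 t; apply: continuous_comp; first exact: cf.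
exact/ch/f0.
Qed.

Let ck u : 0 < u -> {for u, continuous k}.
Proof.
move=> u0; have := kpsi u0 => H.
by apply/differentiable_continuous/derivable1_diffP; exact: ex_derive.
Qed.

(* The shift by [eta > 0] removes the singularity of the kernel at the origin. *)
Lemma radial_ibp (phi : 'rV[R]_n -> 'rV[R]_n) (x : 'rV[R]_n) (eta : R) :
  smooth phi -> compact (support_of phi) -> 0 < eta ->
  (\int[leb n]_z (k (dot z z + eta) * divergence phi (x + z)%R)%:E =
   \int[leb n]_z (2 * psi (dot z z + eta) * dot z (phi (x + z)%R - phi x))%:E)%E.
Proof.
move=> sphi cphi eta0.
(* Beyond [M] the Euclidean norm is at least 1 and at least [b], so its square is at least [b]. *)
pose M := `|b| + 1.
have Mb (z : 'rV[R]_n) : M <= `|z| -> b <= dot z z + eta.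
  move=> Mz; rewrite -enorm_sqr.
  have z1 : 1 <= enorm z.
    by rewrite (le_trans _ (norm_le_enorm z))// (le_trans _ Mz)// lerDr.
  have bz : b <= enorm z.
    rewrite (le_trans _ (norm_le_enorm z))// (le_trans _ Mz)//.
    by rewrite (le_trans (ler_norm _))// lerDl.
  rewrite ler_wpDr ?(ltW eta0)//.
  by rewrite (le_trans bz)// expr2 ler_peMr ?enorm_ge0.
have pos (z : 'rV[R]_n) : 0 < dot z z + eta by rewrite ltr_wpDl// dot_ge0.
have cr : continuous (fun z : 'rV[R]_n => dot z z + eta : R).
  by apply: contD; [exact: continuous_dotzz|exact: contcst].
have ckr : continuous (fun z : 'rV[R]_n => k (dot z z + eta)).
  exact: contcomp_pos.
have cpr : continuous (fun z : 'rV[R]_n => psi (dot z z + eta)).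
  exact: contcomp_pos.
have cphix : continuous (fun z => phi (x + z) - phi x).
  have cs : continuous (fun z => x + z).
    by apply: contaddrV; [exact: contconst_rV|exact: contid].
  apply: contaddrV; last exact: contconst_rV.
  by move=> z; apply: continuous_comp; [exact: cs|exact: smooth_continuous].
have cshift (f : 'rV[R]_n -> R) : continuous f -> continuous (fun z => f (x + z)).
  move=> cf z; apply: (@continuous_comp _ _ _ (fun z => x + z)); last exact: cf.
  by apply: contaddrV; [exact: contconst_rV|exact: contid].
pose A z := k (dot z z + eta) * divergence phi (x + z).
pose B z := 2 * psi (dot z z + eta) * dot z (phi (x + z) - phi x).
have cA : continuous A.
  by apply: contM => //; apply: cshift; exact: continuous_divergence.
have cB : continuous B.
  apply: contM; first by apply: contM => //; exact: contcst.
  by apply: contdot => //; exact: contid.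
have A0 z : M <= `|z| -> A z = 0 by move=> /Mb /kpsi0[kz _]; rewrite /A kz mul0r.
have B0 z : M <= `|z| -> B z = 0 by move=> /Mb /kpsi0[_ pz]; rewrite /B pz mulr0 mul0r.
have iA := integrable_support cA A0.
have iB := integrable_support cB B0.
(* The i-th partial derivative of [k (dot z z + eta)] times the i-th coordinate of
   [phi (x + z) - phi x]. The constant [phi x] does not change the divergence, and it makes the term
   with [psi] of order [dot z z * psi], which survives [eta -> 0]. *)
pose du i z := k (dot z z + eta) * partial i phi (x + z) ord0 i -
  2 * psi (dot z z + eta) * z ord0 i * (phi (x + z) - phi x) ord0 i.
have cdu i : continuous (du i).
  apply: contB.
    apply: contM => //; apply: (cshift (fun y => partial i phi y ord0 i)).
    apply: contcoord; exact: smooth_continuous_partial.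
  apply: contM; last exact: contcoord.
  by apply: contM; [apply: contM => //; exact: contcst|apply: contcoord; exact: contid].
have du0 i z : M <= `|z| -> du i z = 0.
  by move=> /Mb /kpsi0[kz pz]; rewrite /du kz pz mulr0 !mul0r subrr.
have idu i := integrable_support (cdu i) (@du0 i).
have E : (\int[leb n]_z (A z - B z)%:E = 0)%E.
  transitivity (\int[leb n]_z (\sum_(i < n) (du i z)%:E))%E.
    apply: eq_integral => z _; rewrite sumEFin; congr EFin.
    rewrite /du big_split /= -mulr_sumr sumrN; congr (_ - _).
    by rewrite /B /dot mulr_sumr; apply: eq_bigr => i _; rewrite mulrA.
  rewrite (integral_sum measurableT idu) big1// => i _.
  apply: (@integral_partial0 _ _ i (fun z => k (dot z z + eta) *
    (phi (x + z) - phi x) ord0 i) (du i) M) => //; last first.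
    by move=> z Mz; split; [have [kz _] := kpsi0 (Mb _ Mz); rewrite kz mul0r|exact: du0].
  move=> z.
  have D1 : is_derive z (delta_mx ord0 i) (fun z : 'rV[R]_n => k (dot z z + eta))
      (- psi (dot z z + eta) * (2 * z ord0 i)).
    apply: is_derive_comp1; first exact/kpsi/pos.
    have := is_derive_dotzz z i => H.
    by apply: (is_derive_eq (is_deriveD H (is_derive_cst eta z _))); rewrite addr0.
  have D2 : is_derive z (delta_mx ord0 i) (fun z => (phi (x + z) - phi x) ord0 i : R)
      (partial i phi (x + z) ord0 i).
    under eq_fun do rewrite !mxE.
    have H := is_derive_shift_rV (smooth_is_derive sphi i i (x + z)).
    apply: (is_derive_eq (is_deriveB H (is_derive_cst (phi x ord0 i) z _))).
    by rewrite subr0.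
  apply: (is_derive_eq (is_deriveM D1 D2)).
  by rewrite /du /GRing.scale /=; ring.
rewrite -[LHS]fineK ?(integrable_fin_num measurableT iA)//.
rewrite -[RHS]fineK ?(integrable_fin_num measurableT iB)//.
congr EFin; apply/eqP; rewrite -subr_eq0; apply/eqP; apply: EFin_inj.
rewrite EFinB !fineK ?(integrable_fin_num measurableT iA)
  ?(integrable_fin_num measurableT iB)//.
by rewrite -integralB_EFin.
Qed.

End ibp.

(** * Radial kernels as tail integrals of a decreasing profile *)

Section profile.
Context {R : realType}.
Notation lam := (@lebesgue_measure R).
Variables (psi : R -> R) (b : R).
Hypothesis mpsi : measurable_fun setT psi.
Hypothesis psi_ge0 : forall s, 0 <= psi s.
Hypothesis psib : forall s, b <= s -> psi s = 0.
Hypothesis dpsi : forall s t : R, 0 < s -> s <= t -> psi t <= psi s.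
Hypothesis cpsi : forall u, 0 < u -> {for u, continuous psi}.

Definition tail (u : R) : R := \int[lam]_(s in `[u, +oo[) psi s.

(** Extended-real form with the half-line as an indicator: it is what Tonelli needs, and it may be
    infinite at [u = 0], where [psi] is allowed to be singular. *)
Definition etail (u : R) : \bar R := (\int[lam]_s (psi s * (u <= s)%R%:R)%:E)%E.

Lemma etailE u : etail u = (\int[lam]_(s in `[u, +oo[) (psi s)%:E)%E.
Proof.
apply: integral_patchR => // s; rewrite mem_setE in_itv/= andbT.
by case: ifP; rewrite ?mulr1 ?mulr0.
Qed.

Lemma tailE u : tail u = fine (etail u).
Proof. by rewrite etailE. Qed.

Lemma etail_ge0 u : (0 <= etail u)%E.
Proof. by apply: integral_ge0 => s _; rewrite lee_fin mulr_ge0. Qed.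

Lemma integrable_tail u : 0 < u -> lam.-integrable `[u, +oo[ (EFin \o psi).
Proof.
move=> u0.
apply: (@le_integrable _ (measurableTypeR R) R lam `[u, +oo[ _ (EFin \o psi)
  (fun s : measurableTypeR R => ((psi u)%:E * (\1_(`[u, b]%classic) s)%:E)%E)) => //.
- by apply/measurable_EFinP; exact: measurable_funTS.
- move=> s /=; rewrite in_itv/= andbT => us.
  rewrite lee_fin ger0_norm// ger0_norm; last by rewrite mulr_ge0.
  have [sb|/ltW bs] := leP s b; last by rewrite psib// mulr_ge0.
  by rewrite indicE mem_set/= ?in_itv/= ?us// mulr1 dpsi.
- apply: integrableZl => //; apply/integrableP; split.
    by apply/measurable_EFinP; exact: measurable_indic.
  under eq_integral do rewrite gee0_abs ?lee_fin//.
  rewrite integral_indic//.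
  apply: (@le_lt_trans _ _ (lam `[u, b])); first exact: measureIl.
  rewrite [X in (X < _)%E]lebesgue_measure_itv/=.
  by case: ifP; rewrite ltry.
Qed.

Lemma etail_tail u : 0 < u -> etail u = (tail u)%:E.
Proof.
move=> u0; rewrite tailE fineK// etailE.
exact: (integrable_fin_num _ (integrable_tail u0)).
Qed.

Lemma tail_ge0 u : 0 <= tail u.
Proof. by rewrite tailE fine_ge0// etail_ge0. Qed.

Lemma tail_eq0 u : b <= u -> tail u = 0.
Proof.
move=> bu; rewrite tailE (_ : etail u = 0%E)//.
apply: integral0_eq => s _; have [us|] := leP u s; last by rewrite mulr0.
by rewrite psib ?mul0r// (le_trans bu).
Qed.

Let mle : measurable_fun [set: measurableTypeR R * measurableTypeR R]
  (fun p => (p.1 <= p.2)%R%:R : R).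
Proof.
rewrite (_ : (fun _ => _) = \1_[set p | (p.1 <= p.2)%R]); last first.
  apply/funext => p; rewrite indicE; congr (nat_of_bool _)%:R.
  by apply/idP/idP => [/mem_set//|]; rewrite inE.
apply: measurable_indic; rewrite -[X in measurable X]setTI.
exact: measurable_fun_le.
Qed.

Lemma measurable_etail : measurable_fun setT etail.
Proof.
apply: (@measurable_fun_fubini_tonelli_F _ _ (measurableTypeR R)
  (measurableTypeR R) R lam (fun p => (psi p.2 * (p.1 <= p.2)%R%:R)%:E)).
  apply/measurable_EFinP; apply: measurable_funM => //.
  exact: measurableT_comp mpsi measurable_snd.
by move=> p; rewrite lee_fin mulr_ge0.
Qed.

Lemma measurable_tail : measurable_fun setT tail.
Proof.
rewrite (_ : tail = fine \o etail); last by apply/funext => u; rewrite tailE.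
by apply: measurableT_comp; [exact: fine_measurable|exact: measurable_etail].
Qed.

Let measurable_etail_int u : measurable_fun setT (fun s : R => (psi s * (u <= s)%R%:R)%:E).
Proof.
apply/measurable_EFinP; apply: measurable_funM => //.
exact: (measurableT_comp mle (measurable_pair1 u)).
Qed.

Lemma le_etail u v : u <= v -> (etail v <= etail u)%E.
Proof.
move=> uv; apply: ge0_le_integral => //.
- by move=> s _; rewrite lee_fin mulr_ge0.
- exact: measurable_etail_int.
- exact: measurable_etail_int.
- move=> s _; rewrite lee_fin ler_wpM2l// ler_nat.
  by have [vs|//] := leP v s; rewrite (le_trans uv vs).
Qed.

Lemma le_tail u v : 0 < u -> u <= v -> tail v <= tail u.
Proof.
move=> u0 uv; rewrite -lee_fin -!etail_tail ?le_etail//.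
exact: lt_le_trans uv.
Qed.

(** Monotonicity of [psi] on [[u / 2, u]]. It bounds [dot z z * psi (dot z z)] by a multiple of
    [tail (dot z z / 2)], which is integrable: this controls the singular side of the integration by
    parts. *)
Lemma tail_lower u : 0 < u -> u / 2 * psi u <= tail (u / 2).
Proof.
move=> u0; have u20 : 0 < u / 2 by rewrite divr_gt0.
have uu : u / 2 < u by rewrite ltr_pdivrMr// ltr_pMr// ltr1n.
rewrite -lee_fin -etail_tail//.
have -> : (u / 2 * psi u)%:E =
    (\int[lam]_s (psi u * \1_(`[(u / 2)%R, u]%classic) s)%:E)%E.
  transitivity ((psi u)%:E * \int[lam]_s (\1_(`[(u / 2)%R, u]%classic) s)%:E)%E.
    rewrite integral_indic// setIT [X in (_ * X)%E]lebesgue_measure_itv/= lte_fin uu.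
    by rewrite -EFinB -EFinM; congr EFin; field.
  rewrite -ge0_integralZl//.
    by apply/measurable_EFinP; exact: measurable_indic.
  by rewrite lee_fin.
apply: ge0_le_integral => //.
- by move=> s _; rewrite lee_fin mulr_ge0.
- apply/measurable_EFinP; apply: measurable_funM => //; exact: measurable_indic.
- exact: measurable_etail_int.
- move=> s _; rewrite lee_fin indicE.
  case: (boolP (s \in _)) => [|_]; last by rewrite mulr0 mulr_ge0.
  rewrite inE /= in_itv/= => /andP[us su]; rewrite us !mulr1.
  by rewrite dpsi// (lt_le_trans u20).
Qed.

(** The fundamental theorem is applied from [a = u / 2], since [psi] need not be integrable at 0. *)
Lemma is_derive_tail (u : R) : 0 < u -> is_derive u 1 tail (- psi u).
Proof.
move=> u0; pose a := u / 2; have a0 : 0 < a by rewrite divr_gt0.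
have au : a < u by rewrite ltr_pdivrMr// ltr_pMr// ltr1n.
pose F x := \int[lam]_(t in [set` `[a, x]]) psi t.
have i1 : lam.-integrable `[a, u + 1] (EFin \o psi).
  apply: integrableS (integrable_tail a0) => // t /=.
  by rewrite !in_itv/= andbT => /andP[].
have [dF F'] : derivable F u 1 /\ derive1 F u = psi u.
  by apply: (@continuous_FTC1_closed _ psi a u (u + 1)) => //; [rewrite ltrDl|exact: cpsi].
have E : \forall x \near u, tail a - F x = tail x.
  near=> x.
  have ax : a < x by near: x; exact: lt_nbhsr.
  rewrite /tail /F Rintegral_itvB//; first last.
  - by rewrite bnd_simp ltW.
  - exact: integrable_tail.
  rewrite Rintegral_itv_obnd_cbnd//.
  apply: integrableS (integrable_tail a0) => // t /=.
  by rewrite !in_itv/= !andbT => /ltW; apply: le_trans; exact: ltW.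
apply: (near_eq_is_derive E).
have dF' : is_derive u 1 F (psi u).
  by split; [exact: dF|rewrite -derive1E; exact: F'].
have c := is_derive_cst (tail a) u (1 : R).
by apply: (is_derive_eq (is_deriveB c dF')); rewrite sub0r.
Unshelve. all: by end_near. Qed.

Lemma continuous_tail u : 0 < u -> {for u, continuous tail}.
Proof.
move=> u0; have H := is_derive_tail u0.
by apply/differentiable_continuous/derivable1_diffP; exact: ex_derive.
Qed.

Section radial.
Variable n : nat.
Hypothesis n0 : (0 < n)%N.
Hypothesis psiN : forall s, s < 0 -> psi s = 0.
Hypothesis moment : (\int[lam]_s (psi s * s `^ (n%:R / 2))%:E < +oo)%E.

Lemma ae_neq0 : {ae leb n, forall z : 'rV[R]_n, 0 < dot z z}.
Proof.
exists (cball n 0); split; first exact: measurable_cball.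
  by rewrite leb_cball// powR0 ?mulr0// gt_eqF// divr_gt0// ltr0n.
by move=> z /= /negP; rewrite -leNgt.
Qed.

Lemma measurable_tail_dot c : measurable_fun setT (fun z : 'rV[R]_n => tail (c * dot z z)).
Proof.
apply: measurableT_comp; first exact: measurable_tail.
by apply: measurable_funM => //; exact: measurable_dotzz.
Qed.

Lemma integral_tail :
  (\int[leb n]_z (tail (dot z z))%:E =
   (ballvol n)%:E * \int[lam]_s (psi s * s `^ (n%:R / 2))%:E)%E.
Proof.
rewrite -integral_layer//.
apply: ge0_ae_eq_integral => //.
- apply/measurable_EFinP; apply: measurableT_comp; first exact: measurable_tail.
  exact: measurable_dotzz.
- apply: (measurableT_comp measurable_etail); exact: measurable_dotzz.
- by move=> z _; rewrite lee_fin tail_ge0.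
- by move=> z _; exact: etail_ge0.
- by apply: filterS ae_neq0 => z z0 _; rewrite -etail_tail.
Qed.

Lemma integrable_tail_dot : (leb n).-integrable setT (fun z => (tail (dot z z))%:E).
Proof.
apply/integrableP; split.
  apply/measurable_EFinP; apply: measurableT_comp; first exact: measurable_tail.
  exact: measurable_dotzz.
under eq_integral do rewrite gee0_abs ?lee_fin ?tail_ge0//.
by rewrite integral_tail lte_mul_pinfty ?lee_fin ?ballvol_ge0.
Qed.

Lemma integrable_tail_half : (leb n).-integrable setT (fun z => (tail (dot z z / 2))%:E).
Proof.
have mt : measurable_fun setT (fun z : 'rV[R]_n => (tail (dot z z / 2))%:E).
  apply/measurable_EFinP; under eq_fun do rewrite mulrC; exact: measurable_tail_dot.
apply/integrableP; split => //.
under eq_integral do rewrite gee0_abs ?lee_fin ?tail_ge0//.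
have r0 : 0 < Num.sqrt 2^-1 :> R by rewrite sqrtr_gt0 invr_gt0.
have m2 : measurable_fun setT (fun z : 'rV[R]_n => (tail (dot z z))%:E).
  exact: (measurable_int _ integrable_tail_dot).
have := ge0_integral_leb_affine 0 r0 m2 (fun z => ltac:(by rewrite lee_fin tail_ge0)).
have -> : (\int[leb n]_z (tail (dot (Num.sqrt 2^-1 *: z + 0)%R
    (Num.sqrt 2^-1 *: z + 0)%R))%:E = \int[leb n]_z (tail (dot z z / 2))%:E)%E.
  by apply: eq_integral => z _; rewrite addr0 dotZZ sqr_sqrtr ?invr_ge0// mulrC.
move=> ->.
rewrite lte_mul_pinfty ?lee_fin ?invr_ge0 ?exprn_ge0 ?(ltW r0)//.
have := integrableP _ _ _ integrable_tail_dot => -[_].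
by under eq_integral do rewrite gee0_abs ?lee_fin ?tail_ge0//.
Qed.

(** [eta -> 0] along [1 / (m + 1)] by dominated convergence on both sides. Monotonicity of [tail]
    gives the left majorant; [tail_lower] and the Lipschitz bound on [phi] give the right one. *)
Lemma radial_ibp0 (phi : 'rV[R]_n -> 'rV[R]_n) (x : 'rV[R]_n) :
  smooth phi -> compact (support_of phi) ->
  [/\ (leb n).-integrable setT
        (fun z => (tail (dot z z) * divergence phi (x + z)%R)%:E),
      (leb n).-integrable setT
        (fun z => (2 * psi (dot z z) * dot z (phi (x + z)%R - phi x))%:E) &
  (\int[leb n]_z (tail (dot z z) * divergence phi (x + z)%R)%:E =
   \int[leb n]_z (2 * psi (dot z z) * dot z (phi (x + z)%R - phi x))%:E)%E].
Proof.
move=> sphi cphi.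
have [M [C [C0 HM dC phiC divC]]] := test_bounds sphi cphi.
have cshift m (f : 'rV[R]_n -> 'rV[R]_m) : continuous f -> continuous (fun z => f (x + z)).
  move=> cf z; apply: (@continuous_comp _ _ _ (fun z => x + z)); last exact: cf.
  by apply: contaddrV; [exact: contconst_rV|exact: contid].
pose e (m : nat) : R := m.+1%:R^-1.
have e0 m : 0 < e m by rewrite invr_gt0.
have ecvg : e @ \oo --> (0 : R) by exact: cvg_harmonic.
have ecvg' (u : R) : u + e m @[m --> \oo] --> u.
  by rewrite -[X in _ --> X]addr0; apply: cvgD => //; exact: cvg_cst.
have mdiv : measurable_fun setT (fun z => divergence phi (x + z)).
  apply: continuous_measurable_rVR => z.
  apply: (@continuous_comp _ _ _ (fun z => x + z)).
    by apply: contaddrV; [exact: contconst_rV|exact: contid].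
  exact: continuous_divergence.
have mdelta : measurable_fun setT (fun z : 'rV[R]_n => dot z (phi (x + z) - phi x)).
  apply: continuous_measurable_rVR; apply: contdot; first exact: contid.
  apply: contaddrV; last exact: contconst_rV.
  by apply: cshift; exact: smooth_continuous.
have mdot c : measurable_fun setT (fun z : 'rV[R]_n => dot z z + c).
  by apply: measurable_funD => //; exact: measurable_dotzz.
pose f1 m z : \bar R := (tail (dot z z + e m) * divergence phi (x + z)%R)%:E.
pose g1 (z : 'rV[R]_n) : \bar R := (C%:E * (tail (dot z z))%:E)%E.
have ig1 : (leb n).-integrable setT g1 by apply: integrableZl => //; exact: integrable_tail_dot.
pose f2 m z : \bar R := (2 * psi (dot z z + e m) * dot z (phi (x + z)%R - phi x))%:E.
(* The integrand is at most [2 * psi u * (n * (C * n)) * u] with [u = dot z z]; writing [u] as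
   [2 * (u / 2)] to apply [tail_lower] doubles the constant. *)
pose c2 := 4 * (n%:R * (C * n%:R)).
have c20 : 0 <= c2 by rewrite !mulr_ge0.
pose g2 (z : 'rV[R]_n) : \bar R := (c2%:E * (tail (dot z z / 2))%:E)%E.
have ig2 : (leb n).-integrable setT g2 by apply: integrableZl => //; exact: integrable_tail_half.
have mpsid c : measurable_fun setT (fun z : 'rV[R]_n => psi (dot z z + c)).
  exact: measurableT_comp mpsi (mdot c).
have mf1 m : measurable_fun setT (f1 m).
  apply/measurable_EFinP; apply: measurable_funM => //.
  exact: measurableT_comp measurable_tail (mdot _).
have mf10 : measurable_fun setT
    (fun z => (tail (dot z z) * divergence phi (x + z)%R)%:E).
  apply/measurable_EFinP; apply: measurable_funM => //.
  exact: measurableT_comp measurable_tail (@measurable_dotzz R n).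
have c1 : {ae leb n, forall z, setT z -> f1 ^~ z @ \oo -->
    (tail (dot z z) * divergence phi (x + z)%R)%:E}.
  apply: filterS ae_neq0 => z z0 _; apply: cvg_EFin; first by near=> m.
  apply: cvgM; last exact: cvg_cst.
  by apply: continuous_cvg; [exact: continuous_tail|exact: ecvg'].
have d1 : {ae leb n, forall z m, setT z -> (`|f1 m z| <= g1 z)%E}.
  apply: filterS ae_neq0 => z z0 m _; rewrite /f1 /g1 /= lee_fin normrM.
  by rewrite mulrC ler_pM// ger0_norm ?tail_ge0// le_tail// lerDl ltW.
have [I1 _ L1] := dominated_convergence measurableT mf1 mf10 c1 ig1 d1.
have lip z j : `|(phi (x + z) - phi x) ord0 j| <= C * n%:R * enorm z.
  rewrite !mxE.
  have D i y : is_derive y (delta_mx ord0 i) (fun y => phi y ord0 j : R)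
    (partial i phi y ord0 j) by exact: smooth_is_derive.
  apply: le_trans (ler_lipschitz_partial D (fun i y => dC y i j) x z) _.
  rewrite -mulrA ler_wpM2l//.
  rewrite (@le_trans _ _ (\sum_(i < n) enorm z))//.
    by apply: ler_sum => i _; exact: ler_coord_enorm.
  by rewrite sumr_const card_ord mulr_natl.
have mf2 m : measurable_fun setT (f2 m).
  by apply/measurable_EFinP; apply: measurable_funM => //; apply: measurable_funM.
have mf20 : measurable_fun setT
    (fun z => (2 * psi (dot z z) * dot z (phi (x + z)%R - phi x))%:E).
  apply/measurable_EFinP; apply: measurable_funM => //; apply: measurable_funM => //.
  exact: measurableT_comp mpsi (@measurable_dotzz R n).
have cc2 : {ae leb n, forall z, setT z -> f2 ^~ z @ \oo -->
    (2 * psi (dot z z) * dot z (phi (x + z)%R - phi x))%:E}.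
  apply: filterS ae_neq0 => z z0 _; apply: cvg_EFin; first by near=> m.
  apply: cvgM; last exact: cvg_cst.
  apply: cvgM; first exact: cvg_cst.
  by apply: continuous_cvg; [exact: cpsi|exact: ecvg'].
have d2 : {ae leb n, forall z m, setT z -> (`|f2 m z| <= g2 z)%E}.
  apply: filterS ae_neq0 => z z0 m _; rewrite /f2 /g2 /= lee_fin normrM.
  rewrite normrM ger0_norm// (ger0_norm (psi_ge0 _)).
  rewrite (@le_trans _ _ (2 * psi (dot z z) *
    (n%:R * (C * n%:R * enorm z) * enorm z)))//.
    rewrite ler_pM// ?mulr_ge0//; last exact: dot_abs_le.
    by rewrite ler_wpM2l// dpsi// lerDl ltW.
  have := ler_wpM2l c20 (tail_lower z0); apply: le_trans.
  rewrite le_eqVlt; apply/orP; left; apply/eqP.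
  by rewrite -enorm_sqr /c2; field.
have [I2 _ L2] := dominated_convergence measurableT mf2 mf20 cc2 ig2 d2.
split => //.
have E m : (\int[leb n]_z f1 m z = \int[leb n]_z f2 m z)%E.
  apply: (radial_ibp (b := b)) => //.
  - exact: is_derive_tail.
  - by move=> u bu; split; [exact: tail_eq0|exact: psib].
apply: (cvg_unique _ _ L2); first exact: ereal_hausdorff.
have <- : (fun m => \int[leb n]_z f1 m z)%E = (fun m => \int[leb n]_z f2 m z)%E.
  by apply/funext => m; exact: E.
exact: L1.
Unshelve. all: by end_near. Qed.

End radial.
End profile.

(** * The truncated kernel of the fractional divergence *)

Section far_weight.
Context {R : realType}.
Notation lam := (@lebesgue_measure R).

Lemma integral_powRN (r a : R) : 0 < r -> 0 < a ->
  (\int[lam]_(s in `[a, +oo[) (r * s `^ (- r - 1))%:E = (a `^ (- r))%:E)%E.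
Proof.
move=> r0 a0.
have D (x : R) : a <= x -> is_derive x 1 (fun s => - s `^ (- r)) (r * x `^ (- r - 1)).
  move=> ax; have x0 : 0 < x by exact: lt_le_trans ax.
  have H := is_derive1_powR (- r) x0.
  by apply: (is_derive_eq (is_deriveN H)); rewrite mulNr opprK.
have Cx (p x : R) : 0 < x -> {for x, continuous (fun s : R => s `^ p)}.
  move=> x0; apply/differentiable_continuous/derivable1_diffP.
  by apply: derivable_powR; rewrite in_itv/= andbT.
rewrite (@ge0_continuous_FTC2y _ (fun s => r * s `^ (- r - 1)) (fun s => - s `^ (- r)) a 0).
- by rewrite EFinN oppeK add0e.
- by move=> x _; rewrite mulr_ge0 ?powR_ge0// ltW.
- apply: continuous_in_subspaceT => x; rewrite inE /= in_itv/= andbT => ax.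
  by apply: cvgM; [exact: cvg_cst|apply: Cx; exact: lt_le_trans ax].
- rewrite -oppr0; apply: cvgN.
  apply/cvgrPdist_lt => e e0; near=> x.
  have x1 : 1 <= x by near: x; exact: nbhs_pinfty_ge.
  rewrite sub0r normrN ger0_norm ?powR_ge0// powRN.
  rewrite invf_plt ?posrE ?powR_gt0 ?(lt_le_trans _ x1)//.
  have : e^-1 `^ (r^-1) < x by near: x; apply: nbhs_pinfty_gt; exact: num_real.
  move=> /(@gt0_ltr_powR _ r r0); rewrite !nnegrE powR_ge0 (le_trans ler01 x1).
  move=> /(_ isT isT); rewrite -powRrM mulVf ?gt_eqF// powRr1//.
  by rewrite invr_ge0 ltW.
- by move=> x ax; have := D x (ltW ax) => H; exact: ex_derive.
- by apply: cvgN; apply: cvg_at_right_filter; exact: Cx.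
- move=> x; rewrite in_itv/= andbT => ax; have := D x (ltW ax) => H.
  by rewrite derive1E derive_val.
Unshelve. all: by end_near. Qed.

Variable n : nat.
Hypothesis n0 : (0 < n)%N.
(** This is [(n + alpha) / 2] at [alpha = 1/2], the slowest decay to be dominated. *)
Let r : R := n%:R / 2 + 4^-1.
Let r0 : 0 < r. Proof. by rewrite addr_gt0// ?divr_gt0 ?invr_gt0 ?ltr0n. Qed.

(* An integrable weight that dominates the far part of the kernel for every
   alpha in [1/2, 1[. *)
Definition farw (z : 'rV[R]_n) : R := (Num.max 1 (dot z z)) `^ (- (n%:R / 2 + 4^-1)).

(** Minus the derivative of [s ^ (- r)] beyond 1: its tail at [dot z z] is [farw z], so the layer
    formula computes the mass of [farw]. *)
Let psi2 (s : R) : R := if 1 <= s then r * s `^ (- r - 1) else 0.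

Let mpsi2 : measurable_fun setT psi2.
Proof.
apply: measurable_fun_ifT => //; first exact: measurable_fun_ler.
by apply: measurable_funM => //; exact: measurable_powRl.
Qed.

Let psi20 s : 0 <= psi2 s.
Proof. by rewrite /psi2; case: ifP => // _; rewrite mulr_ge0 ?powR_ge0// ltW. Qed.

Let etail2 u : (\int[lam]_s (psi2 s * (u <= s)%R%:R)%:E = ((Num.max 1 u) `^ (- r))%:E)%E.
Proof.
rewrite -integral_powRN//; last by rewrite lt_max ltr01.
apply: integral_patchR => // s; rewrite mem_setE in_itv/= andbT /psi2 ge_max.
case: (1 <= s) => /=; last by rewrite mul0r.
by case: (u <= s); rewrite ?mulr1 ?mulr0.
Qed.

Lemma farw_ge0 z : 0 <= farw z. Proof. exact: powR_ge0. Qed.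

Lemma measurable_farw : measurable_fun setT farw.
Proof.
apply: (measurableT_comp (@measurable_powR R _)).
by apply: measurable_maxr => //; exact: measurable_dotzz.
Qed.

Lemma integrable_farw : (leb n).-integrable setT (EFin \o farw).
Proof.
apply/integrableP; split; first by apply/measurable_EFinP; exact: measurable_farw.
under eq_integral do rewrite /= ger0_norm ?farw_ge0// /farw -/r -etail2.
rewrite integral_layer//; last first.
  by move=> s s0; rewrite /psi2 leNgt (lt_trans s0).
rewrite lte_mul_pinfty ?lee_fin ?ballvol_ge0//.
have -> : (\int[lam]_s (psi2 s * s `^ (n%:R / 2))%:E =
    (4 * r)%:E * \int[lam]_(s in `[1%R, +oo[) (4^-1 * s `^ (- 4^-1 - 1))%:E)%E.
  rewrite -ge0_integralZl//.
  - apply: integral_patchR => // s; rewrite mem_setE in_itv/= andbT /psi2.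
    case: ifPn => s1; last by rewrite mul0r.
    have s0 : 0 < s by exact: lt_le_trans s1.
    rewrite -mulrA -powRD; last by rewrite (gt_eqF s0) implybT.
    rewrite (_ : 4 * r * _ = r * s `^ (- 4^-1 - 1)); last by field.
    by congr (_ * _ `^ _); rewrite /r; field.
  - by apply/measurable_EFinP; apply: measurable_funM => //; exact: measurable_powRl.
  - by move=> s _; rewrite lee_fin mulr_ge0 ?powR_ge0.
  - by rewrite lee_fin mulr_ge0// ltW.
by rewrite integral_powRN// powR1 mule1 ltry.
Qed.

Lemma integrable_farw_scale (b : R) : 0 < b ->
  (leb n).-integrable setT (fun z : 'rV[R]_n => (farw ((Num.sqrt b)^-1 *: z))%:E).
Proof.
move=> b0; have s0 : 0 < (Num.sqrt b)^-1 by rewrite invr_gt0 sqrtr_gt0.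
have mf : measurable_fun setT (fun z : 'rV[R]_n => (farw ((Num.sqrt b)^-1 *: z))%:E).
  apply/measurable_EFinP; apply: measurableT_comp; first exact: measurable_farw.
  exact: measurable_scale_rV.
apply/integrableP; split => //.
under eq_integral do rewrite gee0_abs ?lee_fin ?farw_ge0//.
have mf0 : measurable_fun setT (EFin \o farw) by apply/measurable_EFinP; exact: measurable_farw.
have := ge0_integral_leb_affine 0 s0 mf0 (fun z => ltac:(by rewrite lee_fin farw_ge0)).
have -> : (\int[leb n]_z (EFin \o farw) ((Num.sqrt b)^-1 *: z + 0)%R =
    \int[leb n]_z (farw ((Num.sqrt b)^-1 *: z))%:E)%E.
  by apply: eq_integral => z _; rewrite addr0.
move=> ->; rewrite lte_mul_pinfty ?lee_fin ?invr_ge0 ?exprn_ge0 ?(ltW s0)//.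
have := integrableP _ _ _ integrable_farw => -[_].
by under eq_integral do rewrite /= ger0_norm ?farw_ge0//.
Qed.

(** The minimum is what the truncation leaves over: a constant inside the ball, the whole kernel
    outside; [Num.sqrt u] is the length of [z]. As [b <= 1], the power [b ^ (- (n + al) / 2)] is at
    most [b ^ (- (n + 1) / 2)], so the right side is free of [al]. *)
Lemma far_bound (al b u : R) : 2^-1 <= al < 1 -> 0 < b <= 1 -> 0 < u ->
  Num.sqrt u * Num.min (u `^ (- ((n%:R + al + 1) / 2))) (b `^ (- ((n%:R + al + 1) / 2))) <=
  b `^ (- ((n%:R + 1) / 2)) * Num.max 1 (u / b) `^ (- (n%:R / 2 + 4^-1)).
Proof.
move=> /andP[al2 al1] /andP[b0 b1] u0.
set q := (n%:R + al + 1) / 2.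
have uE (v : R) : 0 < v -> Num.sqrt v * v `^ (- q) = v `^ (- ((n%:R + al) / 2)).
  move=> v0; rewrite -powR12_sqrt ?(ltW v0)// -powRD; last by rewrite (gt_eqF v0) implybT.
  by congr (_ `^ _); rewrite /q; field.
have bb : b `^ (- ((n%:R + al) / 2)) <= b `^ (- ((n%:R + 1) / 2)).
  rewrite ger_powR ?b0// lerN2 ler_pM2r ?invr_gt0// lerD2l ltW//.
have [ub|bu] := leP u b.
  rewrite max_l; last by rewrite ler_pdivrMr// mul1r.
  rewrite powR1 mulr1 (le_trans _ bb)// -uE//.
  rewrite ler_pM ?sqrtr_ge0// ?ler_sqrt ?(ltW b0)//.
    by rewrite le_min !powR_ge0.
  by rewrite ge_min lexx orbT.
have ub1 : 1 < u / b by rewrite ltr_pdivlMr// mul1r.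
rewrite max_r ?(ltW ub1)//.
rewrite (@le_trans _ _ (u `^ (- ((n%:R + al) / 2))))//.
  by rewrite -uE// ler_wpM2l ?sqrtr_ge0// ge_min lexx.
have ubb : u = u / b * b by rewrite divfK// gt_eqF.
rewrite [in leLHS]ubb.
rewrite powRM ?(ltW b0) ?divr_ge0 ?(ltW u0) ?(ltW b0)//.
rewrite mulrC ler_pM ?powR_ge0//.
rewrite ler_powR ?(ltW ub1)// lerN2; lra.
Qed.

End far_weight.

Section kernel.
Context {R : realType}.
Notation lam := (@lebesgue_measure R).
Variables (n : nat) (al b : R).
Hypotheses (n0 : (0 < n)%N) (al01 : 0 < al < 1) (b0 : 0 < b).

Let q : R := (n%:R + al + 1) / 2.
Let mu : R := mu_frac (n := n) al.

(* Chosen so that [2 * prof (dot z z) *: z] is the kernel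
   mu z / |z|^(n + al + 1) minus mu z / b^((n + al + 1) / 2), set to 0 for
   |z|^2 >= b, and is minus the gradient of [kern z]. *)
Definition prof (s : R) : R := if 0 < s then
  mu_frac (n := n) al / 2 * Num.max 0 (s `^ (- ((n%:R + al + 1) / 2)) -
  b `^ (- ((n%:R + al + 1) / 2))) else 0.

Let q0 : 0 < q.
Proof.
by case/andP: al01 => a0 _; rewrite divr_gt0// addr_gt0// ltr_wpDl.
Qed.

Let mu0 : 0 <= mu. Proof. exact: mu_frac_ge0. Qed.

Let mu20 : 0 <= mu_frac (n := n) al / 2.
Proof. by apply: divr_ge0; [exact: mu0|]. Qed.

Lemma powRN_anti (p s t : R) : 0 <= p -> 0 < s -> s <= t -> t `^ (- p) <= s `^ (- p).
Proof.
move=> p0 s0 st; rewrite !powRN lef_pV2 ?posrE ?powR_gt0 ?(lt_le_trans s0)//.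
by apply: ge0_ler_powR => //; rewrite nnegrE ltW// (lt_le_trans s0).
Qed.

Lemma measurable_prof : measurable_fun setT prof.
Proof.
apply: measurable_fun_ifT => //; first exact: measurable_fun_ltr.
apply: measurable_funM => //; apply: measurable_maxr => //.
by apply: measurable_funB => //; exact: measurable_powRl.
Qed.

Lemma prof_ge0 s : 0 <= prof s.
Proof.
by rewrite /prof; case: ifP => // _; rewrite mulr_ge0 ?mu20// le_max lexx.
Qed.

Lemma prof_eq0 s : b <= s -> prof s = 0.
Proof.
move=> bs; rewrite /prof (lt_le_trans b0 bs) max_l ?mulr0//.
by rewrite subr_le0 powRN_anti// ltW.
Qed.

Lemma prof_anti s t : 0 < s -> s <= t -> prof t <= prof s.
Proof.
move=> s0 st; rewrite /prof s0 (lt_le_trans s0 st) ler_wpM2l ?mu20//.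
rewrite ge_max le_max lexx /= le_max lerD2r.
by rewrite (@powRN_anti q s t) ?orbT// ltW.
Qed.

Lemma profN s : s < 0 -> prof s = 0.
Proof. by move=> s0; rewrite /prof ltNge (ltW s0). Qed.

Lemma continuous_prof s : 0 < s -> {for s, continuous prof}.
Proof.
move=> s0.
have E : \forall t \near s, mu / 2 * Num.max 0 (t `^ (- q) - b `^ (- q)) = prof t.
  by near=> t; rewrite /prof ifT//; near: t; exact: lt_nbhsr.
apply: cvg_trans; first exact: (near_eq_cvg E).
rewrite /prof s0; apply: cvgM; first exact: cvg_cst.
have C : {for s, continuous (fun t : R => t `^ (- q) - b `^ (- q))}.
  have C0 : {for s, continuous (fun t : R => t `^ (- q))}.
    apply/differentiable_continuous/derivable1_diffP.
    by apply: derivable_powR; rewrite in_itv/= andbT.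
  by apply: cvgB; [exact: C0|exact: cvg_cst].
apply: (@continuous_max _ _ (cst 0) (fun t : R => t `^ (- q) - b `^ (- q))) => //.
exact: cst_continuous.
Unshelve. all: by end_near. Qed.

Let c1 : R := b `^ ((1 - al) / 2) / ((1 - al) / 2).
Let c2 : R := b `^ (- q) * (b `^ (n%:R / 2 + 1) / (n%:R / 2 + 1)).

Lemma integral_powR1 (p : R) : 0 < p ->
  (\int[lam]_(s in `]0%R, b]) (s `^ (p - 1))%:E = (b `^ p / p)%:E)%E.
Proof.
move=> p0; have := integral_powR p0 b0.
under eq_integral do rewrite EFinM.
rewrite ge0_integralZl//; last 3 first.
- by apply/measurable_EFinP; exact: measurable_powRl.
- by move=> s _; rewrite lee_fin powR_ge0.
- by rewrite lee_fin ltW.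
move=> /(congr1 (fun x => (p^-1)%:E * x)%E).
by rewrite muleA -!EFinM mulVf ?gt_eqF// mul1e mulrC.
Qed.

Lemma prof_moment : (\int[lam]_s (prof s * s `^ (n%:R / 2))%:E =
  (mu / 2 * (c1 - c2))%:E)%E.
Proof.
have h0 : 0 <= mu / 2 by rewrite divr_ge0.
pose f s := Num.max 0 (s `^ (- q) - b `^ (- q)) * s `^ (n%:R / 2).
have f0 s : 0 <= f s by rewrite mulr_ge0 ?powR_ge0// le_max lexx.
have mf D : measurable_fun D f.
  apply: measurable_funM; last exact: measurable_powRl.
  by apply: measurable_maxr => //; apply: measurable_funB => //; exact: measurable_powRl.
have n20 : (0 : R) < n%:R / 2 + 1 by rewrite addr_gt0// divr_gt0// ltr0n.
have a20 : 0 < (1 - al) / 2.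
  by case/andP: al01 => _ a1; rewrite divr_gt0// subr_gt0.
(* The subtracted constant is put on the left so that only nonnegative integrals are added;
   finiteness of the first integral then comes with the identity. *)
have E : (\int[lam]_(s in `]0%R, b]) (f s)%:E + c2%:E = c1%:E)%E.
  rewrite /c1 -integral_powR1// /c2 EFinM -integral_powR1// addrK.
  rewrite -ge0_integralZl//; last 3 first.
  - by apply/measurable_EFinP; exact: measurable_powRl.
  - by move=> s _; rewrite lee_fin powR_ge0.
  - by rewrite lee_fin powR_ge0.
  rewrite -ge0_integralD//.
  - apply: eq_integral => s; rewrite inE /= in_itv/= => /andP[s0 sb].
    rewrite -EFinM -EFinD; congr EFin; rewrite /f max_r; last first.
      by rewrite subr_ge0 powRN_anti// ltW.
    rewrite mulrBl subrK -powRD; last by rewrite (gt_eqF s0) implybT.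
    by congr (_ `^ _); rewrite /q; field.
  - by move=> s _; rewrite lee_fin.
  - by apply/measurable_EFinP; apply: mf.
  - by move=> s _; rewrite lee_fin mulr_ge0 ?powR_ge0.
  - by apply/measurable_EFinP; apply: measurable_funM => //; exact: measurable_powRl.
have E2 : (\int[lam]_(s in `]0%R, b]) (f s)%:E = (c1 - c2)%:E)%E.
  move: E; case: (\int[lam]_(s in _) _)%E (@integral_ge0 _ _ _ lam `]0%R, b]%classic
    (fun s => (f s)%:E) (fun s _ => f0 s)) => [r|//|//] _.
  by rewrite -EFinD => -[<-]; rewrite addrK.
transitivity (\int[lam]_(s in `]0%R, b]) ((mu / 2)%:E * (f s)%:E))%E.
  rewrite [RHS]integral_mkcond; apply: eq_integral => s _.
  rewrite patchE mem_setE in_itv/=; case: ifPn => [/andP[s0 sb]|].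
    by rewrite /prof s0 /f -EFinM mulrA.
  rewrite negb_and -leNgt -ltNge => /orP[s0|bs].
    by rewrite /prof ltNge s0 /= mul0r.
  by rewrite prof_eq0 ?mul0r// ltW.
rewrite ge0_integralZl//.
- by rewrite E2 -EFinM.
- by apply/measurable_EFinP; apply: mf.
- by move=> s _; rewrite lee_fin.
Qed.

Definition kern (z : 'rV[R]_n) : R := tail prof (dot z z).

(** [ballvol n] times the moment of [prof]. As [al -> 1] with [b] fixed, the first term, with
    denominator [(1 - al) / 2], carries the limit 1; the second, due to the subtracted constant, has
    only the vanishing factor mu. *)
Definition kmass : R := ballvol n * (mu_frac (n := n) al / 2 *
  (b `^ ((1 - al) / 2) / ((1 - al) / 2) - b `^ ((1 - al) / 2) / (n%:R / 2 + 1))).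

Lemma kern_ge0 z : 0 <= kern z.
Proof. exact: (tail_ge0 prof_ge0). Qed.

Lemma kern_eq0 z : b <= dot z z -> kern z = 0.
Proof. exact: (tail_eq0 prof_eq0). Qed.

Let moment : (\int[lam]_s (prof s * s `^ (n%:R / 2))%:E < +oo)%E.
Proof. by rewrite prof_moment ltry. Qed.

Lemma measurable_kern : measurable_fun setT kern.
Proof.
exact: (measurableT_comp (measurable_tail measurable_prof prof_ge0) (@measurable_dotzz R n)).
Qed.

Lemma integral_kern : (\int[leb n]_z (kern z)%:E = kmass%:E)%E.
Proof.
have := integral_tail measurable_prof prof_ge0 prof_eq0 prof_anti n0 profN.
move=> ->; rewrite prof_moment -EFinM; congr (_ * (_ * (_ - _)))%:E.
rewrite /c2 mulrA -powRD; last by rewrite (gt_eqF b0) implybT.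
by congr (_ `^ _ / _); rewrite /q; field.
Qed.

Lemma integrable_kern : (leb n).-integrable setT (EFin \o kern).
Proof.
exact: (integrable_tail_dot measurable_prof prof_ge0 prof_eq0 prof_anti n0 profN moment).
Qed.

Lemma kern_ibp (phi : 'rV[R]_n -> 'rV[R]_n) (x : 'rV[R]_n) :
  smooth phi -> compact (support_of phi) ->
  [/\ (leb n).-integrable setT
        (fun z => (kern z * divergence phi (x + z)%R)%:E),
      (leb n).-integrable setT
        (fun z => (2 * prof (dot z z) * dot z (phi (x + z)%R - phi x))%:E) &
  (\int[leb n]_z (kern z * divergence phi (x + z)%R)%:E =
   \int[leb n]_z (2 * prof (dot z z) * dot z (phi (x + z)%R - phi x))%:E)%E].
Proof.
exact: (radial_ibp0 measurable_prof prof_ge0 prof_eq0 prof_anti continuous_prof n0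
  profN moment).
Qed.

Definition farc : R := 2 * n%:R * b `^ (- ((n%:R + 1) / 2)) *
  \int[leb n]_z farw ((Num.sqrt b)^-1 *: z).

(** The error depends on [phi] only through its sup bound [S]: the difference of the two kernels is
    bounded at the origin, so no derivative of [phi] enters. This uniformity over test fields is
    what the upper bound needs. *)
Lemma frac_div_near (phi : 'rV[R]_n -> 'rV[R]_n) (x : 'rV[R]_n) (S : R) :
  2^-1 <= al -> b <= 1 ->
  smooth phi -> compact (support_of phi) ->
  (forall y j, `|phi y ord0 j| <= S) ->
  `|frac_div al phi x - \int[leb n]_z (kern z * divergence phi (x + z))| <=
  mu_frac (n := n) al * S * farc.
Proof.
move=> al2 b1 sphi cphi phiS; have [I1 I2 E] := kern_ibp x sphi cphi.
pose A z := 2 * prof (dot z z) * dot z (phi (x + z) - phi x).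
pose V z := mu * (dot z (phi (x + z) - phi x) / enorm z `^ (n%:R + al + 1)).
pose F z := V z - A z.
have S0 : 0 <= S.
  by apply: le_trans (phiS 0 (Ordinal n0)); exact: normr_ge0.
pose K := 2 * n%:R * b `^ (- ((n%:R + 1) / 2)) * (mu * S).
have K0 : 0 <= K by apply: mulr_ge0;
  [apply: mulr_ge0; [exact: mulr_ge0|exact: powR_ge0]|exact: mulr_ge0].
have Fle z : `|F z| <= K * farw ((Num.sqrt b)^-1 *: z).
  have [z0|z0] := eqVneq z 0.
    have dot0 w : dot (0 : 'rV[R]_n) w = 0.
      by rewrite /dot big1// => i _; rewrite mxE mul0r.
    have -> : F z = 0 by rewrite /F /V /A z0 dot0 !(mulr0, mul0r) subrr.
    by rewrite normr0 mulr_ge0 ?farw_ge0.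
  have u0 : 0 < dot z z.
    rewrite lt_neqAle dot_ge0 andbT eq_sym; apply: contra_neq z0; exact: dot_eq0.
  have -> : F z = mu * Num.min (dot z z `^ (- q)) (b `^ (- q)) *
      dot z (phi (x + z) - phi x).
    have enE : enorm z `^ (n%:R + al + 1) = dot z z `^ q.
      rewrite /enorm -powR12_sqrt ?(ltW u0)// -powRrM; congr (_ `^ _).
      by rewrite /q mulrC.
    rewrite /F /V /A /prof u0 enE -/q -/mu.
    set w := dot z (phi (x + z) - phi x).
    rewrite -powRN; set P := dot z z `^ (- q); set Q := b `^ (- q).
    (* [P - max 0 (P - Q) = min P Q]: removing the truncated kernel caps the full one at its value
       on the sphere. *)
    have [PQ|QP] := leP P Q.
      by rewrite max_l ?subr_le0//; ring.
    by rewrite max_r ?subr_ge0 ?(ltW QP)//; field.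
  have dS j : `|(phi (x + z) - phi x) ord0 j| <= 2 * S.
    rewrite !mxE (le_trans (ler_normB _ _))// mulr_natl mulr2n lerD//.
  rewrite normrM (ger0_norm (_ : 0 <= mu * _)); last first.
    by rewrite mulr_ge0// le_min !powR_ge0.
  rewrite (@le_trans _ _ (mu * Num.min (dot z z `^ (- q)) (b `^ (- q)) *
    (n%:R * (2 * S) * enorm z)))//.
    by rewrite ler_wpM2l ?dot_abs_le// mulr_ge0// le_min !powR_ge0.
  have al_ : 2^-1 <= al < 1 by rewrite al2; case/andP: al01.
  have b01 : 0 < b <= 1 by rewrite b0.
  have FB := far_bound n al_ b01 u0.
  have -> : farw ((Num.sqrt b)^-1 *: z) = Num.max 1 (dot z z / b) `^ (- (n%:R / 2 + 4^-1)).
    rewrite /farw dotZZ exprVn sqr_sqrtr ?(ltW b0)// mulrC//.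
  have c0 : 0 <= 2 * n%:R * mu * S.
    by apply: mulr_ge0 => //; apply: mulr_ge0 => //; exact: mulr_ge0.
  have := ler_wpM2l c0 FB; rewrite /K /enorm -/q => H.
  apply: le_trans (le_trans H _); rewrite le_eqVlt; apply/orP; left; apply/eqP; ring.
have mxz : measurable_fun setT (fun z : 'rV[R]_n => phi (x + z)).
  apply: continuous_measurable_rV => z.
  apply: (@continuous_comp _ _ _ (fun z => x + z)); last exact: smooth_continuous.
  by apply: contaddrV; [exact: contconst_rV|exact: contid].
have mw : measurable_fun setT (fun z : 'rV[R]_n => dot z (phi (x + z) - phi x)).
  by apply: measurable_dot => //; apply: measurable_add_rV => //; exact: measurable_cst.
have men : measurable_fun setT (fun z : 'rV[R]_n => (enorm z `^ (n%:R + al + 1))^-1).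
  under eq_fun do rewrite -powRN.
  apply: (measurableT_comp (@measurable_powR R _)).
  by apply: continuous_measurable_rVR; exact: continuous_enorm.
have mV : measurable_fun setT V by apply: measurable_funM => //; apply: measurable_funM.
have mA : measurable_fun setT A by have /measurable_EFinP := measurable_int _ I2.
have mF : measurable_fun setT F by exact: measurable_funB.
have Ifar := integrable_farw_scale n0 b0.
have IF : (leb n).-integrable setT (EFin \o F).
  apply: (@le_integrable _ _ _ (leb n) setT _ (EFin \o F)
    (fun z : 'rV[R]_n => (K%:E * (farw ((Num.sqrt b)^-1 *: z))%:E)%E)) => //.
  - exact/measurable_EFinP.
  - by move=> z _ /=; rewrite lee_fin (ger0_norm (_ : 0 <= K * _))// mulr_ge0// farw_ge0.
  - exact: integrableZl.
have IA : (leb n).-integrable setT (EFin \o A) by [].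
have IV : (leb n).-integrable setT (EFin \o V).
  rewrite (_ : V = fun z => A z + F z); last by apply/funext => z; rewrite /F addrC subrK.
  exact: (integrableD measurableT IA IF).
have -> : frac_div al phi x = \int[leb n]_z V z.
  (* Pulling [mu] out of the integral requires the unscaled integrand to be integrable, which is
     read off from [V] by dividing by [mu]; if [mu = 0] both sides vanish. *)
  have [m00|m00] := eqVneq mu 0.
    rewrite /frac_div -/mu /V m00 mul0r; under [RHS]eq_Rintegral do rewrite mul0r.
    by rewrite /Rintegral integral0.
  have IV' : (leb n).-integrable setT (EFin \o (fun z : 'rV[R]_n =>
      dot z (phi (x + z) - phi x) / enorm z `^ (n%:R + al + 1))).
    rewrite (_ : EFin \o _ = (fun z => (mu^-1)%:E * (EFin \o V) z)%E).
      exact: integrableZl.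
    by apply/funext => z; rewrite /comp -EFinM /V (mulKf m00).
  have -> : \int[leb n]_z V z = mu * \int[leb n]_z (dot z (phi (x + z) - phi x) / enorm z `^ (n%:R + al + 1)).
    exact: (RintegralZl mu measurableT IV').
  rewrite /frac_div; apply: (congr1 (fun t => mu * t)).
  rewrite /Rintegral; apply: (congr1 fine).
  rewrite -[RHS](@integral_leb_shift R n (- x)).
    apply: eq_integral => y _; rewrite addrC; congr (_%:E).
    by rewrite addNKr.
  by apply/measurable_EFinP; apply: measurable_funM.
have -> : \int[leb n]_z (kern z * divergence phi (x + z)) = \int[leb n]_z A z.
  by rewrite /Rintegral E.
rewrite -RintegralB//.
rewrite (le_trans (le_normr_Rintegral measurableT IF))//.
have -> : mu_frac (n := n) al * S * farc =
    \int[leb n]_z (K * farw ((Num.sqrt b)^-1 *: z)).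
  by rewrite (RintegralZl K measurableT Ifar) /farc /K /mu; ring.
apply: le_Rintegral => //.
- exact: (integrable_norm IF).
- exact: (integrableZl measurableT K Ifar).
Qed.

End kernel.

(** * Convergence of the fractional divergence *)

Section localization.
Context {R : realType} {n : nat}.
Hypothesis n0 : (0 < n)%N.

Lemma near_alpha (c : R) : c < 1 -> \forall a \near (1 : R)^'-, c <= a < 1.
Proof.
move=> c1; near=> a; apply/andP; split; last by near: a; exact: nbhs_left_lt.
by near: a; apply: nbhs_left_ge.
Unshelve. all: by end_near. Qed.

Lemma near_half : \forall a \near (1 : R)^'-, 2^-1 <= a < 1.
Proof. by apply: near_alpha; rewrite invf_lt1// ltr1n. Qed.

Lemma mu_frac_cvg0 : mu_frac (R := R) (n := n) a @[a --> (1 : R)^'-] --> (0 : R).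
Proof.
have E : \forall a \near (1 : R)^'-,
    mu_frac (n := n) a * ballvol n / (1 - a) * ((1 - a) / ballvol n) =
    mu_frac (n := n) a.
  near=> a.
  have a1 : 1 - a != 0.
    by rewrite subr_eq0 eq_sym lt_eqF.
  have w0 : ballvol n != 0 :> R by rewrite gt_eqF// ballvol_gt0.
  by set m := mu_frac a; field; rewrite w0 a1.
apply: cvg_trans; first exact: (near_eq_cvg E).
rewrite -[X in _ `=>` nbhs X](mulr0 (1 : R)); apply: cvgM.
  exact: mu_frac_lim.
rewrite -[X in _ --> X](mul0r (ballvol n)^-1); apply: cvgM; last exact: cvg_cst.
rewrite -[X in _ --> X](subrr 1); apply: cvgB; first exact: cvg_cst.
exact: cvg_at_left_filter.
Unshelve. all: by end_near. Qed.

Lemma kmass_cvg1 (b : R) : 0 < b -> kmass n a b @[a --> (1 : R)^'-] --> (1 : R).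
Proof.
move=> b0.
pose P (a : R) := expR ((1 - a) / 2 * ln b).
have PE a : b `^ ((1 - a) / 2) = P a by rewrite /powR gt_eqF.
have E : \forall a \near (1 : R)^'-,
    P a * (mu_frac (n := n) a * ballvol n / (1 - a)) -
    P a * (mu_frac (n := n) a * (ballvol n / (n%:R + 2))) = kmass n a b.
  near=> a; rewrite /kmass PE.
  have a1 : 1 - a != 0.
    by rewrite subr_eq0 eq_sym lt_eqF.
  have n20 : n%:R + 2 != 0 :> R by rewrite gt_eqF// ltr_wpDl.
  set m := mu_frac a; field.
  by rewrite n20 a1.
have P1 : P a @[a --> (1 : R)^'-] --> (1 : R).
  have H : (1 - a) / 2 * ln b @[a --> (1 : R)^'-] --> (0 : R); last first.
    suff : P a @[a --> (1 : R)^'-] --> (expR 0 : R) by rewrite expR0.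
    by apply: continuous_cvg H; exact: continuous_expR.
  rewrite -[X in _ --> X](mul0r (ln b)); apply: cvgM; last exact: cvg_cst.
  rewrite -[X in _ --> X](mul0r 2^-1); apply: cvgM; last exact: cvg_cst.
  rewrite -[X in _ --> X](subrr 1); apply: cvgB; first exact: cvg_cst.
  exact: cvg_at_left_filter.
apply: cvg_trans; first exact: (near_eq_cvg E).
rewrite -[X in _ `=>` nbhs X](subr0 (1 : R)) -[X in _ `=>` nbhs (X - _)](mulr1 (1 : R))
  -[X in _ `=>` nbhs (_ - X)](mulr0 (1 : R)).
apply: cvgB; apply: cvgM => //; first exact: mu_frac_lim.
rewrite -[X in _ --> X](mul0r (ballvol n / (n%:R + 2))).
by apply: cvgM; [exact: mu_frac_cvg0|exact: cvg_cst].
Unshelve. all: by end_near. Qed.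

Lemma kmass_ge0 (a b : R) : 0 < a < 1 -> 0 < b -> 0 <= kmass n a b.
Proof.
move=> a01 b0; rewrite -lee_fin -integral_kern//.
by apply: integral_ge0 => z _; rewrite lee_fin kern_ge0.
Qed.

Lemma smooth_partial (phi : 'rV[R]_n -> 'rV[R]_n) j : smooth phi -> smooth (partial j phi).
Proof. by move=> sphi s; have := sphi (rcons s j); rewrite /partials foldr_rcons. Qed.

Lemma compact_support_bound (phi : 'rV[R]_n -> 'rV[R]_n) (M : R) :
  (forall z, M <= `|z| -> phi z = 0) -> compact (support_of phi).
Proof.
move=> H; have cB := @closed_box_compact R n M.
apply: (@subclosed_compact _ _ _ _ cB); first exact: closed_closure.
rewrite /support_of (iffLR (closure_id _) (@closed_norm_le R n M)); apply: closureS => z /= pz.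
by rewrite leNgt; apply: contra pz => Mz; rewrite H// ltW.
Qed.

Lemma compact_support_partial (phi : 'rV[R]_n -> 'rV[R]_n) j :
  compact (support_of phi) -> compact (support_of (partial j phi)).
Proof.
move=> cphi; have [M HM] := support_bound cphi.
by apply: (@compact_support_bound _ M) => z Mz; exact: (HM z Mz).2.
Qed.

Lemma divergence_lipschitz (phi : 'rV[R]_n -> 'rV[R]_n) :
  smooth phi -> compact (support_of phi) ->
  exists2 L : R, 0 <= L & forall x z, `|divergence phi (x + z) - divergence phi x| <= L * enorm z.
Proof.
move=> sphi cphi.
have B1 : forall j, exists C : R, forall i z, `|partial i (partial j phi) z ord0 j| <= C.
  move=> j; have [M [C [_ _ H _ _]]] := test_bounds
    (@smooth_partial _ j sphi) (@compact_support_partial _ j cphi).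
  by exists C.
have [C HC] := choice B1.
have D i z : is_derive z (delta_mx ord0 i) (divergence phi : 'rV[R]_n -> R)
    (\sum_j partial i (partial j phi) z ord0 j).
  rewrite (_ : divergence phi = \sum_j (fun y => partial j phi y ord0 j : R)); last first.
    by apply/funext => y; rewrite fct_sumE.
  by apply: is_derive_sum => j; apply: smooth_is_derive; exact: smooth_partial.
have B i z : `|\sum_j partial i (partial j phi) z ord0 j| <= \sum_j `|C j|.
  rewrite (le_trans (ler_norm_sum _ _ _))//; apply: ler_sum => j _.
  by rewrite (le_trans (HC _ _ _))// ler_norm.
have S0 : 0 <= \sum_j `|C j| by exact: sumr_ge0.
exists ((\sum_j `|C j|) * n%:R) => [|x z]; first exact: mulr_ge0.
rewrite (le_trans (ler_lipschitz_partial D B x z))// -mulrA ler_wpM2l//.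
rewrite (@le_trans _ _ (\sum_(i < n) enorm z))//.
  by apply: ler_sum => i _; exact: ler_coord_enorm.
by rewrite sumr_const card_ord mulr_natl.
Qed.

(** First the cut is fixed according to the Lipschitz constant of the divergence, then [a -> 1].
    Three errors add up: the far part, the oscillation of the divergence on the ball, and the defect
    of [kmass] from 1. *)
Lemma frac_div_cvg (phi : 'rV[R]_n -> 'rV[R]_n) (e : R) :
  smooth phi -> compact (support_of phi) -> 0 < e ->
  \forall a \near (1 : R)^'-, forall x, `|frac_div a phi x - divergence phi x| <= e.
Proof.
move=> sphi cphi e0.
have [M [S [S0 _ _ phiS divS]]] := test_bounds sphi cphi.
have [L L0 HL] := divergence_lipschitz sphi cphi.
(* Cut radius: the divergence oscillates by at most [L * d <= e / 4] on the ball, and the kernel has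
   mass at most 2, so this error is [e / 2]; the two others get [e / 4] each. The minimum with 1
   ensures [b <= 1] for [frac_div_near]. *)
pose d := Num.min 1 (e / (4 * (L + 1))).
have L1 : 0 < L + 1 by rewrite ltr_wpDl.
have d0 : 0 < d by rewrite lt_min ltr01 divr_gt0// mulr_gt0.
pose b := d ^+ 2.
have b0 : 0 < b by rewrite exprn_gt0.
have b1 : b <= 1 by rewrite expr_le1// ?ge_min ?lexx// ltW.
have Ld : L * d <= e / 4.
  rewrite (@le_trans _ _ ((L + 1) * (e / (4 * (L + 1)))))//.
    by apply: ler_pM => //; [exact: ltW|rewrite lerDl|rewrite ge_min lexx orbT].
  by rewrite le_eqVlt; apply/orP; left; apply/eqP; field; rewrite gt_eqF.
have K1 : `|1 - kmass n a b| @[a --> (1 : R)^'-] --> (0 : R).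
  rewrite -[X in _ --> X](normr0 R) -(subrr (1 : R)).
  by apply: cvg_norm; apply: cvgB; [exact: cvg_cst|exact: kmass_cvg1].
have mS : mu_frac (n := n) a * S * farc n b @[a --> (1 : R)^'-] --> (0 : R).
  rewrite -[X in _ --> X](mul0r (S * farc n b)); under eq_fun do rewrite -mulrA.
  by apply: cvgM; [exact: mu_frac_cvg0|exact: cvg_cst].
near=> a => x.
have /andP[a2 a1] : 2^-1 <= a < 1 by near: a; exact: near_half.
have a01 : 0 < a < 1 by rewrite a1 andbT (lt_le_trans _ a2) ?invr_gt0.
have N := frac_div_near n0 a01 b0 x a2 b1 sphi cphi phiS.
have mSa : mu_frac (n := n) a * S * farc n b <= e / 4.
  by near: a; apply: (cvgr_le 0) => //; rewrite divr_gt0.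
have ka1 : `|1 - kmass n a b| <= 1 by near: a; apply: (cvgr_le 0).
have kaS : `|1 - kmass n a b| <= e / (4 * (S + 1)).
  by near: a; apply: (cvgr_le 0) => //; rewrite divr_gt0// mulr_gt0// ltr_wpDl.
have [I1 _ _] := kern_ibp n0 a01 b0 x sphi cphi.
have Ik := integrable_kern n0 a01 b0.
have k0 := fun z : 'rV[R]_n => kern_ge0 b a01 z.
have Rk c : \int[leb n]_z (kern a b z * c) = kmass n a b * c.
  have -> : (fun z : 'rV[R]_n => kern a b z * c) = (fun z => c * kern a b z).
    by apply/funext => z; rewrite mulrC.
  by rewrite (RintegralZl c measurableT Ik) /Rintegral integral_kern// mulrC.
have Ikc c : (leb n).-integrable setT (EFin \o (fun z : 'rV[R]_n => kern a b z * c)).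
  rewrite (_ : _ \o _ = (fun z => c%:E * (EFin \o kern a b) z)%E).
    exact: integrableZl.
  by apply/funext => z; rewrite /comp mulrC EFinM.
pose F (z : 'rV[R]_n) := kern a b z * (divergence phi (x + z) - divergence phi x).
have IF : (leb n).-integrable setT (EFin \o F).
  rewrite (_ : F = (fun z => kern a b z * divergence phi (x + z) -
      kern a b z * divergence phi x)).
    exact: (integrableB measurableT I1 (Ikc _)).
  by apply/funext => z; rewrite /F mulrBr.
have I2 : \int[leb n]_z (kern a b z * divergence phi (x + z)) -
    kmass n a b * divergence phi x = \int[leb n]_z F z.
  rewrite -Rk -(RintegralB measurableT I1 (Ikc _)).
  by apply: eq_Rintegral => z _; rewrite /F mulrBr.
have I3 : `|\int[leb n]_z F z| <= kmass n a b * (L * d).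
  rewrite -Rk (le_trans (le_normr_Rintegral measurableT IF))//.
  apply: le_Rintegral => // [|z _]; first exact: integrable_norm IF.
  rewrite /F normrM ger0_norm ?k0//.
  have [zb|zb] := leP b (dot z z); first by rewrite kern_eq0// !mul0r.
  rewrite ler_wpM2l ?k0// (le_trans (HL _ _))// ler_wpM2l//.
  by rewrite -(ler_pXn2r (n := 2)) ?nnegrE ?enorm_ge0 ?(ltW d0)// enorm_sqr ltW.
set I := (X in `|_ - X| <= _) in N.
have k2 : kmass n a b <= 2.
  by move: ka1; rewrite ler_norml => /andP[]; lra.
have I4 : `|kmass n a b * divergence phi x - divergence phi x| <= e / 4.
  rewrite -{2}[divergence phi x]mul1r -mulrBl normrM distrC.
  rewrite (@le_trans _ _ (e / (4 * (S + 1)) * (S + 1)))//.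
    by apply: ler_pM => //; rewrite (le_trans (divS x))// lerDl.
  by rewrite le_eqVlt; apply/orP; left; apply/eqP; field; rewrite gt_eqF// ltr_wpDl.
have I5 : `|I - kmass n a b * divergence phi x| <= e / 2.
  rewrite I2 (le_trans I3)// (@le_trans _ _ (2 * (e / 4)))//; last by lra.
  by apply: ler_pM => //; [exact: kmass_ge0|rewrite mulr_ge0// ltW].
have := ler_distD I (frac_div a phi x) (divergence phi x).
have := ler_distD (kmass n a b * divergence phi x) I (divergence phi x).
move: N; lra.
Unshelve. all: by end_near. Qed.

End localization.

Section lebesgue_open.
Context {R : realType}.

Lemma leb_open_gt0 n (U : set 'rV[R]_n) : open U -> U !=set0 -> (0 < leb n U)%E.
Proof.
move=> oU [x Ux]; have /nbhs_ballP[e /= e0 xeU] : nbhs x U by move: oU; rewrite openE; exact.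
have e20 : 0 < e / 2 by rewrite divr_gt0.
pose a : 'rV[R]_n := x - const_mx (e / 2).
pose b : 'rV[R]_n := x + const_mx (e / 2).
have ab i : a ord0 i <= b ord0 i by rewrite !mxE; lra.
apply: (@lt_le_trans _ _ (leb n [set y : 'rV[R]_n | forall i, y ord0 i \in `[a ord0 i, b ord0 i]])).
  rewrite lebesgue_rV_box// lte_fin; apply: prodr_gt0 => i _.
  by rewrite !mxE; lra.
apply: le_measure; rewrite ?inE//; [exact: measurable_rV_box|exact: open_measurable_rV|].
move=> y /= yB; apply: xeU; split=> // i j; rewrite ord1.
have := yB j; rewrite in_itv/= !mxE /ball/= ltr_norml => /andP[]; lra.
Qed.

End lebesgue_open.

(** * Test fields: pointwise bound, sign change, translation *)

Section test_fields.
Context {R : realType} {n : nat}.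
Implicit Types (phi : 'rV[R]_n -> 'rV[R]_n) (U : set 'rV[R]_n).

Lemma enormN (v : 'rV[R]_n) : enorm (- v) = enorm v.
Proof. by rewrite -scaleN1r enormZ normrN1 mul1r. Qed.

Lemma off_support U phi x : support_of phi `<=` U -> ~ U x -> phi x = 0.
Proof.
move=> pU Ux; apply: contrapT => /eqP px; apply: Ux; apply: pU.
exact: subset_closure.
Qed.

(** For continuous [phi] the set where [enorm (phi x) > 1] is open, and a nonempty open set has
    positive measure; so the essential bound is a pointwise one. Off [U] the field is 0, which
    removes the indicator. *)
Lemma Linfty_norm_le1 U phi : continuous phi -> support_of phi `<=` U ->
  (Linfty_norm U phi <= 1)%E <-> forall x, enorm (phi x) <= 1.
Proof.
move=> cphi pU.
have E : (fun x => (\1_U x * enorm (phi x))%:E) = (fun x => (enorm (phi x))%:E).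
  apply/funext => x; rewrite indicE; have [xU|xU] := boolP (x \in U).
    by rewrite mul1r.
  by rewrite mul0r (@off_support U phi x)// ?enorm0//; move=> Ux; move: xU; rewrite mem_set.
have muT : (0 < lebesgue_rV n [set: 'rV[R]_n])%E.
  by apply: leb_open_gt0; [exact: openT|exists 0].
rewrite /Linfty_norm E unlock muT; split=> [/ess_supP H x|H]; last first.
  apply/ess_supP/nearW => x /=.
  by rewrite lee_fin ger0_norm ?enorm_ge0.
have [A [mA A0 HA]] := H.
rewrite leNgt; apply/negP => px.
pose V := [set y : 'rV[R]_n | 1 < enorm (phi y)].
have oV : open V.
  rewrite (_ : V = (fun y : 'rV[R]_n => enorm (phi y)) @^-1` [set t | 1 < t])//.
  apply: open_comp; last exact: open_gt.
  by move=> y _; apply: continuous_comp; [exact: cphi|exact: continuous_enorm].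
have := leb_open_gt0 oV (ex_intro _ x px); rewrite ltNge => /negP; apply.
rewrite -A0; apply: le_measure; rewrite ?inE//; first exact: open_measurable_rV.
move=> y Vy; apply: HA => /=; rewrite lee_fin ger0_norm ?enorm_ge0//.
by apply/negP; rewrite -ltNge.
Qed.

Lemma test_fieldP U phi :
  test_field U phi <-> Cc_infty U phi /\ forall x, enorm (phi x) <= 1.
Proof.
split=> -[C H]; split => //; case: (C) => sp _ pU;
have cp := smooth_continuous sp; exact/(Linfty_norm_le1 cp pU).
Qed.

Lemma test_field_sub U V phi : U `<=` V -> test_field U phi -> test_field V phi.
Proof.
move=> UV /test_fieldP[[sp cp pU] H]; apply/test_fieldP; split => //; split => //.
exact: subset_trans UV.
Qed.

Lemma partials_opp phi s : smooth phi ->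
  partials s (fun x => - phi x) = (fun x => - partials s phi x).
Proof.
move=> sp; elim: s => [//|i s IH] /=; rewrite IH; apply/funext => x.
by rewrite /partial deriveN//; exact: (sp s).2.
Qed.

Lemma smooth_opp phi : smooth phi -> smooth (fun x => - phi x).
Proof.
move=> sp s; rewrite partials_opp//; split=> [x|i x].
  by apply: continuousN; exact: (sp s).1.
by apply: derivableN; exact: (sp s).2.
Qed.

Lemma divergence_opp phi x : smooth phi ->
  divergence (fun y => - phi y) x = - divergence phi x.
Proof.
move=> sp; rewrite /divergence -sumrN; apply: eq_bigr => i _.
by have := partials_opp [:: i] sp; rewrite /partials /= => ->; rewrite mxE.
Qed.

Lemma test_field_opp U phi : test_field U phi -> test_field U (fun x => - phi x).
Proof.
move=> /test_fieldP[[sp cp pU] H]; apply/test_fieldP.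
have E : support_of (fun x => - phi x) = support_of phi.
  by congr closure; apply/seteqP; split=> x /=; rewrite oppr_eq0.
split=> [|x]; last by rewrite enormN; exact: H.
by split; [exact: smooth_opp|rewrite E|rewrite E].
Qed.

Lemma derive_shift (V : normedModType R) (f : 'rV[R]_n -> V) (a x v : 'rV[R]_n) :
  'D_v (fun y => f (y + a)) x = 'D_v f (x + a) /\
  (derivable f (x + a) v -> derivable (fun y => f (y + a)) x v).
Proof.
have E : (fun h : R => h^-1 *: (((fun y => f (y + a)) \o shift x) (h *: v) - f (x + a))) =
    (fun h => h^-1 *: ((f \o shift (x + a)) (h *: v) - f (x + a))).
  by apply/funext => h; rewrite /= addrA.
by rewrite /derive /derivable E.
Qed.

Lemma partials_shift phi a s :
  partials s (fun x => phi (x + a)) = (fun x => partials s phi (x + a)).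
Proof.
elim: s => [//|i s IH] /=; rewrite IH; apply/funext => x.
by rewrite /partial; case: (derive_shift (partials s phi) a x (delta_mx ord0 i)).
Qed.

Lemma smooth_shift phi a : smooth phi -> smooth (fun x => phi (x + a)).
Proof.
move=> sp s; rewrite partials_shift; split=> [x|i x].
  apply: (@continuous_comp _ _ _ (fun y : 'rV[R]_n => y + a)); last exact: (sp s).1.
  exact: continuous_add_rV.
by apply: (derive_shift _ a x _).2; exact: (sp s).2.
Qed.

Lemma divergence_shift phi a x :
  divergence (fun y => phi (y + a)) x = divergence phi (x + a).
Proof.
rewrite /divergence; apply: eq_bigr => i _.
by have := partials_shift phi a [:: i]; rewrite /partials /= => ->.
Qed.

Lemma Cc_infty_shift U V phi a : (forall x : 'rV[R]_n, U (x + a) -> V x) ->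
  Cc_infty U phi -> Cc_infty V (fun x => phi (x + a)).
Proof.
move=> UV [sp cp pU].
have [M HM] := support_bound cp.
split; first exact: smooth_shift.
  apply: (@compact_support_bound _ _ _ (M + `|a|)) => z Mz; apply: (HM _ _).1.
  have := ler_normD (z + a) (- a); rewrite addrK normrN => ?.
  by rewrite -(lerD2r `|a|) (le_trans Mz).
apply: subset_trans (_ : [set x | support_of phi (x + a)] `<=` V); last first.
  by move=> x /= /pU; exact: UV.
have cl : closed [set x : 'rV[R]_n | support_of phi (x + a)].
  apply: (@closed_comp _ _ (fun x : 'rV[R]_n => x + a)); last exact: closed_closure.
  by move=> x _; exact: continuous_add_rV.
rewrite [X in _ `<=` X](iffLR (closure_id _) cl).
by apply: closureS => x /= px; exact: subset_closure.
Qed.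

Lemma test_field_shift U V phi a : (forall x : 'rV[R]_n, U (x + a) -> V x) ->
  test_field U phi -> test_field V (fun x => phi (x + a)).
Proof.
move=> UV /test_fieldP[Up H]; apply/test_fieldP; split=> [|x]; last exact: H.
exact: Cc_infty_shift Up.
Qed.

End test_fields.

(** * The liminf inequality *)

Section L1_facts.
Context {R : realType} {n : nat}.
Implicit Types (f g h : 'rV[R]_n -> R) (Omega : set 'rV[R]_n).
Implicit Types phi : 'rV[R]_n -> 'rV[R]_n.

Lemma L1_integrableP f : L1 f <-> (leb n).-integrable setT (EFin \o f).
Proof.
rewrite /L1; split=> [|/integrableP[mf fi]].
  rewrite inE => /andP[mf ff]; apply/integrableP; split.
    by apply/measurable_EFinP; exact: (set_mem mf).
  by move: (set_mem ff); rewrite /= /finite_norm Lnorm1.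
apply/andP; split.
  by apply/mem_set; apply/measurable_EFinP.
by apply/mem_set; rewrite /= /finite_norm Lnorm1.
Qed.

Lemma L1_measurable f : L1 f -> measurable_fun setT f.
Proof. by move/L1_integrableP/measurable_int/measurable_EFinP. Qed.

Lemma integrable_mul_bounded f h (C : R) : L1 f -> measurable_fun setT h ->
  (forall x, `|h x| <= C) ->
  (leb n).-integrable setT (fun x => (f x * h x)%:E).
Proof.
move=> /L1_integrableP fi mh hC; have /measurable_EFinP mf := measurable_int _ fi.
have C0 : 0 <= C by apply: le_trans (hC 0); exact: normr_ge0.
apply: (@le_integrable _ _ _ (leb n) setT _ _ (fun x => (C%:E * (f x)%:E)%E)) => //.
- by apply/measurable_EFinP; exact: measurable_funM.
- move=> x _ /=; rewrite lee_fin !normrM (ger0_norm C0) mulrC.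
  by rewrite ler_wpM2r.
- exact: (integrableZl measurableT C fi).
Qed.

Lemma measurable_frac_div (al : R) phi : continuous phi ->
  measurable_fun setT (frac_div al phi).
Proof.
move=> cphi; rewrite /frac_div.
apply: measurable_funM => //.
pose H (p : 'rV[R]_n * 'rV[R]_n) : R := dot (p.2 - p.1) (phi p.2 - phi p.1) /
  enorm (p.2 - p.1) `^ (n%:R + al + 1).
have mopp d (T : measurableType d) (g : T -> 'rV[R]_n) : measurable_fun setT g ->
    measurable_fun setT (fun t => - g t).
  move=> mg; under eq_fun do rewrite -scaleN1r.
  by apply: measurable_scale_rV.
have mphi := continuous_measurable_rV cphi.
have mH : measurable_fun setT H.
  apply: measurable_funM.
    apply: measurable_dot; apply: measurable_add_rV.
    - exact: measurable_snd.
    - by apply: mopp; exact: measurable_fst.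
    - exact: measurableT_comp mphi (measurable_snd).
    - by apply: mopp; exact: measurableT_comp mphi (measurable_fst).
  under eq_fun do rewrite -powRN.
  apply: (measurableT_comp (@measurable_powR R _)).
  apply: (@measurableT_comp _ _ _ _ _ _ (fun z : 'rV[R]_n => enorm z)).
    by apply: continuous_measurable_rVR; exact: continuous_enorm.
  apply: measurable_add_rV; first exact: measurable_snd.
  by apply: mopp; exact: measurable_fst.
have mE : measurable_fun setT (EFin \o H) by apply/measurable_EFinP.
rewrite (_ : (fun x => _) = (fun x => fine
    (fubini_F (leb n) (fun p => (EFin \o H)^\+ p)%E x -
     fubini_F (leb n) (fun p => (EFin \o H)^\- p)%E x)%E)); last first.
  apply/funext => x; rewrite /Rintegral; congr fine; rewrite [LHS]integralE.
  by congr (_ - _)%E; apply: eq_integral => y _; rewrite ?(funeposE, funenegE).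
apply: measurableT_comp; first exact: fine_measurable.
apply: emeasurable_funB; apply: measurable_fun_fubini_tonelli_F => //.
- exact: measurable_funepos.
- exact: measurable_funeneg.
Qed.

Lemma limf_einf_ge (F : set_system R) (f : R -> \bar R) (l : R) :
  Filter F -> (forall e : R, 0 < e -> \forall a \near F, ((l - e)%:E <= f a)%E) ->
  (l%:E <= limf_einf f F)%E.
Proof.
move=> FF H; rewrite limf_einfE; apply/lee_subgt0Pr => e e0.
apply: (@le_trans _ _ (ereal_inf (f @` [set a | ((l - e)%:E <= f a)%E]))).
  by apply: le_ereal_inf_tmp => _ [a /= Ha <-].
apply: ereal_sup_ubound; exists [set a | ((l - e)%:E <= f a)%E] => //.
exact: H.
Qed.

Lemma limf_esup_le (F : set_system R) (f : R -> \bar R) (l : R) :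
  Filter F -> (forall e : R, 0 < e -> \forall a \near F, (f a <= (l + e)%:E)%E) ->
  (limf_esup f F <= l%:E)%E.
Proof.
move=> FF H; rewrite limf_esupE; apply/lee_addgt0Pr => e e0.
apply: (@le_trans _ _ (ereal_sup (f @` [set a | (f a <= (l + e)%:E)%E]))).
  apply: ereal_inf_lbound; exists [set a | (f a <= (l + e)%:E)%E] => //.
  exact: H.
by apply: ge_ereal_sup => _ [a /= Ha <-].
Qed.

Lemma L1_norm_lt f : L1 f -> exists2 N : R, 0 <= N & (\int[leb n]_x `|f x|%:E = N%:E)%E.
Proof.
move=> /L1_integrableP /integrableP[mf fi]; exists (fine (\int[leb n]_x `|(EFin \o f) x|)%E).
  by rewrite fine_ge0// integral_ge0.
by rewrite fineK// ge0_fin_numE// integral_ge0.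
Qed.

Lemma integrable_L1_div f phi : L1 f -> smooth phi -> compact (support_of phi) ->
  (leb n).-integrable setT (fun x => (f x * divergence phi x)%:E).
Proof.
move=> L1f sphi cphi; have [M [C [C0 _ _ _ divC]]] := test_bounds sphi cphi.
apply: integrable_mul_bounded divC => //.
by apply: continuous_measurable_rVR; exact: continuous_divergence.
Qed.

Lemma distr_gradE f phi : L1 f -> smooth phi -> compact (support_of phi) ->
  distr_grad f phi = (- \int[leb n]_x (f x * divergence phi x))%:E.
Proof.
move=> L1f sphi cphi; rewrite EFinN /distr_grad /Rintegral fineK//.
by apply: integrable_fin_num => //; exact: integrable_L1_div.
Qed.

(** One test field at a time: its fractional divergences converge uniformly and stay bounded, hence
    pair well with L^1 convergence. The supremum over fields is taken only afterwards. *)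
Lemma frac_variation_liminf (Omega : set 'rV[R]_n) fam f phi : (0 < n)%N ->
  test_field Omega phi -> L1 f -> cvg_L1 fam f ->
  (distr_grad f phi <= limf_einf (fun a => frac_variation a (fam a) Omega) (1^'-))%E.
Proof.
move=> n0 tphi L1f [L1fam cfam].
(* [distr_grad] carries a minus sign and [frac_variation] does not; the sign is moved into the
   field. *)
pose psi := fun x => - phi x.
have tpsi : test_field Omega psi by exact: test_field_opp.
have /test_fieldP[[sphi cphi _] _] := tphi.
have /test_fieldP[[spsi cpsi _] _] := tpsi.
have [M [C [C0 _ _ _ divC]]] := test_bounds spsi cpsi.
have Idiv := integrable_L1_div L1f spsi cpsi.
pose I := \int[leb n]_x (f x * divergence psi x).
have -> : distr_grad f phi = I%:E.
  rewrite distr_gradE// /I; congr EFin.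
  rewrite -[LHS]mulN1r -(RintegralZl _ measurableT (integrable_L1_div L1f sphi cphi)).
  by apply: eq_Rintegral => x _; rewrite divergence_opp// mulN1r mulrN.
have [N N0 NE] := L1_norm_lt L1f.
apply: limf_einf_ge => e e0.
have D0 : 0 < C + 1 + N + 1 by lra.
(* The total error will be [(C + 1) * h + h * N]. The bound [h <= 1] keeps the fractional divergence
   below [C + 1]. *)
pose h := Num.min 1 (e / (C + 1 + N + 1)).
have h0 : 0 < h by rewrite lt_min ltr01 divr_gt0.
have cfh : \forall a \near (1 : R)^'-,
    (Lnorm (lebesgue_rV n) 1 (fun x => (fam a x - f x)%:E) <= h%:E)%E.
  have h0' : (0%E < h%:E :> \bar R)%E by rewrite lte_fin.
  have N0s : nbhs (0%E : \bar R) [set u | (u <= h%:E)%E].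
    by apply: (filterS _ (open_ereal_lt' h0')) => u; exact: ltW.
  exact: (cfam _ N0s).
near=> a.
have /andP[a2 a1] : 2^-1 <= a < 1 by near: a; exact: near_half.
have a01 : 0 < a < 1 by rewrite a1 andbT (lt_le_trans _ a2) ?invr_gt0.
have Fh : forall x, `|frac_div a psi x - divergence psi x| <= h.
  by near: a; exact: frac_div_cvg.
have fh : (Lnorm (lebesgue_rV n) 1 (fun x => (fam a x - f x)%:E) <= h%:E)%E.
  by near: a; exact: cfh.
have h1 : h <= 1 by rewrite ge_min lexx.
have FC x : `|frac_div a psi x| <= C + 1.
  have := ler_distD 0 (frac_div a psi x - divergence psi x) (- divergence psi x).
  rewrite subr0 sub0r opprK subrK => /le_trans; apply.
  by rewrite addrC lerD//; exact: le_trans h1.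
have mF : measurable_fun setT (frac_div a psi).
  by apply: measurable_frac_div; exact: smooth_continuous.
have IF := integrable_mul_bounded (L1fam _ a01) mF FC.
apply: (@le_trans _ _ (\int[leb n]_x (fam a x * frac_div a psi x)%:E)%E); last first.
  by apply: ereal_sup_ubound; exists psi.
have -> : (\int[leb n]_x (fam a x * frac_div a psi x)%:E =
    (\int[leb n]_x (fam a x * frac_div a psi x)%R)%:E)%E.
  by rewrite /Rintegral fineK//; exact: integrable_fin_num.
pose G x := f x * divergence psi x - fam a x * frac_div a psi x.
have IG : (leb n).-integrable setT (EFin \o G).
  exact: (integrableB measurableT Idiv IF).
have mf : measurable_fun setT f.
  exact: L1_measurable.
have mfa : measurable_fun setT (fam a).
  exact: L1_measurable (L1fam _ a01).
rewrite lee_fin lerBlDr -lerBlDl /I -(RintegralB measurableT Idiv IF).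
rewrite (le_trans (ler_norm _))// (le_trans (le_normr_Rintegral measurableT IG))//.
rewrite -lee_fin /Rintegral fineK; last exact: integrable_fin_num (integrable_norm IG).
apply: (@le_trans _ _ (\int[leb n]_x ((C + 1)%:E * `|fam a x - f x|%:E +
    h%:E * `|f x|%:E))%E).
  apply: ge0_le_integral => //.
  - by apply/measurable_EFinP; apply: measurableT_comp => //;
      have /measurable_EFinP := measurable_int _ IG.
  - apply/measurable_EFinP; apply: measurable_funD; apply: measurable_funM => //;
      apply: measurableT_comp => //; exact: measurable_funB.
  move=> x _; rewrite -!EFinM -EFinD lee_fin /G.
  (* The L^1-small factor [fam a - f] meets a bounded function, and the fixed [f] meets a uniformly
     small one. *)
  have -> : f x * divergence psi x - fam a x * frac_div a psi x =
      - ((fam a x - f x) * frac_div a psi x) -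
      f x * (frac_div a psi x - divergence psi x) by ring.
  move: (FC x) (Fh x); move: (frac_div a psi x) => u uC uh.
  rewrite (le_trans (ler_normB _ _))// normrN !normrM lerD// mulrC ler_wpM2r//.
have mfaf : measurable_fun setT (fun x => `|fam a x - f x|).
  by apply: measurableT_comp => //; exact: measurable_funB.
have mff : measurable_fun setT (fun x => `|f x|) by exact: measurableT_comp.
have C10 : 0 <= C + 1 by rewrite addr_ge0.
rewrite ge0_integralD//; first last.
- by apply/measurable_EFinP; exact: measurable_funM.
- by move=> x _; rewrite -EFinM lee_fin mulr_ge0// ltW.
- by apply/measurable_EFinP; exact: measurable_funM.
- by move=> x _; rewrite -EFinM lee_fin mulr_ge0.
rewrite !ge0_integralZl//; first last.
- by apply/measurable_EFinP.
- by rewrite lee_fin ltW.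
- by apply/measurable_EFinP.
rewrite NE.
apply: (@le_trans _ _ ((C + 1)%:E * h%:E + h%:E * N%:E)%E).
  apply: leeD => //; apply: lee_wpmul2l; first by rewrite lee_fin.
  by move: fh; rewrite Lnorm1.
rewrite -!EFinM -EFinD lee_fin.
apply: (@le_trans _ _ ((C + 1 + N + 1) * h)); first by have := ltW h0; nra.
by rewrite mulrC -ler_pdivlMr// ge_min lexx orbT.
Unshelve. all: by end_near. Qed.

End L1_facts.

(** * The upper bound on a neighbourhood *)

Section upper_bound.
Context {R : realType} {n : nat}.
Implicit Types (f g h : 'rV[R]_n -> R) (Omega : set 'rV[R]_n).
Implicit Types phi : 'rV[R]_n -> 'rV[R]_n.

(* The near part averages over z the distributional gradient of g against the
   translates phi (. + z), which are test fields of U. *)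
Lemma frac_variation_le (U Omega : set 'rV[R]_n) g (N M a b : R) :
  (0 < n)%N -> L1 g -> (\int[leb n]_x `|g x|%:E = N%:E)%E ->
  2^-1 <= a < 1 -> 0 < b <= 1 ->
  (forall x z : 'rV[R]_n, Omega x -> dot z z < b -> U (x + z)) ->
  (total_var g U <= M%:E)%E ->
  (frac_variation a g Omega <=
    (kmass n a b * M + N * (mu_frac (n := n) a * farc n b))%:E)%E.
Proof.
move=> n0 L1g gN /andP[a2 a1] /andP[b0 b1] OU gM.
have a01 : 0 < a < 1 by rewrite a1 andbT (lt_le_trans _ a2) ?invr_gt0.
apply: ge_ereal_sup => _ [phi tphi <-].
have /test_fieldP[[sphi cphi pO] phi1] := tphi.
have phiS y j : `|phi y ord0 j| <= 1 by rewrite (le_trans (ler_coord_enorm _ _)).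
have [M' [C [C0 _ _ _ divC]]] := test_bounds sphi cphi.
have mdiv : measurable_fun setT (divergence phi).
  by apply: continuous_measurable_rVR; exact: continuous_divergence.
pose K x := \int[leb n]_z (kern a b z * divergence phi (x + z)).
have near x : `|frac_div a phi x - K x| <= mu_frac (n := n) a * 1 * farc n b.
  exact: frac_div_near.
have k0 (z : 'rV[R]_n) : 0 <= kern a b z by exact: kern_ge0.
have mk : measurable_fun setT (fun z : 'rV[R]_n => kern a b z).
  exact: measurable_kern.
have mg := L1_measurable L1g.
pose F (p : 'rV[R]_n * 'rV[R]_n) : R := g p.1 * (kern a b p.2 * divergence phi (p.1 + p.2)).
have mF : measurable_fun setT F.
  apply: measurable_funM; first exact: measurableT_comp mg measurable_fst.
  apply: measurable_funM; first exact: measurableT_comp mk measurable_snd.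
  apply: measurableT_comp mdiv _.
  by apply: measurable_add_rV; [exact: measurable_fst|exact: measurable_snd].
have Ik x : (leb n).-integrable setT (fun z => (kern a b z * divergence phi (x + z))%:E).
  by case: (kern_ibp n0 a01 b0 x sphi cphi).
have ik := integrable_kern n0 a01 b0.
have iF : (leb n \x leb n)%E.-integrable setT (EFin \o F).
  pose G (p : 'rV[R]_n * 'rV[R]_n) : R := g p.1 * kern a b p.2.
  have mG : measurable_fun setT G.
    by apply: measurable_funM; [exact: measurableT_comp mg measurable_fst|
      exact: measurableT_comp mk measurable_snd].
  have iG : (leb n \x leb n)%E.-integrable setT (EFin \o G).
    apply/integrable12ltyP; first by apply/measurable_EFinP.
    rewrite (_ : (\int[_]_x _)%E = (\int[leb n]_x ((kmass n a b)%:E * `|g x|%:E))%E).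
      rewrite ge0_integralZl//; last 2 first.
      - by apply/measurable_EFinP; exact: measurableT_comp.
      - by rewrite lee_fin kmass_ge0.
      by rewrite gN -EFinM ltry.
    apply: eq_integral => x _; rewrite -integral_kern// muleC -ge0_integralZl//.
    - by apply: eq_integral => z _; rewrite /G /= normrM (ger0_norm (k0 _)).
    - by apply/measurable_EFinP.
    - by move=> z _; rewrite lee_fin.
  apply: (@le_integrable _ _ _ _ setT _ _ (fun p => (C%:E * (G p)%:E)%E)) => //.
  - by apply/measurable_EFinP.
  - move=> p _ /=; rewrite lee_fin /F /G mulrA normrM [leRHS]normrM mulrC.
    by rewrite (ger0_norm C0) ler_wpM2r.
  - exact: (integrableZl measurableT C iG).
have FE x : fubini_F (leb n) (EFin \o F) x = (g x * K x)%:E.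
  rewrite /fubini_F /K EFinM /Rintegral fineK; last exact: integrable_fin_num (Ik x).
  by rewrite -integralZl.
have IgK : (leb n).-integrable setT (fun x => (g x * K x)%:E).
  by under eq_fun do rewrite -FE; exact: integrable_fubini_F.
have E1 : (\int[leb n]_x (g x * K x)%:E <= (kmass n a b * M)%:E)%E.
  under eq_integral do rewrite -FE.
  rewrite (Fubini iF) EFinM -integral_kern// muleC -integralZl//.
  apply: le_integral => //.
  - pose F' (p : 'rV[R]_n * 'rV[R]_n) : \bar R := (F (p.2, p.1))%:E.
    have mF' : measurable_fun setT F'.
      apply/measurable_EFinP; apply: (measurableT_comp mF).
      by apply/measurable_fun_pairP; split; [exact: measurable_snd|exact: measurable_fst].
    apply: (@integrable_fubini_F _ _ _ _ _ (leb n) (leb n) F').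
    apply/integrable12ltyP => //.
    by apply: (iffLR (integrable21ltyP (leb n) (leb n) _) iF); apply/measurable_EFinP.
  - exact: integrableZl.
  move=> z _ /=; rewrite -EFinM.
  (* Outside the ball the weight vanishes; inside, the translate of [phi] is still a test field of
     [U], by the margin [OU]. *)
  have [zb|zb] := leP b (dot z z).
    rewrite integral0_eq ?kern_eq0// ?mulr0// => x _.
    by rewrite /F /= kern_eq0// mul0r mulr0.
  have tz : test_field U (fun x => phi (x + z)).
    apply: test_field_shift tphi => x Oxz.
    by rewrite -(addrK z x); apply: OU; rewrite // -scaleN1r dotZZ sqrrN expr1n mul1r.
  have /test_fieldP[[sz cz _] _] := tz.
  have tN := test_field_opp tz.
  have /test_fieldP[[sN cN _] _] := tN.
  have I1 := integrable_L1_div L1g sz cz.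
  have : (distr_grad g (fun x => - phi (x + z))%R <= M%:E)%E.
    by apply: le_trans gM; apply: ereal_sup_ubound; exists (fun x => - phi (x + z)).
  rewrite distr_gradE// lee_fin.
  have -> : - (\int[leb n]_x (g x * divergence (fun y => - phi (y + z)) x)) =
      \int[leb n]_x (g x * divergence (fun y => phi (y + z)) x).
    rewrite -[LHS]mulN1r -(RintegralZl _ measurableT (integrable_L1_div L1g sN cN)).
    by apply: eq_Rintegral => x _; rewrite divergence_opp// mulrN mulN1r opprK.
  move=> HM.
  (* For fixed [z] the kernel is a constant weight; its nonnegativity preserves the bound [HM]. *)
  rewrite (_ : (\int[_]_x _)%E =
      ((kern a b z)%:E * \int[leb n]_x (g x * divergence (fun y => phi (y + z)%R) x)%:E)%E).
    rewrite -[(\int[_]_x (g x * _)%:E)%E]fineK; last exact: integrable_fin_num.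
    by rewrite -EFinM lee_fin mulrC ler_wpM2r.
  rewrite -(integralZl measurableT I1); apply: eq_integral => x _.
  by rewrite /F /= divergence_shift -EFinM mulrCA.
have KC x : `|K x| <= C * kmass n a b.
  have -> : C * kmass n a b = \int[leb n]_z (C * kern a b z).
    by rewrite RintegralZl// /Rintegral integral_kern.
  rewrite (le_trans (le_normr_Rintegral measurableT (Ik x)))//.
  apply: le_Rintegral => //.
  - exact: integrable_norm (Ik x).
  - exact: (integrableZl measurableT C ik).
  by move=> z _; rewrite normrM (ger0_norm (k0 _)) mulrC ler_wpM2r.
have fdC x : `|frac_div a phi x| <= mu_frac (n := n) a * 1 * farc n b + C * kmass n a b.
  have := near x; have := KC x; move: (frac_div a phi x) (K x) => u v Hv Hu.
  by have := ler_normD (u - v) v; rewrite subrK => /le_trans; apply; exact: lerD.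
have mfd : measurable_fun setT (frac_div a phi).
  by apply: measurable_frac_div; exact: smooth_continuous.
have Ifd := integrable_mul_bounded L1g mfd fdC.
have IB : (leb n).-integrable setT (fun x => (g x * (frac_div a phi x - K x))%:E).
  under eq_fun do rewrite mulrBr EFinB.
  exact: integrableB.
rewrite (_ : (\int[_]_x _)%E = (\int[leb n]_x ((g x * K x)%:E +
    (g x * (frac_div a phi x - K x))%:E))%E); last first.
  by apply: eq_integral => x _; rewrite -EFinD -mulrDr addrC subrK.
rewrite integralD// EFinD leeD//.
apply: le_trans (lee_abs _) _; apply: le_trans (le_abse_integral _ _ _) _ => //.
  exact: measurable_int IB.
have c0 : 0 <= mu_frac (n := n) a * farc n b.
  by have := near 0; rewrite mulr1; apply: le_trans.
rewrite EFinM -gN muleC -ge0_integralZl//; last first.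
  by apply/measurable_EFinP; exact: measurableT_comp.
apply: ge0_le_integral => //.
- by apply: measurableT_comp => //; exact: measurable_int IB.
- by apply/measurable_EFinP; apply: measurable_funM => //; exact: measurableT_comp.
move=> x _; rewrite -EFinM lee_fin.
have := near x; move: (frac_div a phi x) (K x) => u v; rewrite mulr1 => uv.
by rewrite normrM mulrC ler_wpM2r.
Qed.

End upper_bound.

(** * Continuity of translations in L^1 *)

Section translation.
Context {R : realType} {n : nat}.
Implicit Types (f g : 'rV[R]_n -> R).
Variable h : nat -> 'rV[R]_n.
Hypothesis h0 : h k @[k --> \oo] --> (0 : 'rV[R]_n).

Definition shift_dist f (v : 'rV[R]_n) : \bar R :=
  (\int[leb n]_x `|f (x + v)%R - f x|%:E)%E.

(** Continuity along the fixed null sequence [h], since the proofs go through dominated convergence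
    of sequences. Integrability is bundled so that the class is stable under the closure steps
    below. *)
Definition shift_continuous f :=
  L1 f /\ forall e : R, 0 < e -> \forall k \near \oo, (shift_dist f (h k) <= e%:E)%E.

Lemma L1D f g : L1 f -> L1 g -> L1 (fun x => f x + g x).
Proof. by move=> /L1_integrableP fi /L1_integrableP gi; apply/L1_integrableP; exact: (integrableD measurableT fi gi). Qed.

Lemma L1Z c f : L1 f -> L1 (fun x => c * f x).
Proof. by move=> /L1_integrableP fi; apply/L1_integrableP; exact: (integrableZl measurableT c fi). Qed.

Lemma L1_shift v f : L1 f -> L1 (fun x => f (x + v)).
Proof. by move=> /L1_integrableP fi; apply/L1_integrableP; exact: (integrable_leb_shift v fi). Qed.

Lemma L1B f g : L1 f -> L1 g -> L1 (fun x => f x - g x).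
Proof.
move=> fi /(L1Z (-1)) gi; have := L1D fi gi.
by under eq_fun do rewrite mulN1r.
Qed.

Lemma measurable_abs_EFin f : measurable_fun setT f ->
  measurable_fun setT (fun x => `|f x|%:E).
Proof. by move=> mf; apply/measurable_EFinP; exact: measurableT_comp. Qed.

Lemma integral_abs_shift v f : L1 f ->
  (\int[leb n]_x `|f (x + v)%R|%:E = \int[leb n]_x `|f x|%:E)%E.
Proof.
move=> fi; apply: (integral_leb_shift v (f := fun x => `|f x|%:E)).
by apply: measurable_abs_EFin; exact: L1_measurable.
Qed.

Lemma integral_abs_le_add f g u : L1 f -> L1 g -> L1 u ->
  (forall x, `|u x| <= `|f x| + `|g x|) ->
  (\int[leb n]_x `|u x|%:E <= \int[leb n]_x `|f x|%:E + \int[leb n]_x `|g x|%:E)%E.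
Proof.
move=> /L1_measurable mf /L1_measurable mg /L1_measurable mu ufg.
rewrite -ge0_integralD//; [|exact: measurable_abs_EFin..].
apply: ge0_le_integral => //; first exact: measurable_abs_EFin.
  by apply: emeasurable_funD; exact: measurable_abs_EFin.
by move=> x _; rewrite -EFinD lee_fin.
Qed.

Lemma shift_continuous_lim f : L1 f ->
  (forall e : R, 0 < e -> exists2 g, shift_continuous g &
    (\int[leb n]_x `|f x - g x|%:E <= e%:E)%E) -> shift_continuous f.
Proof.
move=> fi H; split => // e e0; have e3 : 0 < e / 3 by rewrite divr_gt0.
have [g [gi gh] fg] := H _ e3.
near=> k; have ghk : (shift_dist g (h k) <= (e / 3)%:E)%E by near: k; exact: gh.
have fgi := L1B fi gi.
pose u x := (f (x + h k) - g (x + h k)) - (f x - g x).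
have ui : L1 u by apply: L1B => //; exact: (L1_shift (h k) fgi).
have -> : e = e / 3 + e / 3 + e / 3 by field.
rewrite !EFinD.
apply: (@le_trans _ _ (\int[leb n]_x `|u x|%:E + shift_dist g (h k))%E).
  apply: integral_abs_le_add => // [||x].
  - by apply: L1B => //; exact: L1_shift.
  - by apply: L1B => //; exact: L1_shift.
  - rewrite (_ : f _ - f x = u x + (g (x + h k) - g x)) ?ler_normD//.
    by rewrite /u; ring.
apply: leeD ghk.
apply: (@le_trans _ _ (\int[leb n]_x `|f (x + h k)%R - g (x + h k)%R|%:E +
    \int[leb n]_x `|f x - g x|%:E)%E).
  by apply: integral_abs_le_add => // [|x]; [exact: (L1_shift (h k) fgi)|exact: ler_normB].
by apply: leeD => //; rewrite (integral_abs_shift (h k) fgi).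
Unshelve. all: by end_near. Qed.

Lemma shift_continuous0 : shift_continuous (fun=> 0).
Proof.
split=> [|e e0].
  by apply/L1_integrableP; exact: integrable0.
near=> k; rewrite /shift_dist integral0_eq ?lee_fin ?ltW// => x _.
by rewrite subrr normr0.
Unshelve. all: by end_near. Qed.

Lemma shift_continuousD f g : shift_continuous f -> shift_continuous g ->
  shift_continuous (fun x => f x + g x).
Proof.
move=> [fi fh] [gi gh]; split=> [|e e0]; first exact: L1D.
have e2 : 0 < e / 2 by rewrite divr_gt0.
near=> k; have H1 : (shift_dist f (h k) <= (e / 2)%:E)%E by near: k; exact: fh.
have H2 : (shift_dist g (h k) <= (e / 2)%:E)%E by near: k; exact: gh.
rewrite (splitr e) EFinD; apply: le_trans (leeD H1 H2).
have B u : L1 u -> L1 (fun x => u (x + h k) - u x).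
  by move=> ui; apply: L1B => //; exact: L1_shift.
apply: (integral_abs_le_add (B _ fi) (B _ gi)) => [|x].
  by apply: (B (fun x => f x + g x)); exact: L1D.
by rewrite opprD addrACA ler_normD.
Unshelve. all: by end_near. Qed.

Lemma shift_continuousZ c f : shift_continuous f -> shift_continuous (fun x => c * f x).
Proof.
move=> [fi fh]; split=> [|e e0]; first exact: L1Z.
have c0 : 0 < `|c| + 1 by rewrite ltr_wpDl.
near=> k; have : (shift_dist f (h k) <= (e / (`|c| + 1))%:E)%E.
  by near: k; apply: fh; rewrite divr_gt0.
have c1 : (0 <= `|c|%:E :> \bar R)%E by rewrite lee_fin.
move=> /(lee_wpmul2l c1) H.
rewrite /shift_dist; under eq_integral do rewrite -mulrBr normrM EFinM.
rewrite ge0_integralZl//; last first.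
  apply: measurable_abs_EFin; apply: measurable_funB; apply: L1_measurable => //.
  exact: L1_shift.
apply: le_trans H _.
rewrite -EFinM lee_fin mulrA ler_pdivrMr// mulrC ler_wpM2l ?ltW//.
by rewrite ltrDl.
Unshelve. all: by end_near. Qed.

Lemma shift_continuous_sum (I : Type) (r : seq I) (F : I -> 'rV[R]_n -> R) :
  (forall i, shift_continuous (F i)) -> shift_continuous (fun x => \sum_(i <- r) F i x).
Proof.
move=> HF; elim: r => [|i r IH].
  by under eq_fun do rewrite big_nil; exact: shift_continuous0.
by under eq_fun do rewrite big_cons; exact: shift_continuousD.
Qed.

(** Dominated limits are L^1 limits, under which the class is closed. This carries the property from
    open sets to Borel sets and from simple functions to all of L^1. *)
Lemma shift_continuous_dct (F : nat -> 'rV[R]_n -> R) f G :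
  (forall m, shift_continuous (F m)) -> measurable_fun setT f -> L1 G ->
  (forall x, F m x @[m --> \oo] --> f x) -> (forall m x, `|F m x| <= G x) ->
  shift_continuous f.
Proof.
move=> HF mf Gi Ff FG.
have /L1_integrableP Gi' := Gi.
have [||||| fi D _] := @dominated_convergence _ _ _ (leb n) setT measurableT
  (fun m x => (F m x)%:E) (EFin \o f) (EFin \o G).
- by move=> m; apply/measurable_EFinP; apply: L1_measurable; case: (HF m).
- exact/measurable_EFinP.
- by apply: aeW => x _; apply: cvg_EFin; [exact: nearW|exact: Ff].
- exact: Gi'.
- by apply: aeW => x m _ /=; rewrite lee_fin.
apply: shift_continuous_lim => [|e e0]; first exact/L1_integrableP.
have e0' : (0%E < e%:E :> \bar R)%E by rewrite lte_fin.
have [m _ /(_ m (leqnn m)) Hm] := D _ (open_ereal_lt' e0').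
exists (F m); first exact: HF.
by apply: ltW; apply: le_lt_trans Hm; rewrite le_eqVlt; apply/orP; left; apply/eqP;
  apply: eq_integral => x _; rewrite distrC.
Qed.

Lemma L1_indic (A : set 'rV[R]_n) : measurable A -> (leb n A < +oo)%E -> L1 (\1_A).
Proof.
move=> mA Aoo; apply/L1_integrableP/integrableP; split.
  by apply/measurable_EFinP; exact: measurable_indic.
under eq_integral do rewrite /= ger0_norm//.
by rewrite integral_indic// setIT.
Qed.

Lemma shift_continuous_open (U : set 'rV[R]_n) : open U -> (leb n U < +oo)%E ->
  shift_continuous (\1_U).
Proof.
move=> oU Uoo; have mU := open_measurable_rV oU.
have Ui := L1_indic mU Uoo; split => // e e0.
(* |1_U(x + h) - 1_U(x)| = 2 1_U(x) (1 - 1_U(x + h)) + (1_U(x + h) - 1_U(x)),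
   and the last term has integral 0. *)
pose w k x : R := 2 * (\1_U x * (1 - \1_U (x + h k))).
have b01 x : 0 <= \1_U x :> R /\ \1_U x <= 1 :> R.
  by rewrite indicE; case: (x \in U).
have w0 k x : 0 <= w k x.
  have [? ?] := b01 x; have [? ?] := b01 (x + h k).
  by rewrite /w !mulr_ge0 ?subr_ge0.
have wG k x : w k x <= 2 * \1_U x.
  have [? ?] := b01 x; have [? ?] := b01 (x + h k).
  by rewrite /w ler_pM2l// ler_piMr// lerBlDr lerDl.
have mi := L1_measurable Ui.
have mw k : measurable_fun setT (w k).
  apply: measurable_funM => //; apply: measurable_funM => //; apply: measurable_funB => //.
  exact: L1_measurable (L1_shift (h k) Ui).
have wi k : L1 (w k).
  have /L1_integrableP Gi := L1Z 2 Ui.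
  apply/L1_integrableP; apply: (le_integrable measurableT _ _ Gi); first exact/measurable_EFinP.
  by move=> x _ /=; rewrite lee_fin ger0_norm// (le_trans (wG k x))// ler_norm.
have E k : (shift_dist (\1_U) (h k) = \int[leb n]_x (w k x)%:E)%E.
  have Bi := L1B (L1_shift (h k) Ui) Ui.
  have /L1_integrableP Bi' := Bi; have /L1_integrableP wi' := wi k.
  rewrite /shift_dist (_ : (\int[_]_x `|_|%:E)%E = (\int[leb n]_x ((w k x)%:E +
     (\1_U (x + h k)%R - \1_U x)%:E))%E).
    rewrite integralD//.
    have /L1_integrableP Ui' := Ui; have /L1_integrableP Us' := L1_shift (h k) Ui.
    rewrite [X in (_ + X)%E](_ : _ = 0%E) ?adde0//.
    under eq_integral do rewrite EFinB.
    rewrite integralB//.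
    rewrite (integral_leb_shift (h k) (f := fun x => (\1_U x)%:E)).
      by rewrite subee//; exact: integrable_fin_num Ui'.
    exact: measurable_int Ui'.
  apply: eq_integral => x _; rewrite -EFinD; congr EFin.
  rewrite /w !indicE; case: (_ \in U); case: (_ \in U);
    rewrite /= ?(subrr, subr0, sub0r, normrN, normr1, normr0); ring.
have [||||| _ _ D] := @dominated_convergence _ _ _ (leb n) setT measurableT
  (fun k x => (w k x)%:E) (fun=> 0%E) (fun x => (2 * \1_U x)%:E).
- by move=> k; exact/measurable_EFinP.
- exact: measurable_cst.
- apply: aeW => x _; apply: cvg_near_cst.
  (* Openness is used here: for [x] in [U] the translate is eventually in [U], so [w k x] is
     eventually 0; elsewhere [w k x] is always 0. *)
  rewrite /w indicE; have [xU|xU] := boolP (x \in U); last first.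
    by apply: nearW => k; rewrite mul0r mulr0.
  have xhk : x + h k @[k --> \oo] --> x.
    rewrite -[X in _ --> X](addr0 x); apply: cvgD => //; exact: cvg_cst.
  have nU : nbhs x U by move: oU; rewrite openE; apply; exact: set_mem.
  have HU : \forall k \near \oo, U (x + h k) by exact: xhk _ nU.
  near=> k; rewrite indicE mem_set ?subrr ?mulr0//.
  by near: k; exact: HU.
- exact/L1_integrableP/L1Z.
- by apply: aeW => x k _ /=; rewrite lee_fin ger0_norm.
have e0' : (0%E < e%:E :> \bar R)%E by rewrite lte_fin.
rewrite integral0 in D; have {}D := D _ (open_ereal_lt' e0').
by near=> k; rewrite E ltW//; near: k; exact: D.
Unshelve. all: by end_near. Qed.

Let box (m : nat) : set 'rV[R]_n := [set x | `|x| < m%:R].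

Let oB m : open (box m).
Proof.
rewrite (_ : box m = (fun z : 'rV[R]_n => `|z|) @^-1` [set x | x < m%:R])//.
apply: open_comp; last exact: open_lt.
by move=> x _; exact: norm_continuous.
Qed.

Let mB m : measurable (box m). Proof. exact: open_measurable_rV. Qed.

Let box_fin m : (leb n (box m) < +oo)%E.
Proof.
apply: (@le_lt_trans _ _ (leb n [set z : 'rV[R]_n | (`|z| <= m%:R)%R])).
  by apply: le_measure; rewrite ?inE//; [exact: measurable_box|move=> x /ltW].
exact: leb_box_fin.
Qed.

(** Dynkin induction from the open sets, which are stable under intersection. The box keeps every
    set of finite measure, so that complements and countable disjoint unions remain in L^1. *)
Lemma shift_continuous_indic (A : set 'rV[R]_n) m : measurable A ->
  shift_continuous (\1_(A `&` box m)).
Proof.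
have IB : shift_continuous (\1_(box m)) by exact: shift_continuous_open.
have Bi : L1 (\1_(box m)) by exact: L1_indic.
move: A; apply: (@dynkin_induction _ _ (@open 'rV[R]_n)) => //.
- by move=> U V; exact: openI.
- by rewrite setTI.
- move=> U oU; apply: shift_continuous_open; first exact: openI.
  apply: le_lt_trans (box_fin m); apply: le_measure; rewrite ?inE//.
  by apply: measurableI => //; exact: open_measurable_rV.
- move=> A mA IA.
  rewrite (_ : \1_(~` A `&` box m) = (fun x => \1_(box m) x + (-1) * \1_(A `&` box m) x)).
    by apply: shift_continuousD => //; exact: shift_continuousZ.
  apply/funext => x; rewrite !indicE !in_setI in_setC.
  by case: (x \in A); case: (x \in box m); rewrite /= ?(mulr0, mulr1, addr0, subrr).
- move=> F mF tF IF.
  pose G k : set 'rV[R]_n := F k `&` box m.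
  have tG : trivIset setT G.
    apply/trivIsetP => i j _ _ ij; rewrite /G setIACA setIid.
    by move/trivIsetP : tF => /(_ i j Logic.I Logic.I ij) ->; rewrite set0I.
  rewrite setI_bigcupl -/G.
  have S x : (\sum_(0 <= k < N) \1_(G k) x @[N --> \oo] --> (\1_(\bigcup_k G k) x : R)) /\
      forall N, `|\sum_(0 <= k < N) \1_(G k) x| <= \1_(box m) x :> R.
    have [[j _ Gj]|nG] := pselect ((\bigcup_k G k) x).
      have E N : \sum_(0 <= k < N) \1_(G k) x = (j < N)%N%:R :> R.
        elim: N => [|N IH]; first by rewrite big_geq.
        rewrite big_nat_recr//= IH [(j < N.+1)%N]ltnS [(j <= N)%N]leq_eqVlt indicE.
        have [jN|jN] := eqVneq j N; first by rewrite -jN ltnn mem_set// add0r.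
        rewrite memNset ?addr0// => GN.
        by move/trivIsetP : tG => /(_ j N Logic.I Logic.I jN)/seteqP[/(_ x)] /(_ (conj Gj GN)).
      rewrite indicE mem_set; last by exists j.
      split=> [|N].
        apply: cvg_near_cst; near=> N; rewrite E; congr (_%:R); apply/eqP.
        by rewrite eqb1; near: N; exact: nbhs_infty_gt.
      rewrite E ger0_norm// indicE mem_set; last by case: Gj.
      by case: ltnP.
    rewrite indicE memNset//.
    have E N : \sum_(0 <= k < N) \1_(G k) x = 0 :> R.
      rewrite big1// => k _; rewrite indicE memNset// => Gk.
      by apply: nG; exists k.
    by split=> [|N]; [apply: cvg_near_cst; apply: nearW => N|rewrite E normr0].
  apply: (@shift_continuous_dct (fun N x => \sum_(0 <= k < N) \1_(G k) x) _ (\1_(box m))) => //.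
  + by move=> N; apply: shift_continuous_sum.
  + apply: measurable_indic; apply: bigcupT_measurable => k.
    exact: measurableI.
  + by move=> x; case: (S x).
  + by move=> N x; case: (S x) => _; exact.
Unshelve. all: by end_near. Qed.

Import HBNNSimple.

(** The simple approximations are cut by growing boxes, because a level set, that of 0 for instance,
    may have infinite measure. *)
Let shift_continuous_nneg f : L1 f -> (forall x, 0 <= f x) -> shift_continuous f.
Proof.
move=> fi f0; have mf := L1_measurable fi.
have mEf : measurable_fun setT (EFin \o f) by exact/measurable_EFinP.
pose g := nnsfun_approx measurableT mEf.
have gf x : g m x @[m --> \oo] --> f x.
  have /fine_cvgP[_] : EFin \o (g ^~ x) @ \oo --> (EFin \o f) x.
    by apply: cvg_nnsfun_approx => // y _; rewrite lee_fin.
  exact.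
have gle m x : g m x <= f x.
  rewrite -(cvg_lim _ (gf x))//; apply: (@nondecreasing_cvgn_le _ (fun m => g m x)).
    by move=> i j ij; exact: (lefP _ _ (nd_nnsfun_approx measurableT mEf ij)).
  by apply/cvg_ex; exists (f x); exact: gf.
apply: (@shift_continuous_dct (fun m x => g m x * \1_(box m) x) _ f) => //.
- move=> m; pose s : seq R := finmap.enum_fset (fset_set (range (g m))).
  rewrite (_ : (fun x => _) = (fun x => \sum_(y <- s)
      (y * \1_(g m @^-1` [set y] `&` box m) x))).
    apply: shift_continuous_sum => i; apply: shift_continuousZ.
    exact: shift_continuous_indic.
  apply/funext => x; rewrite fimfunE fsbig_finite//= mulr_suml; apply: eq_bigr => i _.
  by rewrite -mulrA; congr (_ * _); rewrite !indicE in_setI; case: (x \in box m);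
    rewrite ?(mulr1, mulr0, andbT, andbF).
- move=> x; rewrite -[X in _ --> X](mulr1 (f x)); apply: cvgM; first exact: gf.
  apply: cvg_near_cst; near=> m; rewrite indicE mem_set// /box /=.
  by near: m; exact: nbhs_infty_gtr.
- move=> m x; rewrite ger0_norm ?mulr_ge0//.
  by rewrite indicE (le_trans _ (gle m x))// ler_piMr//; case: (x \in _).
Unshelve. all: by end_near. Qed.

Lemma L1_shift_continuous f : L1 f -> shift_continuous f.
Proof.
move=> fi; have mf := L1_measurable fi.
have max_i (g : 'rV[R]_n -> R) : L1 g -> shift_continuous (fun x => Num.max 0 (g x)).
  move=> gi; apply: shift_continuous_nneg => [|x]; last by rewrite le_max lexx.
  have mg := L1_measurable gi; move/L1_integrableP: gi => gi.
  apply/L1_integrableP; apply: (le_integrable measurableT _ _ gi).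
    by apply/measurable_EFinP; exact: measurable_maxr.
  by move=> x _ /=; rewrite lee_fin; case: (leP 0 (g x)) => //; rewrite normr0.
rewrite (_ : f = (fun x => Num.max 0 (f x) + (-1) * Num.max 0 (-1 * f x))).
  apply: shift_continuousD; first exact: max_i.
  by apply: shift_continuousZ; apply: max_i; exact: L1Z.
apply/funext => x; rewrite !mulN1r; case: (leP 0 (f x)) => h0'.
  by rewrite max_l ?oppr_le0// subr0.
by rewrite max_r ?oppr_ge0 ?ltW// opprK add0r.
Qed.

End translation.

(** * Smooth cut-offs *)

Section theta.
Context {R : realType}.

(* The family is closed under derivation up to linear combinations. *)
Definition theta (j : nat) (t : R) : R :=
  if 0 < t then t^-1 ^+ j * expR (- t^-1) else 0.

Lemma theta_ge0 j t : 0 <= theta j t.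
Proof.
rewrite /theta; case: ifPn => // t0.
by rewrite mulr_ge0 ?expR_ge0// exprn_ge0// invr_ge0 ltW.
Qed.

(** One term of the exponential series: [expR t^-1] is at least [t^-1 ^+ (j + 2) / (j + 2)!]. The
    quadratic bound makes the difference quotient at 0 tend to 0. *)
Lemma theta_le j t : `|theta j t| <= (j.+2)`!%:R * t ^+ 2.
Proof.
rewrite ger0_norm ?theta_ge0// /theta; case: ifPn => [t0|_]; last first.
  by rewrite mulr_ge0// sqr_ge0.
have f0 : 0 < (j.+2)`!%:R :> R by rewrite ltr0n fact_gt0.
have i0 : 0 <= t^-1 by rewrite invr_ge0 ltW.
rewrite expRN ler_pdivrMr ?expR_gt0//.
have := expR_ge1Dxn j.+1 i0; rewrite exprS exprSr => H.
have {}H : t^-1 * (t^-1 ^+ j * t^-1) / (j.+2)`!%:R <= expR t^-1.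
  by apply: le_trans H; rewrite lerDr.
apply: le_trans (_ : (j.+2)`!%:R * t ^+ 2 *
  (t^-1 * (t^-1 ^+ j * t^-1) / (j.+2)`!%:R) <= _).
  rewrite le_eqVlt; apply/orP; left; apply/eqP.
  by set F := (_`!)%:R in f0 *; field; rewrite !gt_eqF.
have tf : 0 <= (j.+2)`!%:R * t ^+ 2 by apply: mulr_ge0 => //; exact: sqr_ge0.
by rewrite ler_wpM2l.
Qed.

Lemma is_derive_theta j (t : R) :
  is_derive t (1 : R) (theta j) (theta j.+2 t - j%:R * theta j.+1 t).
Proof.
have [t0|t0|t0] := ltgtP t 0.
- rewrite [theta j.+2 t]/theta [theta j.+1 t]/theta ltNge (ltW t0) /= mulr0 subr0.
  apply: (@near_eq_is_derive _ _ _ (cst (0 : R))).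
  near=> s; rewrite /theta ifF//; apply/negbTE; rewrite -leNgt ltW//.
  by near: s; exact: lt_nbhsl.
- rewrite [theta j.+2 t]/theta [theta j.+1 t]/theta t0.
  apply: (@near_eq_is_derive _ _ _ ((GRing.inv : R -> R) ^+ j * (expR \o (fun s => - s^-1)))).
    near=> s; rewrite /theta ifT; last by near: s; exact: lt_nbhsr.
    by rewrite !fctE.
  have tn : t != 0 by rewrite gt_eqF.
  have dV : is_derive t (1 : R) (GRing.inv : R -> R) (- t ^- 2 *: 1).
    exact: (@is_deriveV _ id).
  have dE : is_derive t (1 : R) (expR \o (fun s => - s^-1)) (expR (- t^-1) * - (- t ^- 2 *: 1)).
    exact: (@is_derive1_comp _ expR (fun s : R => - s^-1)).
  apply: is_derive_eq.
  have sE (a b : R) : a *: b = a * b by [].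
  rewrite !sE exprfctE -[(expR \o _) t]/(expR (- t^-1)); move: (expR _) => E.
  case: j => [|j]; rewrite -?pred_Sn.
    by rewrite !expr0; field.
  by rewrite !exprS; field.
- rewrite t0 [theta j.+2 0]/theta [theta j.+1 0]/theta ltxx mulr0 subr0.
  have C : h^-1 *: ((theta j \o shift 0) (h *: (1 : R)) - theta j 0)
      @[h --> (0 : R)^'] --> (0 : R).
    apply/cvgr0Pnorm_le => e e0; near=> h.
    have h0 : h != 0 by near: h; exact: nbhs_dnbhs_neq.
    rewrite /= addr0 {2}/theta ltxx subr0 [h *: 1]mulr1 normrM normfV.
    rewrite mulrC ler_pdivrMr ?normr_gt0// (le_trans (theta_le _ _))//.
    rewrite -real_normK ?num_real// expr2 mulrA ler_wpM2r// mulrC.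
    have c0 : 0 < (j.+2)`!%:R :> R by rewrite ltr0n fact_gt0.
    rewrite -ler_pdivlMr//; near: h; apply: dnbhs0_le; exact: divr_gt0.
  by apply: DeriveDef; [apply/cvg_ex; exists 0|exact: cvg_lim].
Unshelve. all: by end_near. Qed.

Lemma continuous_theta j : continuous (theta j).
Proof.
move=> t; apply: differentiable_continuous; apply/derivable1_diffP.
by have [] := is_derive_theta j t.
Qed.

End theta.

(** * Smoothness of products and compositions; bump functions *)

Section Ck.
Context {R : realType} {n : nat}.
Implicit Types u v : 'rV[R]_n -> R.

(** [smooth] speaks of iterated partials of one vector field and is awkward for products and
    compositions. Here the order is the recursion variable and derivatives are witnesses, so closure
    properties go by induction on [k]. *)
Fixpoint Ck (k : nat) u : Prop := continuous u /\
  if k is k'.+1 then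
    forall i, exists2 du : 'rV[R]_n -> R,
      (forall x, is_derive x (delta_mx ord0 i) u (du x)) & Ck k' du
  else True.

Lemma Ck_continuous k u : Ck k u -> continuous u.
Proof. by case: k => [|k] []. Qed.

Lemma Ck_le k u : Ck k.+1 u -> Ck k u.
Proof.
elim: k u => [|k IH] u [cu H]; split => // i.
by have [du udu /IH Hdu] := H i; exists du.
Qed.

Lemma Ck_cst k c : Ck k (fun=> c).
Proof.
elim: k c => [|k IH] c; split => //; try exact: contcst.
move=> i; exists (fun=> 0) => [x|]; [exact: is_derive_cst|exact: IH].
Qed.

Lemma CkD k u v : Ck k u -> Ck k v -> Ck k (fun x => u x + v x).
Proof.
elim: k u v => [|k IH] u v [cu Hu] [cv Hv]; split; try exact: contD; try by [].
move=> i; have [du udu Cdu] := Hu i; have [dv vdv Cdv] := Hv i.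
by exists (fun x => du x + dv x) => [x|]; [exact: is_deriveD|exact: IH].
Qed.

Lemma CkM k u v : Ck k u -> Ck k v -> Ck k (fun x => u x * v x).
Proof.
elim: k u v => [|k IH] u v Hu' Hv'; have [cu Hu] := Hu'; have [cv Hv] := Hv'.
  by split => //; exact: contM.
split=> [|i]; first exact: contM.
have [du udu Cdu] := Hu i; have [dv vdv Cdv] := Hv i.
exists (fun x => u x * dv x + v x * du x) => [x|]; first exact: is_deriveM.
by apply: CkD; apply: IH => //; exact: Ck_le.
Qed.

Lemma CkB k u v : Ck k u -> Ck k v -> Ck k (fun x => u x - v x).
Proof.
move=> Hu Hv; have := CkD Hu (CkM (Ck_cst k (-1)) Hv).
by under eq_fun do rewrite mulN1r.
Qed.

Lemma Ck_sum k (I : Type) (r : seq I) (F : I -> 'rV[R]_n -> R) :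
  (forall i, Ck k (F i)) -> Ck k (fun x => \sum_(i <- r) F i x).
Proof.
move=> HF; elim: r => [|i r IH].
  by under eq_fun do rewrite big_nil; exact: Ck_cst.
by under eq_fun do rewrite big_cons; exact: CkD.
Qed.

Lemma Ck_prod k (I : Type) (r : seq I) (F : I -> 'rV[R]_n -> R) :
  (forall i, Ck k (F i)) -> Ck k (fun x => \prod_(i <- r) F i x).
Proof.
move=> HF; elim: r => [|i r IH].
  by under eq_fun do rewrite big_nil; exact: Ck_cst.
by under eq_fun do rewrite big_cons; exact: CkM.
Qed.

Lemma Ck_coord k j : Ck k (fun x : 'rV[R]_n => x ord0 j).
Proof.
have c : continuous (fun x : 'rV[R]_n => x ord0 j : R).
  by apply: contcoord; exact: contid.
case: k => [|k]; split => // i.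
by exists (fun=> (i == j)%:R) => [x|]; [exact: is_derive_coord|exact: Ck_cst].
Qed.

Lemma Ck_theta k j u : Ck k u -> Ck k (fun x => theta j (u x)).
Proof.
elim: k j u => [|k IH] j u Hu'; have [cu Hu] := Hu'.
  by split => //; apply: contcomp => //; exact: continuous_theta.
split=> [|i]; first by apply: contcomp => //; exact: continuous_theta.
have [du udu Cdu] := Hu i.
exists (fun x => (theta j.+2 (u x) - j%:R * theta j.+1 (u x)) * du x) => [x|].
  by apply: is_derive_comp1 => //; exact: is_derive_theta.
have Cu := Ck_le Hu'.
apply: CkM => //; apply: CkB; first exact: IH.
by apply: CkM; [exact: Ck_cst|exact: IH].
Qed.

Lemma Ck_smooth (phi : 'rV[R]_n -> 'rV[R]_n) :
  (forall k j, Ck k (fun x => phi x ord0 j)) -> smooth phi.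
Proof.
move=> H s.
have {}H : forall k j, Ck k (fun x => partials s phi x ord0 j).
  elim: s => [//|i s IH] k j.
  have D j' x : derivable (fun y => partials s phi y ord0 j') x (delta_mx ord0 i).
    have [_ /(_ i)[du udu _]] := IH 1%N j'.
    by have [] := udu x.
  have [_ /(_ i)[du udu Cdu]] := IH k.+1 j.
  rewrite (_ : (fun x => _) = du)//; apply/funext => x.
  rewrite /= /partial derive_mx ?mxE; last first.
    by apply/derivable_mxP => i' j'; rewrite ord1; exact: D.
  by have [] := udu x.
split=> [x|i x].
  by apply: contrV => j; exact: Ck_continuous (H 0%N j).
apply/derivable_mxP => i' j; rewrite ord1.
have [_ /(_ i)[du udu _]] := H 1%N j.
by have [] := udu x.
Qed.

Lemma smooth_Ck (phi : 'rV[R]_n -> 'rV[R]_n) k j :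
  smooth phi -> Ck k (fun x => phi x ord0 j).
Proof.
elim: k phi => [|k IH] phi sphi.
  by split => //; apply: contcoord; exact: smooth_continuous.
split=> [|i]; first by apply: contcoord; exact: smooth_continuous.
exists (fun x => partial i phi x ord0 j) => [x|]; first exact: smooth_is_derive.
by apply: IH; exact: smooth_partial.
Qed.

(* [theta 0 (1 - t)] vanishes for [1 <= t] and is at least [theta 0 1] for
   [t <= 0]. *)
Definition plateau (t : R) : R := theta 0 (theta 0 1 - theta 0 (1 - t)) / theta 0 (theta 0 1).

Lemma theta0_gt0 (t : R) : 0 < t -> 0 < theta 0 t.
Proof. by move=> t0; rewrite /theta t0 expr0 mul1r expR_gt0. Qed.

Lemma theta0_le (s t : R) : s <= t -> theta 0 s <= theta 0 t.
Proof.
move=> st; have [s0|s0] := ltP 0 s; last by rewrite {1}/theta ltNge s0 theta_ge0.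
have t0 := lt_le_trans s0 st.
by rewrite /theta s0 t0 !expr0 !mul1r ler_expR lerN2 lef_pV2 ?posrE.
Qed.

Lemma plateau_bound t : 0 <= plateau t <= 1.
Proof.
have c0 : 0 < theta 0 (theta 0 (1 : R)) by rewrite !theta0_gt0.
rewrite /plateau divr_ge0 ?theta_ge0//= ler_pdivrMr// mul1r theta0_le//.
by rewrite lerBlDr lerDl theta_ge0.
Qed.

Lemma plateau1 t : 1 <= t -> plateau t = 1.
Proof.
move=> t1; have c0 : 0 < theta 0 (theta 0 (1 : R)) by rewrite !theta0_gt0.
rewrite /plateau [theta 0 (1 - t)]/theta ifF; first by rewrite subr0 divff// gt_eqF.
by apply/negbTE; rewrite -leNgt subr_le0.
Qed.

Lemma plateau0 t : t <= 0 -> plateau t = 0.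
Proof.
move=> t0; rewrite /plateau {1}/theta ifF ?mul0r//.
by apply/negbTE; rewrite -leNgt subr_le0 theta0_le// lerDl oppr_ge0.
Qed.

(** The squared distance keeps it smooth at the centre. The argument of [plateau] passes from 1 to 0
    between the radii [r] and [sqrt 2 * r], which is where the bounds [2 * r ^+ 2] below come
    from. *)
Definition ball_bump (y : 'rV[R]_n) (r : R) (x : 'rV[R]_n) : R :=
  plateau (2 - dot (x - y) (x - y) / r ^+ 2).

Lemma Ck_bump k y r : Ck k (ball_bump y r).
Proof.
apply: CkM; last exact: Ck_cst.
apply: Ck_theta; apply: CkB; first exact: Ck_cst.
apply: Ck_theta; apply: CkB; first exact: Ck_cst.
apply: CkB; first exact: Ck_cst.
apply: CkM; last exact: Ck_cst.
rewrite (_ : (fun x => _) = (fun x : 'rV[R]_n => \sum_i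
    (x ord0 i - y ord0 i) * (x ord0 i - y ord0 i))); last first.
  by apply/funext => x; apply: eq_bigr => i _; rewrite !mxE.
apply: Ck_sum => i; apply: CkM; apply: CkB; (exact: Ck_coord) || (exact: Ck_cst).
Qed.

Lemma ball_bump_bound y r x : 0 <= ball_bump y r x <= 1.
Proof. exact: plateau_bound. Qed.

Lemma ball_bump1 y r x : 0 < r -> dot (x - y) (x - y) <= r ^+ 2 -> ball_bump y r x = 1.
Proof.
move=> r0 xy; apply: plateau1.
have : dot (x - y) (x - y) / r ^+ 2 <= 1 by rewrite ler_pdivrMr ?exprn_gt0// mul1r.
lra.
Qed.

Lemma ball_bump0 y r x : 0 < r -> 2 * r ^+ 2 <= dot (x - y) (x - y) -> ball_bump y r x = 0.
Proof.
move=> r0 xy; apply: plateau0.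
have : 2 <= dot (x - y) (x - y) / r ^+ 2 by rewrite ler_pdivlMr ?exprn_gt0.
lra.
Qed.

End Ck.

(** * Pulling a function out of a Lipschitz domain *)

Section field_calculus.
Context {R : realType} {n : nat}.
Implicit Types (phi psi : 'rV[R]_n -> 'rV[R]_n) (U V K : set 'rV[R]_n).

Lemma divergenceE phi (x : 'rV[R]_n) (d : 'I_n -> R) : smooth phi ->
  (forall i, is_derive x (delta_mx ord0 i) (fun y => phi y ord0 i : R) (d i)) ->
  divergence phi x = \sum_i d i.
Proof.
move=> sphi H; apply: eq_bigr => i _.
by have [_ <-] := smooth_is_derive sphi i i x; have [_ ->] := H i.
Qed.

Lemma Cc_infty_sub U V phi : U `<=` V -> Cc_infty U phi -> Cc_infty V phi.
Proof. by move=> UV [sp cp pU]; split => //; exact: subset_trans UV. Qed.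

Lemma Cc_infty0 U : Cc_infty U (fun=> 0 : 'rV[R]_n).
Proof.
have E : support_of (fun=> 0 : 'rV[R]_n) = set0.
  rewrite /support_of (_ : mkset _ = set0) ?closure0//.
  by apply/seteqP; split=> x //=; rewrite eqxx.
split; rewrite ?E//; last exact: compact0.
by apply: Ck_smooth => k j; under eq_fun do rewrite mxE; exact: Ck_cst.
Qed.

Lemma Cc_inftyD U phi psi : Cc_infty U phi -> Cc_infty U psi ->
  Cc_infty U (fun x => phi x + psi x).
Proof.
move=> [sp cp pU] [sq cq qU].
have S : support_of (fun x => phi x + psi x) `<=` support_of phi `|` support_of psi.
  rewrite /support_of -closureU; apply: closureS => x /= pq.
  have [p0|p0] := eqVneq (phi x) 0; last by left.
  by right; rewrite p0 add0r in pq.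
split.
- apply: Ck_smooth => k j; under eq_fun do rewrite mxE.
  by apply: CkD; exact: smooth_Ck.
- apply: subclosed_compact S; first exact: closed_closure.
  exact: compactU.
- by move=> x /S [/pU|/qU].
Qed.

Lemma Cc_infty_sum U (I : Type) (r : seq I) (F : I -> 'rV[R]_n -> 'rV[R]_n) :
  (forall i, Cc_infty U (F i)) -> Cc_infty U (fun x => \sum_(i <- r) F i x).
Proof.
move=> HF; elim: r => [|i r IH].
  by under eq_fun do rewrite big_nil; exact: Cc_infty0.
by under eq_fun do rewrite big_cons; exact: Cc_inftyD.
Qed.

Lemma Cc_infty_cut U phi (u : 'rV[R]_n -> R) : (forall k, Ck k u) -> Cc_infty U phi ->
  Cc_infty (U `&` closure [set x | u x != 0]) (fun x => u x *: phi x).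
Proof.
move=> Cu [sp cp pU].
have S : support_of (fun x => u x *: phi x) `<=`
    support_of phi `&` closure [set x | u x != 0].
  by move=> x H; split; apply: closureS H => y /=;
    apply: contra_neq => ->; rewrite ?scaler0 ?scale0r.
split.
- apply: Ck_smooth => k j; under eq_fun do rewrite mxE.
  by apply: CkM => //; exact: smooth_Ck.
- apply: (@subclosed_compact _ _ _ _ cp); first exact: closed_closure.
  by move=> x /S[].
- by move=> x /S [/pU Ux ?]; split.
Qed.

Lemma Cc_infty_scale U phi (c : R) : Cc_infty U phi -> Cc_infty U (fun x => c *: phi x).
Proof.
move=> Hp; have := @Cc_infty_cut U phi (fun=> c) (fun k => Ck_cst k c) Hp.
by apply: Cc_infty_sub; exact: subIsetl.
Qed.

Lemma off_support_partial phi x : ~ support_of phi x -> forall i, partial i phi x = 0.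
Proof.
move=> sx i.
have nx : \forall y \near x, phi y = 0.
  have : nbhs x (~` support_of phi).
    have : open (~` support_of phi) by apply: closed_openC; exact: closed_closure.
    by rewrite openE; apply.
  apply: filterS => y py; apply: contrapT => /eqP pn; apply: py.
  exact: subset_closure.
rewrite /partial (near_eq_derive (g := cst 0)) ?derive_cst//.
Qed.

Lemma off_support_divergence phi x : ~ support_of phi x -> divergence phi x = 0.
Proof.
move=> sx; rewrite /divergence big1// => i _.
by rewrite off_support_partial// mxE.
Qed.

(** A positive distance from a compact set to the complement, stated as a property of all small [d]
    so that finitely many margins can be combined. *)
Lemma compact_open_margin K V : compact K -> open V -> K `<=` V ->
  \forall d \near (0 : R)^'+, forall x z, K x -> dot z z < d -> V (x + z).
Proof.
move=> /compact_near_coveringP cK oV KV.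
have := @cK R ((0 : R)^'+) (fun d x => forall z, dot z z < d -> V (x + z)) _.
have H : forall x, K x -> \forall x' \near x & d \near (0 : R)^'+,
    forall z : 'rV[R]_n, dot z z < d -> V (x' + z).
  move=> x Kx; have : nbhs x V by move: oV; rewrite openE; apply; exact: KV.
  move=> /nbhs_ballP[e /= e0 xeV].
  have e20 : 0 < e / 2 by rewrite divr_gt0.
  exists (ball x (e / 2), [set d | d < (e / 2) ^+ 2]) => /=.
    split; first exact: nbhsx_ballx.
    by apply: nbhs_right_lt; rewrite exprn_gt0.
  move=> [x' d] /= [xx' de] z zd; apply: xeV.
  rewrite -ball_normE /= opprD addrA (le_lt_trans (ler_normB _ _))//.
  rewrite (splitr e); apply: ltrD; first by move: xx'; rewrite -ball_normE.
  apply: le_lt_trans (norm_le_enorm z) _.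
  rewrite -(ltr_pXn2r (n := 2)) ?nnegrE ?enorm_ge0 ?ltW// enorm_sqr.
  exact: lt_trans de.
by move=> /(_ _ H); apply: filterS => d Hd x z Kx; exact: Hd.
Qed.

End field_calculus.

Section L1_integrals.
Context {R : realType} {n : nat}.
Implicit Types (f g : 'rV[R]_n -> R).

Lemma L1_mul_bounded f g C : L1 f -> measurable_fun setT g -> (forall x, `|g x| <= C) ->
  L1 (fun x => f x * g x).
Proof. by move=> fi mg gC; apply/L1_integrableP; exact: integrable_mul_bounded gC. Qed.

Lemma L1_0 : L1 (fun _ : 'rV[R]_n => 0 : R).
Proof. by apply/L1_integrableP; exact: integrable0. Qed.

Lemma L1_sum (I : Type) (r : seq I) (F : I -> 'rV[R]_n -> R) :
  (forall i, L1 (F i)) -> L1 (fun x => \sum_(i <- r) F i x).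
Proof.
move=> HF; elim: r => [|i r IH]; first by under eq_fun do rewrite big_nil; exact: L1_0.
by under eq_fun do rewrite big_cons; exact: L1D.
Qed.

Lemma Rintegral_sum (I : Type) (r : seq I) (F : I -> 'rV[R]_n -> R) :
  (forall i, L1 (F i)) ->
  \int[leb n]_x (\sum_(i <- r) F i x) = \sum_(i <- r) \int[leb n]_x F i x.
Proof.
move=> HF; elim: r => [|i r IH].
  under eq_Rintegral do rewrite big_nil.
  by rewrite big_nil /Rintegral integral0.
under eq_Rintegral do rewrite big_cons.
by rewrite big_cons -IH RintegralD//; [apply/L1_integrableP|apply/L1_integrableP; exact: L1_sum].
Qed.

Lemma integral_abs_le_sum (I : Type) (r : seq I) (F : I -> 'rV[R]_n -> R) u :
  (forall i, L1 (F i)) -> L1 u -> (forall x, `|u x| <= \sum_(i <- r) `|F i x|) ->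
  (\int[leb n]_x `|u x|%:E <= \sum_(i <- r) \int[leb n]_x `|F i x|%:E)%E.
Proof.
move=> HF ui uF.
rewrite -(ge0_integral_sum _ _ (f := fun i x => `|F i x|%:E))//; last first.
  by move=> i; apply: measurable_abs_EFin; exact: L1_measurable.
apply: ge0_le_integral => //.
- by apply: measurable_abs_EFin; exact: L1_measurable.
- by apply: emeasurable_sum => i; apply: measurable_abs_EFin; exact: L1_measurable.
by move=> x _; rewrite sumEFin lee_fin.
Qed.

End L1_integrals.

(** * Gluing translates of f with cut-offs *)

Section partition_shift.
Context {R : realType} {n : nat}.
Variables (N : nat) (zeta : 'I_N -> 'rV[R]_n -> R) (ev : 'I_N -> 'rV[R]_n).
Variables (V Omega : set 'rV[R]_n) (f : 'rV[R]_n -> R) (t0 M Mz : R).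
Hypotheses (Czeta : forall i k, Ck k (zeta i))
  (zeta_support : forall i x, Mz <= `|x| -> zeta i x = 0)
  (zeta_ge0 : forall i x, 0 <= zeta i x)
  (zeta_le1 : forall x, \sum_i zeta i x <= 1)
  (oV : open V) (zeta1 : forall x, V x -> \sum_i zeta i x = 1)
  (cO : compact (closure Omega)) (OV : closure Omega `<=` V) (t00 : 0 < t0)
  (push : forall i x t, closure Omega x -> closure [set y | zeta i y != 0] x ->
    0 < t <= t0 -> Omega (x + t *: ev i))
  (L1f : L1 f) (fM : total_var f Omega = M%:E).
Hypothesis oOmega : open Omega.

Let K i := closure [set y | zeta i y != 0].

Definition pushed (t : R) (x : 'rV[R]_n) : R :=
  f x + \sum_i zeta i x * (f (x + t *: ev i) - f x).

(** Both conditions are imposed by the test fields: on [V] the [zeta i] add up to 1, and a field cut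
    by [zeta i] lands in [Omega] when translated by [t *: ev i]. *)
Definition push_domain (t : R) : set 'rV[R]_n :=
  [set x | V x /\ forall i, K i x -> Omega (x + t *: ev i)].

Lemma zeta_partials : exists (dz : 'I_N -> 'I_n -> 'rV[R]_n -> R) (C : R),
  [/\ 0 <= C,
    forall i j x, is_derive x (delta_mx ord0 j) (zeta i) (dz i j x),
    forall i j, continuous (dz i j) &
    forall i j x, `|dz i j x| <= C].
Proof.
have H (ij : 'I_N * 'I_n) : exists du : 'rV[R]_n -> R,
    (forall x, is_derive x (delta_mx ord0 ij.2) (zeta ij.1) (du x)) /\ continuous du.
  have [_ /(_ ij.2)[du udu [cdu _]]] := Czeta ij.1 1%N.
  by exists du.
have [dz Hdz] := choice H.
have B (ij : 'I_N * 'I_n) : exists C : R, forall x, `|dz ij x| <= C.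
  apply: (@bounded_support _ _ _ (Mz + 1)); first by case: (Hdz ij).
  move=> x Mx; have [D _] := Hdz ij; have [_ <-] := D x.
  have Mx' : Mz < `|x| by rewrite (lt_le_trans _ Mx)// ltrDl.
  rewrite (near_eq_derive (g := cst 0)) ?derive_cst//.
  have := near_norm_gt Mx'; apply: filterS => y My.
  by rewrite zeta_support// ltW.
have [C HC] := choice B.
exists (fun i j => dz (i, j)), (\sum_ij `|C ij|); split.
- exact: sumr_ge0.
- by move=> i j; case: (Hdz (i, j)).
- by move=> i j; case: (Hdz (i, j)).
- move=> i j x; rewrite (le_trans (HC (i, j) x))// (le_trans (ler_norm _))//.
  by rewrite (bigD1 (i, j))//= lerDl sumr_ge0.
Qed.

Lemma measurable_zeta i : measurable_fun setT (zeta i).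
Proof. by apply: continuous_measurable_rVR; exact: Ck_continuous (Czeta i 0%N). Qed.

Lemma zeta_bound i x : `|zeta i x| <= 1.
Proof.
rewrite ger0_norm// (le_trans _ (zeta_le1 x))//.
by rewrite (bigD1 i)//= lerDl sumr_ge0.
Qed.

Lemma L1_shift_diff v : L1 (fun x => f (x + v) - f x).
Proof. by apply: L1B => //; exact: L1_shift. Qed.

Lemma L1_pushed_term t i : L1 (fun x => zeta i x * (f (x + t *: ev i) - f x)).
Proof.
under eq_fun do rewrite mulrC.
by apply: L1_mul_bounded (zeta_bound i); [exact: L1_shift_diff|exact: measurable_zeta].
Qed.

Lemma L1_pushed t : L1 (pushed t).
Proof. by apply: L1D => //; apply: L1_sum => i; exact: L1_pushed_term. Qed.

Lemma pushed_near t :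
  (\int[leb n]_x `|pushed t x - f x|%:E <= \sum_i shift_dist f (t *: ev i))%E.
Proof.
apply: (integral_abs_le_sum (F := fun i x => f (x + t *: ev i) - f x)) => [i||x].
- exact: L1_shift_diff.
- by apply: L1B => //; exact: L1_pushed.
rewrite /pushed addrC addKr (le_trans (ler_norm_sum _ _ _))//.
apply: ler_sum => i _; rewrite normrM ler_piMl//; exact: zeta_bound.
Qed.

Lemma push_margin t : 0 < t <= t0 -> exists2 d : R, 0 < d &
  forall x z, Omega x -> dot z z < d -> push_domain t (x + z).
Proof.
move=> tt0.
(* The implication defining [push_domain], written as a union of two open sets; it holds on the
   compact closure of [Omega], hence with a margin. *)
pose W i : set 'rV[R]_n := ~` K i `|` [set x | Omega (x + t *: ev i)].
have oW i : open (W i).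
  apply: openU; first by apply: closed_openC; exact: closed_closure.
  apply: (@open_comp _ _ (fun x : 'rV[R]_n => x + t *: ev i)) => // x _.
  exact: continuous_add_rV.
have HV := compact_open_margin cO oV OV.
have HW : \forall d \near (0 : R)^'+, forall i, forall x z, closure Omega x ->
    dot z z < d -> W i (x + z).
  apply: filter_forall => i; apply: compact_open_margin => // x Ox.
  by have [Kx|Kx] := pselect (K i x); [right; exact: push|left].
have [d [[d0 dV] dW]] := filter_ex (filterI (filterI (nbhs_right_gt 0) HV) HW).
exists d => // x z Ox zd; have Cx : closure Omega x by exact: subset_closure.
split=> [|i Kxz]; first exact: dV.
by have [] := dW i x z Cx zd.
Qed.

(** On [V] the function is the sum of the [zeta i] times the translates of [f]. Moving the
    translations onto the field gives [Phi], supported in [Omega] and of norm at most [1 + t * E];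
    this yields the term in [M]. The derivatives that fall on [zeta i] only meet
    [f (x + t *: ev i) - f x], which yields the term in [D]. *)
Lemma pushed_variation : exists E C : R, [/\ 0 <= E, 0 <= C & forall (t : R) (D : 'I_N -> R),
  0 < t <= t0 -> (forall i, shift_dist f (t *: ev i) = (D i)%:E) ->
  (total_var (pushed t) (push_domain t) <=
    ((1 + t * E) * M + C * \sum_i D i)%:E)%E].
Proof.
have [dz [C [C0 dzE cdz dzC]]] := zeta_partials.
pose E := C * \sum_i \sum_j `|ev i ord0 j|.
have E0 : 0 <= E by rewrite mulr_ge0// sumr_ge0// => i _; exact: sumr_ge0.
exists E, (n%:R * C); split=> [//||t D tt0 HD]; first by rewrite mulr_ge0.
have /andP[tp _] := tt0.
apply: ge_ereal_sup => _ [phi /test_fieldP[Cphi phi1] <-].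
have [sphi cphi phiU] := Cphi.
pose psi i (x : 'rV[R]_n) := zeta i x *: phi x.
have Cpsi i : Cc_infty (push_domain t `&` K i) (psi i) by exact: Cc_infty_cut.
pose Psi i (x : 'rV[R]_n) := psi i (x + - (t *: ev i)).
have CPsi i : Cc_infty Omega (Psi i).
  apply: Cc_infty_shift (Cpsi i) => x [[_ Ux] Kx].
  by have := Ux i Kx; rewrite subrK.
pose Phi (x : 'rV[R]_n) := \sum_i Psi i x.
have CPhi : Cc_infty Omega Phi by exact: Cc_infty_sum.
(* [q i = grad (zeta i) . phi]; the [q i] add up to 0 because the [zeta i] add
   up to 1 near the support of [phi]. *)
pose q i (x : 'rV[R]_n) := \sum_j dz i j x * phi x ord0 j.
have divpsi i x : divergence (psi i) x = zeta i x * divergence phi x + q i x.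
  have [spsi _ _] := Cpsi i.
  have H j : is_derive x (delta_mx ord0 j) (fun y => psi i y ord0 j : R)
      (zeta i x *: partial j phi x ord0 j + phi x ord0 j *: dz i j x).
    under eq_fun do rewrite mxE.
    by apply: is_deriveM; exact: smooth_is_derive.
  rewrite (divergenceE spsi H) big_split /= /divergence mulr_sumr; congr (_ + _).
  by apply: eq_bigr => j _; rewrite [LHS]mulrC.
have q0 i x : ~ support_of phi x -> q i x = 0.
  move=> sx; rewrite /q big1// => j _.
  by rewrite (off_support (U := support_of phi) _ sx)// mxE mulr0.
have qsum x : \sum_i q i x = 0.
  have [sx|sx] := pselect (support_of phi x); last by rewrite big1// => i _; exact: q0.
  rewrite /q exchange_big/= big1// => j _; rewrite -mulr_suml.
  suff -> : \sum_i dz i j x = 0 by rewrite mul0r.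
  have H : is_derive x (delta_mx ord0 j) (\sum_i zeta i) (\sum_i dz i j x).
    by apply: is_derive_sum => i; exact: dzE.
  have [_ <-] := H.
  rewrite (near_eq_derive (g := cst (1 : R))) ?derive_cst//.
  have nV : nbhs x V by move: oV; rewrite openE; apply; case: (phiU _ sx).
  by apply: filterS nV => y Vy; rewrite fct_sumE zeta1.
(* Because the [q i] sum to 0, [f x * q i x] can be inserted for free, so [q i] is paired with a
   difference of [f] and not with [f] itself. *)
have key x : pushed t x * divergence phi x =
    \sum_i (f (x + t *: ev i) * divergence (psi i) x -
      (f (x + t *: ev i) - f x) * q i x).
  have [sx|sx] := pselect (support_of phi x); last first.
    rewrite off_support_divergence// mulr0 big1// => i _.
    by rewrite divpsi q0// off_support_divergence// !mulr0 addr0 mulr0 subr0.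
  transitivity (\sum_i (zeta i x * f (x + t *: ev i) * divergence phi x) + f x * \sum_i q i x).
    rewrite qsum mulr0 addr0 -mulr_suml; congr (_ * _); rewrite /pushed.
    under eq_bigr do rewrite mulrBr.
    rewrite sumrB -mulr_suml zeta1 ?mul1r; last by case: (phiU _ sx).
    by rewrite addrC subrK.
  rewrite mulr_sumr -big_split; apply: eq_bigr => i _.
  by rewrite divpsi /=; ring.
have qC i x : `|q i x| <= n%:R * C.
  rewrite (le_trans (ler_norm_sum _ _ _))// (@le_trans _ _ (\sum_(j < n) C))//.
    apply: ler_sum => j _; rewrite normrM -[leRHS]mulr1; apply: ler_pM => //.
    by rewrite (le_trans (ler_coord_enorm _ _)).
  by rewrite sumr_const card_ord mulr_natl.
have mq i : measurable_fun setT (q i).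
  apply: continuous_measurable_rVR; apply: contsum => j; apply: contM; first exact: cdz.
  by apply: contcoord; exact: smooth_continuous.
have L1q i : L1 (fun x => (f (x + t *: ev i) - f x) * q i x).
  exact: (L1_mul_bounded (L1_shift_diff _) (mq i) (qC i)).
have L1d (g : 'rV[R]_n -> R) psi' U : L1 g -> Cc_infty U psi' -> L1 (fun x => g x * divergence psi' x).
  by move=> gi [sp cp _]; apply/L1_integrableP; exact: integrable_L1_div.
have L1p i : L1 (fun x => f (x + t *: ev i) * divergence (psi i) x).
  by apply: L1d (Cpsi i); exact: L1_shift.
have I1 : \int[leb n]_x (pushed t x * divergence phi x) =
    \sum_i \int[leb n]_x (f (x + t *: ev i) * divergence (psi i) x) -
    \sum_i \int[leb n]_x ((f (x + t *: ev i) - f x) * q i x).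
  under eq_Rintegral do rewrite key.
  rewrite Rintegral_sum => [|i]; last by apply: L1B.
  rewrite -sumrB; apply: eq_bigr => i _.
  by rewrite RintegralB//; [apply/L1_integrableP|apply/L1_integrableP].
have divPhi x : divergence Phi x = \sum_i divergence (Psi i) x.
  have [sPhi _ _] := CPhi.
  have H j : is_derive x (delta_mx ord0 j) (fun y => Phi y ord0 j : R)
      (\sum_i partial j (Psi i) x ord0 j).
    rewrite (_ : (fun y => _) = \sum_i (fun y => Psi i y ord0 j : R)); last first.
      by apply/funext => y; rewrite fct_sumE /Phi summxE.
    by apply: is_derive_sum => i; apply: smooth_is_derive; case: (CPsi i).
  by rewrite (divergenceE sPhi H) exchange_big.
have I2 : \sum_i \int[leb n]_x (f (x + t *: ev i) * divergence (psi i) x) =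
    \int[leb n]_x (f x * divergence Phi x).
  under [RHS]eq_Rintegral do rewrite divPhi mulr_sumr.
  rewrite Rintegral_sum => [|i]; last exact: L1d (CPsi i).
  apply: eq_bigr => i _; apply: (congr1 fine).
  rewrite -[RHS](integral_leb_shift (t *: ev i)).
    by apply: eq_integral => x _; rewrite /Psi divergence_shift addrK.
  by have /L1_integrableP/measurable_int := L1d _ _ _ L1f (CPsi i).
have I3 i : `|\int[leb n]_x ((f (x + t *: ev i) - f x) * q i x)| <= n%:R * C * D i.
  have /L1_integrableP Li := L1_shift_diff (t *: ev i).
  have /L1_integrableP Lqi := L1q i.
  have -> : D i = \int[leb n]_x `|f (x + t *: ev i) - f x|.
    by rewrite /Rintegral -[(\int[_]_x _)%E]/(shift_dist f (t *: ev i)) HD.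
  rewrite -RintegralZl//; last exact: integrable_norm Li.
  rewrite (le_trans (le_normr_Rintegral measurableT Lqi))//.
  apply: le_Rintegral => //.
  - exact: integrable_norm Lqi.
  - exact: (integrableZl measurableT _ (integrable_norm Li)).
  by move=> x _; rewrite normrM mulrC ler_wpM2r.
have I4 : - (\int[leb n]_x (f x * divergence Phi x)) <= (1 + t * E) * M.
  (* [Phi] exceeds 1 by at most the oscillation of the [zeta i] at distance [t]. *)
  pose c := 1 + t * E.
  have c0 : 0 < c by rewrite ltr_pwDl// mulr_ge0// ltW.
  have CP' : Cc_infty Omega (fun x => c^-1 *: Phi x) by exact: Cc_infty_scale.
  have tP' : test_field Omega (fun x => c^-1 *: Phi x).
    apply/test_fieldP; split => // x.
    have ci : 0 <= c^-1 by rewrite invr_ge0 ltW.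
    rewrite enormZ (ger0_norm ci) ler_pdivrMl// mulr1.
    rewrite (le_trans (enorm_sum _ _))//.
    apply: (@le_trans _ _ (\sum_i (zeta i x + C * \sum_j `|(t *: ev i) ord0 j|))).
      apply: ler_sum => i _; rewrite /Psi /psi enormZ ger0_norm//.
      rewrite (@le_trans _ _ (zeta i (x - t *: ev i)))//.
        by rewrite ler_piMr.
      have := ler_lipschitz_partial (dzE i) (dzC i) x (- (t *: ev i)).
      under eq_bigr do rewrite mxE normrN.
      by move=> /(le_trans (ler_norm _)); rewrite lerBlDl.
    rewrite big_split /= /c lerD// -mulr_sumr mulrCA ler_wpM2l// mulr_sumr.
    apply: ler_sum => i _; rewrite mulr_sumr; apply: ler_sum => j _.
    by rewrite mxE normrM ger0_norm// ltW.
  have [sPhi cPhi _] := CPhi; have [sP' cP' _] := CP'.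
  have := ereal_sup_ubound (_ : [set distr_grad f psi' | psi' in test_field Omega]
    (distr_grad f (fun x => c^-1 *: Phi x))).
  have -> : ereal_sup [set distr_grad f psi' | psi' in test_field Omega] = M%:E by [].
  move=> /(_ (ex_intro2 _ _ _ tP' erefl)).
  rewrite distr_gradE// lee_fin.
  have H x j : is_derive x (delta_mx ord0 j) (fun y => (c^-1 *: Phi y) ord0 j : R)
      (c^-1 *: partial j Phi x ord0 j).
    under eq_fun do rewrite mxE.
    by apply: is_deriveZ; exact: smooth_is_derive.
  under eq_Rintegral do rewrite (divergenceE sP' (H _)) -scaler_sumr mulrCA.
  rewrite RintegralZl//; last by apply/L1_integrableP; exact: L1d CPhi.
  by rewrite -mulrN ler_pdivrMl.
rewrite distr_gradE//; last exact: L1_pushed.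
rewrite lee_fin I1 I2 opprB addrC; apply: lerD => //.
rewrite (le_trans (ler_norm _))// (le_trans (ler_norm_sum _ _ _))// mulr_sumr.
by apply: ler_sum.
Qed.

End partition_shift.

(** * Pushing a Lipschitz domain into itself *)

Section lipschitz_push.
Context {R : realType}.

Lemma dot_mulmx_orthogonal n (Q : 'M[R]_n) (v : 'rV[R]_n) :
  Q *m Q^T = 1%:M -> dot (v *m Q) (v *m Q) = dot v v.
Proof.
move=> QQ; have dE (w : 'rV[R]_n) : dot w w = (w *m w^T) ord0 ord0.
  by rewrite mxE; apply: eq_bigr => i _; rewrite mxE.
by rewrite !dE trmx_mul mulmxA -(mulmxA v) QQ mulmx1.
Qed.

Lemma contlip (T : topologicalType) n (gamma : 'rV[R]_n -> R) (L : R) (g : T -> 'rV[R]_n) :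
  (forall u v, `|gamma u - gamma v| <= L * enorm (u - v)) -> continuous g ->
  continuous (fun t => gamma (g t)).
Proof.
move=> HL cg s; apply/cvgrPdist_le => e e0.
have L0 : 0 < `|L| + 1 by rewrite ltr_wpDl.
have c : enorm (g s - g t) @[t --> s] --> (0 : R).
  rewrite -(@enorm0 R n) -(subrr (g s)).
  have c : continuous (fun t => g s - g t).
    apply: contaddrV; first exact: contconst_rV.
    by move=> t; apply: continuousN; exact: cg.
  have := @continuous_comp _ _ _ (fun t => g s - g t) (fun z => enorm z) s (c s).
  by apply; exact: continuous_enorm.
near=> t; rewrite (le_trans (HL _ _))//.
rewrite (@le_trans _ _ ((`|L| + 1) * enorm (g s - g t)))//.
  by rewrite ler_wpM2r ?enorm_ge0// (le_trans (ler_norm _))// lerDl.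
rewrite mulrC -ler_pdivlMr//; near: t; apply: (cvgr_le 0) => //.
exact: divr_gt0.
Unshelve. all: by end_near. Qed.

(** Inside [Omega] the zero vector works. At a boundary point [e] is the epigraph axis in the
    original coordinates: closure points lie on or above the graph, and any positive step along the
    axis puts them strictly above it without changing the other coordinates. *)
Lemma local_push n (Omega : set 'rV[R]_n) (x : 'rV[R]_n) :
  open Omega -> lipschitz_boundary Omega -> closure Omega x ->
  exists (e : 'rV[R]_n) (r t0 : R), [/\ 0 < r, 0 < t0 &
    forall y t, closure Omega y -> dot (y - x) (y - x) <= 2 * r ^+ 2 ->
      0 < t <= t0 -> Omega (y + t *: e)].
Proof.
move=> oO lip Cx; have [Ox|nOx] := pselect (Omega x).
  have /nbhs_ballP[s /= s0 sO] : nbhs x Omega by move: oO; rewrite openE; exact.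
  exists 0, (s / 3), 1; split => // [|y t _ yx _]; first by rewrite divr_gt0.
  rewrite scaler0 addr0; apply: sO; rewrite -ball_normE /=.
  rewrite distrC (le_lt_trans (norm_le_enorm _))//.
  rewrite -(ltr_pXn2r (n := 2)) ?nnegrE ?enorm_ge0 ?ltW// enorm_sqr.
  by apply: le_lt_trans yx _; rewrite exprMn; have : 0 < s ^+ 2 by [rewrite exprn_gt0|]; lra.
have [|r0 [Q [k [gamma [r00 QQ [L HL] HO]]]]] := lip x.
  by split => // /interior_subset.
have QTQ : Q^T *m Q = 1%:M by exact: mulmx1C.
pose e : 'rV[R]_n := delta_mx ord0 k *m Q^T.
have eQ : e *m Q = delta_mx ord0 k by rewrite /e -mulmxA QTQ mulmx1.
have cQ : continuous (fun y : 'rV[R]_n => y *m Q).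
  apply: contrV => i; under eq_fun do rewrite mxE.
  by apply: contsum => j; apply: contM; [apply: contcoord; exact: contid|exact: contcst].
(* [2 * (r0 / 5) ^+ 2 < (r0 / 2) ^+ 2] and [r0 / 2 + r0 / 3 < r0]: both [y] and its translate stay
   in the cube where [HO] applies. *)
exists e, (r0 / 5), (r0 / 3); split; [by rewrite divr_gt0|by rewrite divr_gt0|].
move=> y t Cy yx /andP[tp tt0].
have coordQ z s i : 0 < s -> dot (z - x) (z - x) < s ^+ 2 -> `|((z - x) *m Q) ord0 i| < s.
  move=> s0 zs; rewrite (le_lt_trans (ler_coord_enorm _ _))//.
  rewrite -(ltr_pXn2r (n := 2)) ?nnegrE ?enorm_ge0 ?(ltW s0)// enorm_sqr.
  by rewrite dot_mulmx_orthogonal.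
have r02 : 0 < r0 ^+ 2 by rewrite exprn_gt0.
have cube i : `|((y - x) *m Q) ord0 i| < r0 / 2.
  by apply: coordQ; [rewrite divr_gt0|apply: le_lt_trans yx _; rewrite !exprMn; lra].
(* Being strictly below the graph is an open condition, so a closure point there would have points
   of [Omega] nearby that are also strictly below, against [HO]. *)
have yk : gamma (col' k (y *m Q)) <= (y *m Q) ord0 k.
  rewrite leNgt; apply/negP => lt.
  pose A : set 'rV[R]_n := [set z | 0 < gamma (col' k (z *m Q)) - (z *m Q) ord0 k] `&`
    [set z | dot (z - x) (z - x) < r0 ^+ 2].
  have oA : open A.
    apply: openI.
      apply: (@open_comp _ _ (fun z : 'rV[R]_n => gamma (col' k (z *m Q)) - (z *m Q) ord0 k)
        [set t | 0 < t]); last exact: open_gt.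
      move=> z _; apply: contB; last exact: contcoord.
      apply: (contlip HL); apply: contrV => j; under eq_fun do rewrite mxE.
      exact: contcoord.
    exact: open_dot_lt.
  have nA : nbhs y A.
    move: oA; rewrite openE; apply; split; rewrite /= ?subr_gt0//.
    by apply: le_lt_trans yx _; rewrite !exprMn; lra.
  have [z [Oz [zlt zc]]] := Cy _ nA.
  have /HO[/(_ Oz)] : forall i, `|((z - x) *m Q) ord0 i| < r0 by move=> i; exact: coordQ.
  by move: zlt; rewrite /= subr_gt0 => zlt; rewrite ltNge (ltW zlt).
have yte : (y + t *: e) *m Q = y *m Q + t *: delta_mx ord0 k.
  by rewrite mulmxDl -scalemxAl eQ.
apply/HO => [i|].
  rewrite addrAC mulmxDl -scalemxAl eQ mxE (le_lt_trans (ler_normD _ _))//.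
  have := cube i; rewrite !mxE eqxx /= => ci.
  have : `|t * (i == k)%:R| <= r0 / 3.
    by case: (i == k); rewrite ?mulr1 ?mulr0 ?normr0 ?gtr0_norm// divr_ge0// ltW.
  lra.
rewrite yte (_ : col' k _ = col' k (y *m Q)).
  apply: le_lt_trans yk _; move: (y *m Q) => A.
  by rewrite !mxE !eqxx mulr1 ltrDl.
apply/rowP => j; rewrite !mxE eqxx /= [lift k j == k]eq_sym (negbTE (neq_lift k j)).
by rewrite mulr0 addr0.
Qed.

Lemma recovery_lipschitz n (Omega : set 'rV[R]_n) (f : 'rV[R]_n -> R) (M eps : R) :
  open Omega -> bounded_set Omega -> lipschitz_boundary Omega -> L1 f ->
  total_var f Omega = M%:E -> 0 < eps ->
  exists (g : 'rV[R]_n -> R) (d : R) (U : set 'rV[R]_n), [/\ L1 g,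
    (\int[leb n]_x `|g x - f x|%:E <= eps%:E)%E, 0 < d,
    (forall x z, Omega x -> dot z z < d -> U (x + z)) &
    (total_var g U <= (M + eps)%:E)%E].
Proof.
move=> oO bO lip L1f fM eps0.
have cO : compact (closure Omega).
  have [C [_ HC]] := bO.
  apply: (@subclosed_compact _ _ _ _ (@closed_box_compact R n (C + 1))).
    exact: closed_closure.
  rewrite [X in _ `<=` X](iffLR (closure_id _) (@closed_norm_le R n (C + 1))); apply: closureS => z Oz.
  by apply: HC Oz; rewrite ltrDl.
(* Stated for every [x], with dummy data off the closure, so that [choice] yields total functions
   for direction, radius and step. *)
have H (x : 'rV[R]_n) : exists p : 'rV[R]_n * R * R, closure Omega x -> [/\ 0 < p.1.2, 0 < p.2 &
    forall y t, closure Omega y -> dot (y - x) (y - x) <= 2 * p.1.2 ^+ 2 ->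
      0 < t <= p.2 -> Omega (y + t *: p.1.1)].
  have [Cx|nCx] := pselect (closure Omega x); last by exists (0, 0, 0).
  have [e [r [t0 [r0 t00 He]]]] := local_push oO lip Cx.
  by exists (e, r, t0) => _; split.
have [p Hp] := choice H.
pose W (c : 'rV[R]_n) : set 'rV[R]_n := [set y | dot (y - c) (y - c) < (p c).1.2 ^+ 2].
have oW c : open (W c) by exact: open_dot_lt.
have [s sD sC] : exists2 s : seq 'rV[R]_n, (forall c, c \in s -> closure Omega c) &
    closure Omega `<=` [set y | exists2 c, c \in s & W c y].
  move: (cO); rewrite compact_cover => /(_ _ (closure Omega) W)[].
  - by [].
  - move=> x Cx; exists x => //=; have [r0 _ _] := Hp _ Cx.
    by rewrite /W /= subrr /dot big1 ?exprn_gt0// => i _; rewrite mxE mul0r.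
  - move=> D' DD DC; exists (finmap.enum_fset D') => [c /DD|y /DC[c /= cD Wc]].
      by rewrite inE.
    by exists c.
pose cc (k : nat) : 'rV[R]_n := nth 0 s k.
pose N := size s.
have ccC (i : 'I_N) : closure Omega (cc i) by apply: sD; exact: mem_nth.
pose b (k : nat) := ball_bump (cc k) (p (cc k)).1.2.
(* The [Z k] telescope: their sum is 1 minus the product of the [1 - b j]. *)
pose Z (k : nat) (x : 'rV[R]_n) := b k x * \prod_(j < k) (1 - b j x).
have Zsum x m : \sum_(k < m) Z k x = 1 - \prod_(j < m) (1 - b j x).
  elim: m => [|m IH]; first by rewrite !big_ord0 subrr.
  by rewrite !big_ord_recr /= IH /Z; ring.
have b01 k x : 0 <= b k x <= 1 by exact: ball_bump_bound.
have prod01 x m : 0 <= \prod_(j < m) (1 - b j x) <= 1.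
  elim: m => [|m /andP[IH0 IH1]]; first by rewrite big_ord0 ler01 lexx.
  have /andP[b0 b1] := b01 m x.
  by rewrite big_ord_recr /= mulr_ge0 ?subr_ge0// mulr_ile1// ?subr_ge0// lerBlDr lerDl.
pose zeta (i : 'I_N) := Z i.
pose ev (i : 'I_N) := (p (cc i)).1.1.
pose V : set 'rV[R]_n := \bigcup_(c in [set` s]) W c.
have Czeta (i : 'I_N) k : Ck k (zeta i).
  apply: CkM; first exact: Ck_bump.
  by apply: Ck_prod => j; apply: CkB; [exact: Ck_cst|exact: Ck_bump].
(* It exceeds each [|cc i| + 2 r_i], so beyond it [x] is at distance at least [2 r_i] from every
   centre, where the bumps vanish. *)
pose Mz := \sum_(i < N) (`|cc i| + 2 * (p (cc i)).1.2).
have rpos (i : 'I_N) : 0 < (p (cc i)).1.2 by have [] := Hp _ (ccC i).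
have zeta_support (i : 'I_N) x : Mz <= `|x| -> zeta i x = 0.
  move=> Mx; rewrite /zeta /Z /b ball_bump0 ?mul0r//.
  have r2 : 2 * (p (cc i)).1.2 <= `|x - cc i|.
    have : `|cc i| + 2 * (p (cc i)).1.2 <= Mz.
      rewrite /Mz (bigD1 i)//= lerDl sumr_ge0// => j _.
      by rewrite addr_ge0// mulr_ge0// ltW.
    have := lerB_dist x (cc i); lra.
  rewrite -enorm_sqr (@le_trans _ _ ((2 * (p (cc i)).1.2) ^+ 2))//.
    by rewrite exprMn ler_wpM2r ?sqr_ge0//; lra.
  rewrite ler_pXn2r ?nnegrE ?enorm_ge0 ?mulr_ge0 ?(ltW (rpos i))//.
  by rewrite (le_trans r2)// norm_le_enorm.
have zeta_ge0 (i : 'I_N) x : 0 <= zeta i x.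
  have /andP[b0 _] := b01 i x; have /andP[p0 _] := prod01 x i.
  exact: mulr_ge0.
have zeta_le1 x : \sum_i zeta i x <= 1.
  by rewrite Zsum lerBlDr lerDl; have /andP[] := prod01 x N.
have oV : open V by apply: bigcup_open => c _.
have zeta1 x : V x -> \sum_i zeta i x = 1.
  move=> [c /= cs Wx]; rewrite Zsum.
  have ks : (index c s < N)%N by rewrite index_mem.
  rewrite (bigD1 (Ordinal ks))//= [b (index c s) x]ball_bump1 ?subrr ?mul0r ?subr0//.
  - exact: (rpos (Ordinal ks)).
  - by rewrite /cc nth_index// ltW.
have OV : closure Omega `<=` V by move=> x /sC[c cs Wx]; exists c.
have [t0 t00 Ht0] : exists2 t0 : R, 0 < t0 & forall i : 'I_N, t0 <= (p (cc i)).2.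
  have F : \forall t \near (0 : R)^'+, forall i : 'I_N, t <= (p (cc i)).2.
    by apply: filter_forall => i; apply: nbhs_right_le; have [] := Hp _ (ccC i).
  by have [t [t0 Ht]] := filter_ex (filterI (nbhs_right_gt 0) F); exists t.
have push (i : 'I_N) x t : closure Omega x -> closure [set y | zeta i y != 0] x ->
    0 < t <= t0 -> Omega (x + t *: ev i).
  move=> Cx Kx /andP[tp tt0]; have [_ _ Hpush] := Hp _ (ccC i).
  apply: Hpush => //; last by rewrite tp (le_trans tt0).
  pose B := [set y : 'rV[R]_n | dot (y - cc i) (y - cc i) <= 2 * (p (cc i)).1.2 ^+ 2].
  have clB : closed B by exact: closed_dot_le.
  suff : B x by [].
  rewrite (iffLR (closure_id _) clB); apply: closureS Kx => y /= zy.
  rewrite /B /= leNgt; apply: contra zy => yB.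
  by rewrite /zeta /Z /b ball_bump0 ?mul0r// ltW.
have [E [C [E0 C0 HV]]] := pushed_variation ev t0 Czeta zeta_support zeta_ge0 zeta_le1
  oV zeta1 L1f fM.
(* [(N + 1) * (C + 1) * e1 = eps / 2] covers both the L^1 distance, at most [N * e1], and the error
   [C * N * e1] in the variation; the other [eps / 2] is left for [t * E * M]. *)
pose e1 := eps / (2 * (N%:R + 1) * (C + 1)).
have N1 : 0 < N%:R + 1 :> R by rewrite ltr_wpDl.
have C1 : 0 < C + 1 by rewrite ltr_wpDl.
have e10 : 0 < e1 by rewrite divr_gt0// mulr_gt0// mulr_gt0.
have h0 (i : 'I_N) : harmonic k *: ev i @[k --> \oo] --> (0 : 'rV[R]_n).
  rewrite -(scale0r (ev i)); apply: cvgZ; [exact: cvg_harmonic|exact: cvg_cst].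
have F1 : \forall k \near \oo, forall i, (shift_dist f (harmonic k *: ev i) <= e1%:E)%E.
  apply: filter_forall => i.
  by have [_] := L1_shift_continuous (h0 i) L1f; apply.
have F2 : \forall k \near \oo, harmonic k <= t0.
  by apply: (cvgr_le 0) => //; exact: cvg_harmonic.
have EM : 0 < 2 * (E * `|M| + 1) by rewrite mulr_gt0// ltr_wpDl// mulr_ge0.
have F3 : \forall k \near \oo, harmonic k <= eps / (2 * (E * `|M| + 1)).
  by apply: (cvgr_le 0); [exact: cvg_harmonic|exact: divr_gt0].
have [k [[Hk1 Hk2] Hk3]] := filter_ex (filterI (filterI F1 F2) F3).
set t := harmonic k in Hk1 Hk2 Hk3.
have tp : 0 < t by rewrite invr_gt0.
have tt0 : 0 < t <= t0 by rewrite tp.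
have [d d0 Hd] := push_margin oV cO OV push oO tt0.
pose D i := fine (shift_dist f (t *: ev i)).
have HD i : shift_dist f (t *: ev i) = (D i)%:E.
  rewrite /D fineK// ge0_fin_numE; first exact: le_lt_trans (Hk1 i) (ltry _).
  by apply: integral_ge0.
have De i : D i <= e1 by rewrite -lee_fin -HD.
have SD : \sum_i D i <= N%:R * e1.
  rewrite (@le_trans _ _ (\sum_(i < N) e1))//; first exact: ler_sum.
  by rewrite sumr_const card_ord mulr_natl.
have NE : N%:R * e1 + C * (N%:R * e1) + (C + 1) * e1 = eps / 2.
  by rewrite /e1; field; rewrite !gt_eqF.
have s0 : 0 <= N%:R * e1 by rewrite mulr_ge0// ltW.
have Cs0 : 0 <= C * (N%:R * e1) by exact: mulr_ge0.
have Ce0 : 0 <= (C + 1) * e1 by rewrite mulr_ge0// ltW.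
exists (pushed zeta ev f t), d, (push_domain zeta ev V Omega t); split => //.
- exact: L1_pushed.
- apply: le_trans (pushed_near _ Czeta zeta_ge0 zeta_le1 L1f t) _.
  under eq_bigr do rewrite HD.
  by rewrite sumEFin lee_fin (le_trans SD)//; lra.
- apply: le_trans (HV _ _ tt0 HD) _.
  rewrite lee_fin.
  have CD : C * \sum_i D i <= C * (N%:R * e1) by rewrite ler_wpM2l.
  have tM : t * (E * `|M| + 1) <= eps / 2.
    rewrite (le_trans (ler_wpM2r _ Hk3))//; first by rewrite addr_ge0// mulr_ge0.
    rewrite le_eqVlt; apply/orP; left; apply/eqP; field.
    by rewrite gt_eqF// ltr_wpDl// mulr_ge0.
  have tE : t * E * M <= t * E * `|M|.
    by rewrite ler_wpM2l ?ler_norm// mulr_ge0// ltW.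
  lra.
Qed.

End lipschitz_push.

(** * Recovery family *)

Section recovery.
Context {R : realType}.

(** Each [P k] holds near 1, but on a neighbourhood that depends on [k]; the index must therefore
    grow slowly enough with [a]. *)
Lemma diagonal_selection (P : nat -> R -> Prop) :
  (forall k, \forall a \near (1 : R)^'-, P k a) ->
  exists kappa : R -> nat, (forall K, \forall a \near (1 : R)^'-, (K <= kappa a)%N) /\
    \forall a \near (1 : R)^'-, P (kappa a) a.
Proof.
move=> HP; pose m (a : R) := Num.truncn (1 - a)^-1.
pose kappa (a : R) := (\max_(k < (m a).+1 | `[< P k a >]) k)%N.
(* [kappa a] is the largest [k <= 1 / (1 - a)] for which [P k a] holds. *)
exists kappa; split=> [K|].
  have K1 : 0 < K.+1%:R^-1 :> R by rewrite invr_gt0.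
  near=> a.
  have PK : P K a by near: a; exact: HP.
  have /andP[aK a1] : 1 - K.+1%:R^-1 <= a < 1.
    by near: a; apply: near_alpha; rewrite gtrBl.
  have a10 : 0 < 1 - a by rewrite subr_gt0.
  have Ka : (K < (m a).+1)%N.
    rewrite ltnS /m truncn_ge_nat ?invr_ge0 ?(ltW a10)//.
    rewrite (@le_trans _ _ K.+1%:R) ?ler_nat// -[K.+1%:R]invrK lef_pV2 ?posrE//.
    by rewrite lerBlDl -lerBlDr.
  apply: (@leq_bigmax_cond _ (fun k : 'I_(m a).+1 => `[< P k a >]) (fun k => nat_of_ord k)
    (Ordinal Ka)).
  exact/asboolP.
(* [P 0] makes the index set nonempty, so the maximum is attained at an index satisfying [P]; an
   empty maximum would be 0 without that property. *)
have := HP 0%N; apply: filterS => a P0.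
have [|k] := @eq_bigmax_cond _ (fun k : 'I_(m a).+1 => `[< P k a >]) (fun k => nat_of_ord k).
  by apply/card_gt0P; exists ord0; apply/asboolP.
by move=> /asboolP Pk kE; rewrite /kappa kE.
Unshelve. all: by end_near. Qed.

Lemma cvg_ge0_squeeze (u : R -> \bar R) (v : R -> R) : (forall a, 0 <= u a)%E ->
  (\forall a \near (1 : R)^'-, (u a <= (v a)%:E)%E) ->
  v a @[a --> (1 : R)^'-] --> (0 : R) -> u a @[a --> (1 : R)^'-] --> 0%E.
Proof.
move=> u0 uv v0; apply: (@squeeze_cvge _ _ _ _ (fun=> 0%E) _ (fun a => (v a)%:E)).
- by near=> a; rewrite u0/=; near: a; exact: uv.
- exact: cvg_cst.
- by apply: cvg_EFin => //; exact: nearW.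
Unshelve. all: by end_near. Qed.

Lemma frac_variation_limsup n (U Omega : set 'rV[R]_n) g (M d e : R) :
  (0 < n)%N -> L1 g -> 0 < d ->
  (forall x z : 'rV[R]_n, Omega x -> dot z z < d -> U (x + z)) ->
  (total_var g U <= M%:E)%E -> 0 < e ->
  \forall a \near (1 : R)^'-, (frac_variation a g Omega <= (M + e)%:E)%E.
Proof.
move=> n0 L1g d0 OU gM e0; have [N N0 NE] := L1_norm_lt L1g.
(* The cut stays fixed as [a -> 1]: below the margin [d], so that translates remain in [U], and at
   most 1 for the far estimate. *)
pose b := Num.min 1 d.
have b0 : 0 < b by rewrite lt_min ltr01.
have b01 : 0 < b <= 1 by rewrite b0 ge_min lexx.
have OU' (x z : 'rV[R]_n) : Omega x -> dot z z < b -> U (x + z).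
  by move=> Ox; rewrite lt_min => /andP[_]; exact: OU.
have C : kmass n a b * M + N * (mu_frac (n := n) a * farc n b) @[a --> (1 : R)^'-] --> M.
  have -> : nbhs M = nbhs (1 * M + N * (0 * farc n b)) by rewrite mul1r mul0r mulr0 addr0.
  apply: cvgD; first by apply: cvgM; [exact: kmass_cvg1|exact: cvg_cst].
  apply: cvgM; first exact: cvg_cst.
  by apply: cvgM; [exact: mu_frac_cvg0|exact: cvg_cst].
near=> a; apply: (@le_trans _ _ (kmass n a b * M + N * (mu_frac (n := n) a * farc n b))%:E).
  by apply: frac_variation_le OU' gM => //; near: a; exact: near_half.
rewrite lee_fin; near: a; apply: (cvgr_le M) => //.
by rewrite ltrDl.
Unshelve. all: by end_near. Qed.

Lemma total_var_ge0 n (g : 'rV[R]_n -> R) U : (0 <= total_var g U)%E.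
Proof.
have C0 := @Cc_infty0 R n U.
have t0 : test_field U (fun=> 0 : 'rV[R]_n).
  by apply/test_fieldP; split=> // x; rewrite enorm0.
suff <- : distr_grad g (fun=> 0) = 0%E by apply: ereal_sup_ubound; exists (fun=> 0).
rewrite /distr_grad integral0_eq ?oppe0// => x _.
by rewrite off_support_divergence ?mulr0// => /(_ setT filterT)[y []]; rewrite /= eqxx.
Qed.

Lemma total_var_le n (g : 'rV[R]_n -> R) U V : U `<=` V -> (total_var g U <= total_var g V)%E.
Proof.
move=> UV; apply: ge_ereal_sup => _ [phi tp <-]; apply: ereal_sup_ubound.
by exists phi => //; exact: test_field_sub tp.
Qed.

End recovery.

Theorem theorem4p17 (R : realType) (n : nat) (n_ge1 : (1 <= n)%N)
    (Omega : set 'rV[R]_n) (oOmega : open Omega)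
    (hOmega : (bounded_set Omega /\ lipschitz_boundary Omega) \/ Omega = setT)
    (f : 'rV[R]_n -> R) (fBV : BV_Rn f) :
  Gamma_L1_lim (fun alpha g => frac_variation alpha g Omega) f
    (total_var f Omega).
Proof.
have [L1f fT] := fBV.
split=> [fam cfam|].
  apply: ge_ereal_sup => _ [phi tphi <-].
  exact: frac_variation_liminf.
have [M fM] : exists M : R, total_var f Omega = M%:E.
  exists (fine (total_var f Omega)); rewrite fineK// ge0_fin_numE ?total_var_ge0//.
  by apply: le_lt_trans fT; exact: total_var_le.
have R0 (k : nat) : exists p : ('rV[R]_n -> R) * R * set 'rV[R]_n, [/\ L1 p.1.1,
    (\int[leb n]_x `|p.1.1 x - f x|%:E <= (k.+1%:R^-1)%:E)%E, 0 < p.1.2,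
    (forall x z, Omega x -> dot z z < p.1.2 -> p.2 (x + z)) &
    (total_var p.1.1 p.2 <= (M + k.+1%:R^-1)%:E)%E].
  have e0 : 0 < k.+1%:R^-1 :> R by rewrite invr_gt0.
  case: hOmega => [[bO lO]|OT]; last first.
    (* On the whole space every translate of a test field is one, so any margin does. *)
    exists (f, 1, setT); split => //=.
    - rewrite integral0_eq ?lee_fin ?ltW// => x _; by rewrite subrr normr0.
    - by rewrite -OT fM lee_fin lerDl ltW.
  have [g [d [U [? ? ? ? ?]]]] := recovery_lipschitz oOmega bO lO L1f fM e0.
  by exists (g, d, U).
have [p Hp] := choice R0.
(* One [1 / (k + 1)] comes from the variation of the k-th approximation, the other from letting
   [a -> 1] with that approximation fixed. *)
pose P k a := (frac_variation a (p k).1.1 Omega <= (M + k.+1%:R^-1 + k.+1%:R^-1)%:E)%E.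
have [|kappa [Kinf KP]] := @diagonal_selection R P.
  move=> k; have [L1p _ d0 OU pM] := Hp k.
  by apply: (frac_variation_limsup n_ge1 L1p d0 OU pM); rewrite invr_gt0.
have kcvg : (kappa a).+1%:R^-1 @[a --> (1 : R)^'-] --> (0 : R).
  apply/cvgr0Pnorm_le => e e0.
  near=> a; rewrite ger0_norm ?invr_ge0// invf_ple ?posrE//.
  rewrite ltW// (lt_le_trans (truncnS_gt _))// ler_nat ltnS.
  by near: a; exact: Kinf.
exists (fun a => (p (kappa a)).1.1).
  split=> [a _|]; first by case: (Hp (kappa a)).
  apply: cvg_ge0_squeeze kcvg => [a|]; first exact: Lnorm_ge0.
  by near=> a; rewrite Lnorm1; case: (Hp (kappa a)).
rewrite fM; apply: limf_esup_le => e e0.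
near=> a; apply: (@le_trans _ _ (M + (kappa a).+1%:R^-1 + (kappa a).+1%:R^-1)%:E).
  by near: a; exact: KP.
rewrite lee_fin -addrA lerD2l (splitr e).
have : (kappa a).+1%:R^-1 <= e / 2 by near: a; apply: (cvgr_le 0) => //; rewrite divr_gt0.
by move=> H; exact: lerD.
Unshelve. all: by end_near. Qed.
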